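(* Let $X$ be a smooth, complete and connected curve over a perfect field $k$, such that $k$ is algebraically closed in the function field $\Sigma_X$ and $X$ has a $k$-rational point. Assume that $k$ is either finite or algebraically closed. Then there is an exact sequence of groups $$0 \to \operatorname{Hom}_{\mathrm{gr}}\big(\operatorname{Pic}^0(X),k^{*}\big) \to (\Sigma_X^{*})^{\perp\!\!\!\perp}\big/\big(\Sigma_X^{*}\prod_{x\in X}N_x\big) \to \operatorname{Pic}^0(X),$$ where the last arrow is the map induced by sending an idele $\alpha$ to its divisor $D(\alpha)$. Moreover, for $k=\mathbb{C}$ the last arrow is surjective.
   Context: Notation: $x\in X$ always denotes a closed point of $X$. $\Sigma_X$ is the function field; $v_x$ is the normalized discrete valuation at $x$; $\widehat{\mathcal O}_{X,x}$ is the completion of the local ring at $x$, with maximal ideal $\widehat{\mathfrak m}_x$, fraction field $K_x$ and residue field $k(x)$; $\deg(x)=[k(x):k]$. A choice of uniformizer $t_x$ gives $\widehat{\mathcal O}_{X,x}\simeq k(x)[[t_x]]$, so $\widehat{\mathcal O}_{X,x}^*\simeq k(x)^*\times(1+\widehat{\mathfrak m}_x)$. The adele ring is $\mathbb A_X=\prod'_{x}K_x$ (restricted product with respect to the $\widehat{\mathcal O}_{X,x}$), and the idele group is $\mathbb I_X=\mathbb A_X^*$. The divisor of an idele $\alpha=(\alpha_x)$ is $D(\alpha)=\sum_x v_x(\alpha_x)\,x$, and $\mathbb I_X^1=\{\alpha\in\mathbb I_X : \sum_x\deg(x)v_x(\alpha_x)=0\}$. Let $\bar{\mathbb I}_X^1=\mathbb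 I_X^1/\prod_{x}(1+\widehat{\mathfrak m}_x)$. Global pairing $\langle\cdot,\cdot\rangle:\mathbb I_X\times\mathbb I_X\to k^*$: $$\langle\alpha,\beta\rangle=\prod_{x}(-1)^{\deg(x)v_x(\alpha_x)v_x(\beta_x)}N_{k(x)/k}\Big(\frac{\alpha_x^{v_x(\beta_x)}}{\beta_x^{v_x(\alpha_x)}}(x)\Big),$$ where $(x)$ denotes the residue class in $k(x)$. It is bimultiplicative, it is trivial on $\Sigma_X^*\times\Sigma_X^*$ (Weil reciprocity, $\Sigma_X^*$ being embedded diagonally), and $\prod_x(1+\widehat{\mathfrak m}_x)$ pairs trivially with everything, so it induces a pairing on $\bar{\mathbb I}_X^1$. Since $\Sigma_X^*\cap\prod_x(1+\widehat{\mathfrak m}_x)=\{1\}$, $\Sigma_X^*$ is regarded as a subgroup of $\bar{\mathbb I}_X^1$. For $G\subseteq\bar{\mathbb I}_X^1$, $G^{\perp\!\!\!\perp}=\{\alpha\in\bar{\mathbb I}_X^1:\langle\alpha,g\rangle=1\ \forall g\in G\}$; thus $\Sigma_X^*\subseteq(\Sigma_X^* )^{\perp\!\!\!\perp}$. $N_x=\{\lambda\in k(x):N_{k(x)/k}(\lambda)=1\}$, and $\prod_xN_x$ is regarded as a subgroup of $\prod_xk(x)^*\subset\bar{\mathbb I}_X^1$. $\operatorname{Pic}^0(X)$ is the group of degree-zero divisors on $X$ modulo divisors of functions in $\Sigma_X^*$. $\operatorname{Hom}_{\mathrm{gr}}$ denotes homomorphisms of abstract groups (no topology). *)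

(* Defs.v *)
From HB Require Import structures.
From mathcomp Require Import all_boot all_order all_algebra all_field.
From mathcomp Require Import generic_quotient ring_quotient.
From mathcomp Require Import mathcomp_extra boolp classical_sets functions.
From mathcomp Require Import cardinality fsbigop.
From mathcomp Require Import reals.
From mathcomp Require Import complex.

Set Implicit Arguments.
Unset Strict Implicit.
Unset Printing Implicit Defensive.

Import Order.TTheory GRing.Theory Num.Theory.

Local Open Scope classical_set_scope.
Local Open Scope ring_scope.

(* All the groups below are abelian and carry MathComp's [zmodType] structure.
   Hence the product of two ideles (or of two elements of a group [F^*]) is
   written [+], the unit idele [0], and the inverse [-]. *)

Definition perfect_field (k : fieldType) : Prop :=
  forall p : {poly k}, irreducible_poly p -> separable_poly p.

Definition is_complex (k : fieldType) : Prop :=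
  exists (R : realType) (phi : {rmorphism k -> R[i]}), bijective phi.

Section MulGroup.
Variable F : fieldType.

Definition mulgrp : Type := {a : F | a != 0}.
HB.instance Definition _ := Choice.on mulgrp.

Definition mulgrp_one : mulgrp := exist _ 1 (oner_neq0 F).
Definition mulgrp_mul (a b : mulgrp) : mulgrp :=
  exist _ (sval a * sval b) (mulf_neq0 (svalP a) (svalP b)).
Definition mulgrp_inv (a : mulgrp) : mulgrp :=
  exist _ (sval a)^-1 (invr_neq0 (svalP a)).

Fact mulgrp_mulA : associative mulgrp_mul.
Proof. by move=> a b c; apply: val_inj; rewrite /= mulrA. Qed.
Fact mulgrp_mulC : commutative mulgrp_mul.
Proof. by move=> a b; apply: val_inj; rewrite /= mulrC. Qed.
Fact mulgrp_mul1 : left_id mulgrp_one mulgrp_mul.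
Proof. by move=> a; apply: val_inj; rewrite /= mul1r. Qed.
Fact mulgrp_mulV : left_inverse mulgrp_one mulgrp_inv mulgrp_mul.
Proof. by move=> a; apply: val_inj; rewrite /= mulVf// (svalP a). Qed.

HB.instance Definition _ :=
  GRing.isZmodule.Build mulgrp mulgrp_mulA mulgrp_mulC mulgrp_mul1 mulgrp_mulV.

Lemma mulgrpD (a b : mulgrp) : sval (a + b) = sval a * sval b.
Proof. by []. Qed.
Lemma mulgrp0 : sval (0 : mulgrp) = 1. Proof. by []. Qed.
Lemma mulgrpN (a : mulgrp) : sval (- a) = (sval a)^-1. Proof. by []. Qed.
Lemma mulgrp_neq0 (a : mulgrp) : sval a != 0. Proof. exact: (svalP a). Qed.

End MulGroup.

(* The norm of a finite extension: the determinant of the multiplication. *)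
Definition normf (k : fieldType) (L : fieldExtType k) (a : L) : k :=
  \det (passmx.mxof (vbasis {:L}) (vbasis {:L}) (amull a)).

Section Norm.
Variables (k : fieldType) (L : fieldExtType k).

Lemma normfM (a b : L) : normf (a * b) = normf a * normf b.
Proof.
have bas := vbasisP (fullv : {vspace L}).
have abE : amull (a * b) = (amull a \o amull b)%VF.
  by apply/lfunP => c; rewrite comp_lfunE !lfunE /= mulrA.
by rewrite /normf abE (passmx.mxof_comp _ _ bas) det_mulmx mulrC.
Qed.

Lemma normf1 : normf (1 : L) = 1.
Proof.
have bas := vbasisP (fullv : {vspace L}).
by rewrite /normf amull1 passmx.mxof1 ?det1// (basis_free bas).
Qed.

End Norm.

Section Hom.
Variables U V : zmodType.

Definition hom_pred : {pred U -> V} := fun f => `[< zmod_morphism f >].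

Fact hom_pred_closed : zmod_closed hom_pred.
Proof.
split=> [|f g /asboolP fM /asboolP gM]; apply/asboolP => x y /=.
  by rewrite subr0.
by rewrite !fctE fM gM !opprD addrACA.
Qed.
HB.instance Definition _ := GRing.isZmodClosed.Build (U -> V) hom_pred
  hom_pred_closed.

Definition Homgr : Type := {f : U -> V | f \in hom_pred}.
HB.instance Definition _ := SubChoice.on Homgr.
HB.instance Definition _ := [SubChoice_isSubZmodule of Homgr by <:].

End Hom.

Lemma fsbig_split_supp (T : choiceType) (R : eqType) (idx : R)
    (op : Monoid.com_law idx) (S : set T) (f g : T -> R) : finite_set S ->
  (forall x, ~ S x -> f x = idx) -> (forall x, ~ S x -> g x = idx) ->
  \big[op/idx]_(x \in [set: T]) op (f x) (g x) =
  op (\big[op/idx]_(x \in [set: T]) f x) (\big[op/idx]_(x \in [set: T]) g x).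
Proof.
move=> finS f1 g1.
have w h : (forall x, ~ S x -> h x = idx) ->
    \big[op/idx]_(x \in [set: T]) h x = \big[op/idx]_(x \in S) h x.
  by move=> h1; apply/esym/fsbig_widen => // x [_ Sx]; exact: h1.
rewrite (w f)// (w g)// -fsbig_split//; apply: w => x Sx.
by rewrite f1// g1// Monoid.mul1m.
Qed.

(* The value at [0] (which should be [+oo]) is irrelevant. *)
Record discrete_valuation (F : fieldType) (v : F -> int) : Prop := {
  dvalM : forall a b, a != 0 -> b != 0 -> v (a * b) = v a + v b;
  dvalD : forall a b, a != 0 -> b != 0 -> a + b != 0 ->
    Num.min (v a) (v b) <= v (a + b);
  dval_uniformizer : exists2 t, t != 0 & v t = 1 }.

Definition val_ge (F : fieldType) (v : F -> int) (n : int) (a : F) : bool :=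
  (a == 0) || (n <= v a).

Section ValTheory.
Variables (F : fieldType) (v : F -> int) (vP : discrete_valuation v).

Lemma dval1 : v 1 = 0.
Proof.
by apply: (addrI (v 1)); rewrite -(dvalM vP) ?oner_neq0// mulr1 addr0.
Qed.

Lemma dvalV a : a != 0 -> v a^-1 = - v a.
Proof.
move=> a0; apply/eqP; rewrite -addr_eq0 -(dvalM vP) ?invr_eq0//.
by rewrite mulVf// dval1.
Qed.

Lemma dvalX a (n : nat) : a != 0 -> v (a ^+ n) = v a *+ n.
Proof.
move=> a0; elim: n => [|n IHn]; first by rewrite expr0 dval1.
by rewrite exprS (dvalM vP) ?expf_neq0// IHn mulrS.
Qed.

Lemma dvalXz a (n : int) : a != 0 -> v (a ^ n) = v a * n.
Proof.
move=> a0; case: n => n; first by rewrite -exprnP dvalX// -mulr_natr natz.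
by rewrite NegzE -exprnN dvalV ?expf_neq0// dvalX// -mulr_natr natz mulrN.
Qed.

Lemma dvalN1 : v (-1) = 0.
Proof.
have := dvalM vP (a := -1) (b := -1); rewrite oppr_eq0 oner_eq0 => /(_ isT isT).
rewrite mulrNN mulr1 dval1 => /esym/eqP; rewrite -mulr2n mulrn_eq0 /=.
by move/eqP.
Qed.

Lemma val_geD n a b : val_ge v n a -> val_ge v n b -> val_ge v n (a + b).
Proof.
rewrite /val_ge; have [->|a0] := eqVneq a 0; first by rewrite add0r.
have [->|b0] /= := eqVneq b 0; first by rewrite addr0 (negPf a0).
have [//|ab0] /= := eqVneq (a + b) 0 => na nb.
by apply: le_trans (dvalD vP a0 b0 ab0); rewrite le_min na.
Qed.

Lemma val_geM m n a b :
  val_ge v m a -> val_ge v n b -> val_ge v (m + n) (a * b).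
Proof.
rewrite /val_ge mulf_eq0; have [//|a0] /= := eqVneq a 0.
by have [//|b0] /= := eqVneq b 0 => ma nb; rewrite (dvalM vP)// lerD.
Qed.

Lemma val_geN n a : val_ge v n a -> val_ge v n (- a).
Proof.
rewrite /val_ge oppr_eq0; have [//|a0] /= := eqVneq a 0.
by rewrite -mulN1r (dvalM vP) ?oppr_eq0 ?oner_eq0// dvalN1 add0r.
Qed.

Lemma val_ge_unit a : val_ge v 1 (a - 1) -> a != 0 -> v a = 0.
Proof.
move=> a1 a0; apply/eqP; rewrite eq_le.
have v1 : val_ge v 0 1 by rewrite /val_ge dval1 lexx orbT.
have a1' : val_ge v 0 (a - 1).
  by move: a1; rewrite /val_ge => /orP[->//|?];
    rewrite (le_trans _ (_ : 1 <= _))// orbT.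
have := val_geD a1' v1; rewrite subrK /val_ge (negPf a0) /= => ->.
rewrite andbT.
rewrite leNgt; apply/negP => va.
have : val_ge v 1 (a - (a - 1)).
  by apply: val_geD; [rewrite /val_ge -gtz0_ge1 va orbT | apply: val_geN].
by rewrite opprB addrC subrK /val_ge oner_eq0 dval1.
Qed.

End ValTheory.

(* A smooth, complete, connected curve over a (perfect) field [k], presented
   by its function field and its closed points.
   - [fun_field_trdeg1]: the function field is finite over [k(t)] for some [t]
     transcendental over [k], i.e. finitely generated of transcendence
     degree 1 over [k].
   - [pval x] is the normalized valuation of the local ring at [x]: this ring
     is a discrete valuation ring containing [k], with fraction field
     [fun_field].
   - [curve_complete] is the valuative criterion: each discrete valuation ring
     of [fun_field] containing [k] is the local ring of exactly one closed
     point. Existence is properness, uniqueness is separatedness. *)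
Record curve (k : fieldType) := Curve {
  fun_field : fieldType;
  constf : {rmorphism k -> fun_field};
  fun_field_trdeg1 : exists2 t : fun_field, ~ algebraicOver constf t &
    exists (n : nat) (b : 'I_n -> fun_field), forall f : fun_field,
    exists (q : {poly k}) (p : 'I_n -> {poly k}), q != 0 /\
      f * (map_poly constf q).[t] = \sum_i (map_poly constf (p i)).[t] * b i;
  closed_point : choiceType;
  pval : closed_point -> fun_field -> int;
  pvalP : forall x, discrete_valuation (pval x);
  pval_const : forall x (c : k), c != 0 -> pval x (constf c) = 0;
  curve_complete : forall v : fun_field -> int, discrete_valuation v ->
    (forall c : k, c != 0 -> v (constf c) = 0) ->
    exists! x : closed_point, forall f, f != 0 -> pval x f = v f }.

Definition alg_closed_in_fun_field (k : fieldType) (X : curve k) : Prop :=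
  forall f : fun_field X, algebraicOver (constf X) f ->
    exists c : k, f = constf X c.

(* A completion [lfield] of the function field at [x], with its valuation
   [lval], together with the residue field [rfield] and the residue map [res]
   (significant only on the valuation ring [val_ge lval 0]). These data are
   unique up to a unique isomorphism; the residue field of a closed point is a
   finite extension of [k], whence [fieldExtType k]. *)
Record completion (k : fieldType) (X : curve k) (x : closed_point X) :=
Completion {
  lfield : fieldType;
  embed : {rmorphism fun_field X -> lfield};
  lval : lfield -> int;
  lvalP : discrete_valuation lval;
  lval_embed : forall f, f != 0 -> lval (embed f) = pval x f;
  lfield_dense : forall (a : lfield) (n : int),
    exists f, val_ge lval n (a - embed f);
  lfield_complete : forall u : nat -> lfield,
    (forall n : int, exists m : nat, forall i j : nat,
      (m <= i)%N -> (m <= j)%N -> val_ge lval n (u i - u j)) ->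
    exists l : lfield, forall n : int, exists m : nat, forall i : nat,
      (m <= i)%N -> val_ge lval n (u i - l);
  rfield : fieldExtType k;
  res : lfield -> rfield;
  resD : forall a b, val_ge lval 0 a -> val_ge lval 0 b ->
    res (a + b) = res a + res b;
  resM : forall a b, val_ge lval 0 a -> val_ge lval 0 b ->
    res (a * b) = res a * res b;
  res_const : forall c : k, res (embed (constf X c)) = c%:A;
  res_eq0 : forall a, val_ge lval 0 a -> (res a == 0) = val_ge lval 1 a;
  res_surj : forall l : rfield, exists2 a, val_ge lval 0 a & res a = l }.

Section Adelic.
Variables (k : fieldType) (X : curve k).
Variable K : forall x : closed_point X, completion x.

Local Notation v x := (@lval _ _ _ (K x)).
Local Notation rs x := (@res _ _ _ (K x)).

Definition pdeg (x : closed_point X) : nat := \dim {: rfield (K x)}.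

Definition has_rational_point : Prop := exists x, pdeg x = 1%N.

Definition div_pred : {pred closed_point X -> int} :=
  fun D => `[< finite_set [set x | D x != 0] >].

Fact div_pred_closed : zmod_closed div_pred.
Proof.
split=> [|D E /asboolP fD /asboolP fE]; apply/asboolP.
  by apply: sub_finite_set (finite_set0 _) => x /eqP; apply.
have fDE : finite_set ([set x | D x != 0] `|` [set x | E x != 0]).
  by rewrite finite_setU.
apply: sub_finite_set fDE => x /=; rewrite !fctE.
have [->|] := eqVneq (D x) 0; last by left.
by rewrite sub0r oppr_eq0; right.
Qed.
HB.instance Definition _ := GRing.isZmodClosed.Build (closed_point X -> int)
  div_pred div_pred_closed.

Definition Div : Type := {D : closed_point X -> int | D \in div_pred}.
HB.instance Definition _ := SubChoice.on Div.
HB.instance Definition _ := [SubChoice_isSubZmodule of Div by <:].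

Definition div_degree (D : Div) : int :=
  \sum_(x \in [set: closed_point X]) (pdeg x)%:Z * sval D x.

Lemma div_degreeB (D E : Div) :
  div_degree (D - E) = div_degree D - div_degree E.
Proof.
suff dD A B : div_degree (A + B) = div_degree A + div_degree B.
  by apply/eqP; rewrite eq_sym subr_eq -dD subrK.
have /asboolP fA := svalP A; have /asboolP fB := svalP B.
have fAB : finite_set ([set x | sval A x != 0] `|` [set x | sval B x != 0]).
  by rewrite finite_setU.
rewrite /div_degree -(fsbig_split_supp _ fAB)/=.
- by apply: eq_fsbigr => x _; rewrite -mulrDr.
- by move=> x /not_orP[/negP/negPn/eqP-> _]; rewrite mulr0.
- by move=> x /not_orP[_ /negP/negPn/eqP->]; rewrite mulr0.
Qed.

Definition div0_pred : {pred Div} := fun D => div_degree D == 0.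

Fact div0_pred_closed : zmod_closed div0_pred.
Proof.
split=> [|D E /eqP dD /eqP dE]; rewrite unfold_in.
  by rewrite -(subrr 0) div_degreeB subrr.
by rewrite /div0_pred div_degreeB dD dE subrr.
Qed.
HB.instance Definition _ := GRing.isZmodClosed.Build Div div0_pred
  div0_pred_closed.

Definition Div0 : Type := {D : Div | D \in div0_pred}.
HB.instance Definition _ := SubChoice.on Div0.
HB.instance Definition _ := [SubChoice_isSubZmodule of Div0 by <:].

(* The divisor of a nonzero function always is in [Div0], so asking for it
   through [D : Div0] does not restrict [f]. *)
Definition principal_div : {pred Div0} := fun D =>
  `[< exists2 f : fun_field X, f != 0 &
        forall x, sval (sval D) x = pval x f >].

Fact principal_div_closed : zmod_closed principal_div.
Proof.
split=> [|D E /asboolP[f f0 fE] /asboolP[g g0 gE]]; apply/asboolP.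
  by exists 1; [exact: oner_neq0 | move=> x; rewrite (dval1 (pvalP x))].
exists (f / g); first by rewrite mulf_neq0 ?invr_eq0.
move=> x; rewrite (dvalM (pvalP x)) ?invr_eq0// (dvalV (pvalP x))//.
by rewrite -fE -gE.
Qed.
HB.instance Definition _ := GRing.isZmodClosed.Build Div0 principal_div
  principal_div_closed.

Definition Pic0 : zmodType := Quotient.quot principal_div.

Definition div_class (D : Div0) : Pic0 :=
  \pi_(Quotient.quot principal_div)%qT D.

(* An idele is a unit of the restricted product of the fields [lfield (K x)]:
   a family of nonzero elements, almost all of valuation 0. *)
Record idele : Type := Idele {
  icomp : forall x : closed_point X, mulgrp (lfield (K x));
  icomp_fin : finite_set [set x | v x (sval (icomp x)) != 0] }.

HB.instance Definition _ := gen_eqMixin idele.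
HB.instance Definition _ := gen_choiceMixin idele.

Lemma ideleP (a b : idele) : (forall x, icomp a x = icomp b x) -> a = b.
Proof.
case: a b => [a fa] [b fb] /= eq_ab.
have ab : a = b by exact: functional_extensionality_dep.
by move: fa; rewrite ab => fa; rewrite (Prop_irrelevance fa fb).
Qed.

Fact idele_one_fin :
  finite_set [set x | v x (sval (0 : mulgrp (lfield (K x)))) != 0].
Proof.
apply: sub_finite_set (finite_set0 _) => x /=.
by rewrite (dval1 (lvalP (K x))) eqxx.
Qed.

Fact idele_mul_fin (a b : idele) :
  finite_set [set x | v x (sval (icomp a x + icomp b x)) != 0].
Proof.
have fab : finite_set ([set x | v x (sval (icomp a x)) != 0] `|`
                       [set x | v x (sval (icomp b x)) != 0]).
  by rewrite finite_setU; split; exact: icomp_fin.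
apply: sub_finite_set fab => x /=.
rewrite (dvalM (lvalP (K x))) ?mulgrp_neq0//.
have [->|] := eqVneq (v x (sval (icomp a x))) 0; last by left.
by rewrite add0r; right.
Qed.

Fact idele_inv_fin (a : idele) :
  finite_set [set x | v x (sval (- icomp a x)) != 0].
Proof.
apply: sub_finite_set (icomp_fin a) => x /=.
by rewrite (dvalV (lvalP (K x))) ?mulgrp_neq0// oppr_eq0.
Qed.

Definition idele_one := Idele idele_one_fin.
Definition idele_mul a b := Idele (idele_mul_fin a b).
Definition idele_inv a := Idele (idele_inv_fin a).

Fact idele_mulA : associative idele_mul.
Proof. by move=> a b c; apply: ideleP => x /=; rewrite addrA. Qed.
Fact idele_mulC : commutative idele_mul.
Proof. by move=> a b; apply: ideleP => x /=; rewrite addrC. Qed.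
Fact idele_mul1 : left_id idele_one idele_mul.
Proof. by move=> a; apply: ideleP => x /=; rewrite add0r. Qed.
Fact idele_mulV : left_inverse idele_one idele_inv idele_mul.
Proof. by move=> a; apply: ideleP => x /=; rewrite addNr. Qed.

HB.instance Definition _ :=
  GRing.isZmodule.Build idele idele_mulA idele_mulC idele_mul1 idele_mulV.

Definition icoord (a : idele) (x : closed_point X) : lfield (K x) :=
  sval (icomp a x).

Lemma icoord_neq0 a x : icoord a x != 0. Proof. exact: mulgrp_neq0. Qed.
Lemma icoordD a b x : icoord (a + b) x = icoord a x * icoord b x.
Proof. by []. Qed.
Lemma icoordN a x : icoord (- a) x = (icoord a x)^-1. Proof. by []. Qed.
Lemma icoord0 x : icoord 0 x = 1. Proof. by []. Qed.

Fact idele_div_subproof (a : idele) :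
  (fun x => v x (icoord a x)) \in div_pred.
Proof. by apply/asboolP; exact: icomp_fin. Qed.

Definition idele_div (a : idele) : Div := 
  exist _ (fun x => v x (icoord a x)) (idele_div_subproof a).

Lemma idele_divB a b : idele_div (a - b) = idele_div a - idele_div b.
Proof.
apply: val_inj; apply: funext => x.
change (v x (icoord a x / icoord b x) = v x (icoord a x) - v x (icoord b x)).
by rewrite (dvalM (lvalP (K x))) ?(dvalV (lvalP (K x))) ?invr_eq0 ?icoord_neq0.
Qed.

Definition idele1_pred : {pred idele} := fun a => idele_div a \in div0_pred.

Fact idele1_pred_closed : zmod_closed idele1_pred.
Proof.
split=> [|a b]; rewrite ![_ \in idele1_pred]unfold_in /idele1_pred.
  by rewrite -(subrr 0) idele_divB subrr rpred0.
by rewrite idele_divB; exact: rpredB.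
Qed.
HB.instance Definition _ := GRing.isZmodClosed.Build idele idele1_pred
  idele1_pred_closed.

Definition idele1 : Type := {a : idele | a \in idele1_pred}.
HB.instance Definition _ := SubChoice.on idele1.
HB.instance Definition _ := [SubChoice_isSubZmodule of idele1 by <:].

Definition idele1_div (a : idele1) : Div0 :=
  exist _ (idele_div (sval a)) (svalP a).

(* The product of the groups [1 + m_x]; it is contained in [idele1]. *)
Definition one_units : {pred idele1} := fun a =>
  `[< forall x, val_ge (v x) 1 (icoord (sval a) x - 1) >].

Fact one_units_closed : zmod_closed one_units.
Proof.
split=> [|a b /asboolP a1 /asboolP b1]; apply/asboolP => x.
  by rewrite icoord0 subrr /val_ge eqxx.
rewrite icoordD icoordN.
have vP := lvalP (K x); have b0 := icoord_neq0 (sval b) x.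
have -> : icoord (sval a) x / icoord (sval b) x - 1 =
    (icoord (sval a) x - 1 - (icoord (sval b) x - 1)) / icoord (sval b) x.
  by rewrite opprB addrA subrK mulrBl mulfV.
rewrite -[1](addr0 (1 : int)); apply: (val_geM vP).
  by apply: (val_geD vP); [exact: a1 | apply: (val_geN vP); exact: b1].
by rewrite /val_ge (dvalV vP)// (val_ge_unit vP (b1 x))// oppr0 lexx orbT.
Qed.
HB.instance Definition _ := GRing.isZmodClosed.Build idele1 one_units
  one_units_closed.

Definition bidele1 : zmodType := Quotient.quot one_units.

Definition bclass (a : idele1) : bidele1 := \pi_(Quotient.quot one_units)%qT a.

Lemma bclassB a b : bclass (a - b) = bclass a - bclass b.
Proof. by rewrite /bclass raddfB. Qed.

Lemma bclass0 : bclass 0 = 0.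
Proof. by rewrite -[X in bclass X](subrr 0) bclassB subrr. Qed.

Lemma bclass_surj (u : bidele1) : exists a, bclass a = u.
Proof. by exists (repr u); rewrite /bclass reprK. Qed.

Lemma bclass_eq a b : bclass a = bclass b -> a - b \in one_units.
Proof. by move/eqP; rewrite /bclass -Quotient.idealrBE. Qed.

Definition local_symbol (x : closed_point X) (a b : lfield (K x)) : k :=
  (-1) ^ ((pdeg x)%:Z * v x a * v x b)
  * normf (rs x (a ^ (v x b) / b ^ (v x a))).

(* A product over all points, almost all the factors of which are 1. *)
Definition pairing (a b : idele) : k :=
  \big[*%R/1]_(x \in [set: closed_point X])
    local_symbol (icoord a x) (icoord b x).

Lemma res1 x : rs x 1 = 1.
Proof. by have := res_const (K x) 1; rewrite !rmorph1 scale1r. Qed.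

Lemma res_unit x (a : lfield (K x)) : val_ge (v x) 1 (a - 1) -> rs x a = 1.
Proof.
have vP := lvalP (K x).
move=> a1.
have a1' : val_ge (v x) 0 (a - 1).
  by move: a1; rewrite /val_ge => /orP[->//|?];
    rewrite (le_trans _ (_ : 1 <= _))// orbT.
have v1 : val_ge (v x) 0 1 by rewrite /val_ge (dval1 vP) lexx orbT.
rewrite -[a](subrK 1) (resD a1' v1) res1.
by move: a1; rewrite -(res_eq0 a1') => /eqP ->; rewrite add0r.
Qed.

Section LocalSymbol.
Variable x : closed_point X.
Implicit Types a b c : lfield (K x).
Let vP := lvalP (K x).

Let val_ge0 a : a != 0 -> v x a = 0 -> val_ge (v x) 0 a.
Proof. by move=> _ a0; rewrite /val_ge a0 lexx orbT. Qed.

Lemma lval_symbol a b : a != 0 -> b != 0 ->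
  v x (a ^ v x b / b ^ v x a) = 0.
Proof.
move=> a0 b0; rewrite (dvalM vP) ?invr_eq0 ?expfz_neq0//.
by rewrite (dvalV vP) ?expfz_neq0// !(dvalXz vP)// mulrC subrr.
Qed.

Lemma symbol_neq0 a b : a != 0 -> b != 0 -> a ^ v x b / b ^ v x a != 0.
Proof. by move=> a0 b0; rewrite mulf_neq0 ?invr_eq0 ?expfz_neq0. Qed.

Lemma local_symbolMl a b c : a != 0 -> b != 0 -> c != 0 ->
  local_symbol (a * b) c = local_symbol a c * local_symbol b c.
Proof.
move=> a0 b0 c0; rewrite /local_symbol (dvalM vP)//.
rewrite mulrACA -normfM mulrDr mulrDl; congr (_ * _).
  by rewrite expfzDr ?oppr_eq0 ?oner_eq0.
rewrite -(resM (val_ge0 (symbol_neq0 a0 c0) (lval_symbol a0 c0))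
               (val_ge0 (symbol_neq0 b0 c0) (lval_symbol b0 c0))).
by rewrite expfzMl expfzDr// invfM mulrACA.
Qed.

Lemma local_symbolC a b : a != 0 -> b != 0 ->
  local_symbol a b * local_symbol b a = 1.
Proof.
move=> a0 b0; rewrite /local_symbol mulrACA -normfM.
rewrite -(resM (val_ge0 (symbol_neq0 a0 b0) (lval_symbol a0 b0))
               (val_ge0 (symbol_neq0 b0 a0) (lval_symbol b0 a0))).
rewrite mulrA divfK ?expfz_neq0// divff ?expfz_neq0//.
rewrite res1 normf1 mulr1 (mulrAC _ (v x b)) -expfzDr ?oppr_eq0 ?oner_eq0//.
by rewrite -mulr2n -mulr_natl -exprz_exp -exprnP sqrrN expr1n exp1rz.
Qed.

Lemma local_symbol_unit a b : val_ge (v x) 1 (a - 1) -> a != 0 ->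
  local_symbol a b = 1.
Proof.
move=> a1 a0; have va := val_ge_unit vP a1 a0.
rewrite /local_symbol va mulr0 mul0r expr0z mul1r divr1.
have resV : rs x a^-1 = 1.
  have := @resM _ _ _ (K x) a a^-1.
  rewrite /val_ge va lexx orbT (dvalV vP)// va oppr0 lexx orbT => /(_ isT isT).
  by rewrite divff// res1 (res_unit a1) mul1r => <-.
have X1 c (n : nat) : c != 0 -> v x c = 0 -> rs x c = 1 -> rs x (c ^+ n) = 1.
  move=> c0 vc rc; elim: n => [|n IHn]; first by rewrite expr0 res1.
  rewrite exprS resM ?rc ?IHn ?mulr1//.
    exact: val_ge0.
  by rewrite /val_ge (dvalX vP)// vc mul0rn lexx orbT.
suff -> : rs x (a ^ v x b) = 1 by rewrite normf1.
case: (v x b) => n; first by rewrite -exprnP X1// res_unit.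
by rewrite NegzE -exprnN -exprVn X1 ?invr_eq0// (dvalV vP)// va oppr0.
Qed.

End LocalSymbol.

Lemma local_symbol1 x (a b : lfield (K x)) : v x a = 0 -> v x b = 0 ->
  local_symbol a b = 1.
Proof.
move=> a0 b0; rewrite /local_symbol a0 b0 mulr0 !expr0z divr1 res1 normf1.
by rewrite mulr1.
Qed.

Let isupp (a : idele) := [set x | v x (sval (icomp a x)) != 0].

Let isuppN a x : ~ isupp a x -> v x (icoord a x) = 0.
Proof. by move/negP/negPn/eqP. Qed.

Lemma pairingDl a b c : pairing (a + b) c = pairing a c * pairing b c.
Proof.
have fabc : finite_set (isupp a `|` isupp b `|` isupp c).
  by rewrite !finite_setU; split; [split|]; exact: icomp_fin.
rewrite /pairing -(fsbig_split_supp _ fabc)/=.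
- by apply: eq_fsbigr => x _; rewrite icoordD local_symbolMl ?icoord_neq0.
- move=> x /not_orP[/not_orP[/isuppN va _] /isuppN vc].
  exact: local_symbol1.
- move=> x /not_orP[/not_orP[_ /isuppN vb] /isuppN vc].
  exact: local_symbol1.
Qed.

Lemma pairingC a b : pairing a b * pairing b a = 1.
Proof.
have fab : finite_set (isupp a `|` isupp b).
  by rewrite finite_setU; split; exact: icomp_fin.
rewrite /pairing -(fsbig_split_supp _ fab)/=.
- by apply: fsbig1 => x _; rewrite local_symbolC ?icoord_neq0.
- by move=> x /not_orP[/isuppN va /isuppN vb]; exact: local_symbol1.
- by move=> x /not_orP[/isuppN va /isuppN vb]; exact: local_symbol1.
Qed.

Lemma pairing_unitl (a : idele1) b : a \in one_units -> pairing (sval a) b = 1.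
Proof.
move=> /asboolP a1; apply: fsbig1 => x _.
by rewrite local_symbol_unit// icoord_neq0.
Qed.

Lemma pairing_neq0 a b : pairing a b != 0.
Proof.
have := pairingC a b; have [->|//] := eqVneq (pairing a b) 0.
by rewrite mul0r => /eqP; rewrite eq_sym oner_eq0.
Qed.

Lemma pairing0l b : pairing 0 b = 1.
Proof.
by apply: (mulfI (pairing_neq0 0 b)); rewrite -pairingDl addr0 mulr1.
Qed.

Lemma pairingBl a b c : pairing (a - b) c = pairing a c / pairing b c.
Proof.
apply: (mulIf (pairing_neq0 b c)).
by rewrite -pairingDl subrK divfK ?pairing_neq0.
Qed.

(* The pairing induced on [bidele1]; see [bpairingE]. *)
Definition bpairing (s t : bidele1) : k :=
  pairing (sval (repr s)) (sval (repr t)).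

Lemma pairing_congl (a b : idele1) c :
  bclass a = bclass b -> pairing (sval a) c = pairing (sval b) c.
Proof.
move=> /bclass_eq/pairing_unitl-/(_ c); rewrite /= pairingBl => ab.
by rewrite -[LHS](divfK (pairing_neq0 (sval b) c)) ab mul1r.
Qed.

Lemma bpairingE (a b : idele1) :
  bpairing (bclass a) (bclass b) = pairing (sval a) (sval b).
Proof.
rewrite /bpairing; set a' := repr _; set b' := repr _.
have ea : bclass a' = bclass a by rewrite /bclass reprK.
have eb : bclass b' = bclass b by rewrite /bclass reprK.
rewrite (pairing_congl _ ea).
apply: (mulIf (pairing_neq0 (sval b') (sval a))).
by rewrite pairingC (pairing_congl _ eb) pairingC.
Qed.

Lemma bpairingBl s t u : bpairing (s - t) u = bpairing s u / bpairing t u.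
Proof.
have [[[a <-] [b <-]] [c <-]] := (bclass_surj s, bclass_surj t, bclass_surj u).
by rewrite -bclassB !bpairingE /= pairingBl.
Qed.

Lemma bpairing_neq0 s t : bpairing s t != 0. Proof. exact: pairing_neq0. Qed.

Definition perp (G : set bidele1) : {pred bidele1} :=
  fun s => `[< forall g, G g -> bpairing s g = 1 >].

Fact perp_closed G : zmod_closed (perp G).
Proof.
split=> [|s t /asboolP sG /asboolP tG]; apply/asboolP => g Gg.
  by rewrite -(subrr 0) bpairingBl divff ?bpairing_neq0.
by rewrite bpairingBl sG// tG// divr1.
Qed.
HB.instance Definition _ G := GRing.isZmodClosed.Build bidele1 (perp G)
  (perp_closed G).

(* [fun_field^*] as a subgroup of [bidele1]: the classes of the diagonal
   families of nonzero functions. Such a family is always an idele of degree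
   0, so asking for it through [a : idele1] does not restrict [f]. *)
Definition principal_ideles : set bidele1 :=
  [set s | exists (a : idele1) (f : fun_field X), [/\ f != 0,
     forall x, icoord (sval a) x = embed (K x) f & s = bclass a]].

(* The product of the norm groups [N_x], where [k(x)^*] is identified with
   [O_x^* / (1 + m_x)]. *)
Definition norm_one_ideles : set bidele1 :=
  [set s | exists a : idele1,
     (forall x, v x (icoord (sval a) x) = 0 /\
                normf (rs x (icoord (sval a) x)) = 1) /\ s = bclass a].

Definition perp_fun : Type := {s : bidele1 | s \in perp principal_ideles}.
HB.instance Definition _ := SubChoice.on perp_fun.
HB.instance Definition _ := [SubChoice_isSubZmodule of perp_fun by <:].

(* The subgroup [fun_field^* * prod_x N_x]. It is contained in [perp_fun], by
   Weil reciprocity and since [norm_one_ideles] pairs trivially with functions,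
   so viewing it as a predicate on [perp_fun] loses nothing. *)
Definition fun_norm_one : {pred perp_fun} := fun s =>
  `[< exists g n,
        [/\ principal_ideles g, norm_one_ideles n & sval s = g + n] >].

Lemma principal_idelesB s t :
  principal_ideles s -> principal_ideles t -> principal_ideles (s - t).
Proof.
move=> [a [f [f0 af ->]]] [b [g [g0 bg ->]]]; exists (a - b), (f / g); split.
- by rewrite mulf_neq0 ?invr_eq0.
- by move=> x; rewrite icoordD icoordN af bg rmorphM fmorphV.
- by rewrite bclassB.
Qed.

Lemma norm_one_idelesB s t :
  norm_one_ideles s -> norm_one_ideles t -> norm_one_ideles (s - t).
Proof.
move=> [a [aN ->]] [b [bN ->]]; exists (a - b); split; last by rewrite bclassB.
move=> x; have [[va na] [vb nb]] := (aN x, bN x).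
have vP := lvalP (K x); have b0 := icoord_neq0 (sval b) x.
have vbV : v x (icoord (sval b) x)^-1 = 0 by rewrite (dvalV vP)// vb oppr0.
rewrite icoordD icoordN; split.
  by rewrite (dvalM vP) ?invr_eq0 ?icoord_neq0// va vbV.
have O0 (c : lfield (K x)) : v x c = 0 -> val_ge (v x) 0 c.
  by rewrite /val_ge => ->; rewrite lexx orbT.
rewrite resM ?O0// normfM na mul1r.
have := congr1 (@normf _ _) (resM (O0 _ vb) (O0 _ vbV)).
by rewrite divff// res1 normf1 normfM nb mul1r.
Qed.

Lemma principal_ideles0 : principal_ideles 0.
Proof.
exists 0, 1; split; first exact: oner_neq0.
  by move=> x; rewrite icoord0 rmorph1.
by rewrite bclass0.
Qed.

Lemma norm_one_ideles0 : norm_one_ideles 0.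
Proof.
exists 0; split; last by rewrite bclass0.
by move=> x; rewrite icoord0 (dval1 (lvalP (K x))) res1 normf1.
Qed.

Fact fun_norm_one_closed : zmod_closed fun_norm_one.
Proof.
split=> [|s t /asboolP[g [n [Pg Nn sE]]] /asboolP[h [m [Ph Nm tE]]]];
  apply/asboolP.
  exists 0, 0; split; [exact: principal_ideles0 | exact: norm_one_ideles0 |].
  by rewrite addr0.
exists (g - h), (n - m); split.
- exact: principal_idelesB.
- exact: norm_one_idelesB.
- by rewrite /= sE tE opprD addrACA.
Qed.
HB.instance Definition _ := GRing.isZmodClosed.Build perp_fun fun_norm_one
  fun_norm_one_closed.

Definition perp_quot : zmodType := Quotient.quot fun_norm_one.

Definition perp_class (s : perp_fun) : perp_quot :=
  \pi_(Quotient.quot fun_norm_one)%qT s.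

End Adelic.

Arguments principal_ideles {k X} K _.
Arguments norm_one_ideles {k X} K _.
Arguments fun_norm_one {k X} K _.
Arguments one_units {k X} K _.
Arguments principal_div {k X} K _.

(* Main.v *)
(* A class in the kernel of the divisor map is represented by [f * u] with [f] a
   function and [u] a unit idele.  By Weil reciprocity [f] is orthogonal to all
   functions, so [u] is too, which says that [D |-> prod_x N(u_x)^(D x)] kills
   principal divisors, i.e. is a character of [Pic0].  Conversely a character of
   [Pic0], extended to all divisors by means of a rational point, is of this form
   because the norms of the residue fields are onto: by Frobenius conjugates if
   [k] is finite, trivially if [k] is closed.  If [k] is closed, [k^*] is
   divisible, so for a degree zero divisor [D] the character [(f) |-> <f, D>] of
   the group of principal divisors extends to all divisors, which corrects an
   idele of divisor [D] into one orthogonal to the functions.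

   Weil reciprocity comes from the symmetry of the resultant.  Let [R] be the
   ring of functions regular away from a point [y], and [f], [g] in [R] without
   common zeros: the determinant of [f] on [R / g R] is the product of the norms
   of the values of [f] at the zeros of [g].  Truncating by the order of pole at
   [y], the resultants of [(f, g)] and [(g, f)] are compared through the
   determinant of one family of functions, up to the sign and the leading
   coefficients at [y].  Riemann's theorem provides the functions needed to
   truncate, and to reduce arbitrary [f] and [g] to this case. *)
From HB Require Import structures.
From mathcomp Require Import perm.
Require Import Defs.
From mathcomp Require Import all_boot all_order all_algebra all_field.
From mathcomp Require Import boolp classical_sets functions cardinality fsbigop.
From mathcomp Require Import reals complex.
From mathcomp Require Import ring zify.

Set Implicit Arguments.
Unset Strict Implicit.
Unset Printing Implicit Defensive.

Import Order.TTheory GRing.Theory Num.Theory.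

Local Open Scope classical_set_scope.
Local Open Scope ring_scope.

(** * Determinants on quotients of subspaces *)

(** A [curve] is only a function field with its valuations, so degrees, finiteness of poles and
    Riemann's theorem have to come from dimension counts over [k]. Their common source is
    [indep_bound]: families independent over [k[h]] have bounded length. It makes the valuation ring
    obtained as a maximal subring discrete, so that [curve_complete] turns it into a point and every
    nonconstant function has a pole; it makes the poles finite in number; it makes every function
    integral over [k[h]] up to a factor from [k[h]], which bounds [deg D - ell D] along pole
    divisors and forces principal divisors to have degree zero. Since the norm is itself a
    determinant, a product of norms of values is the determinant of a single multiplication map, and
    reciprocity needs no norm formula along a map to the projective line. Functions whose divisors
    meet at several points are treated by peeling off one common point at a time, that point serving
    as [y]. *)

Section Quotients.
Variables (k : fieldType) (V : lmodType k).
Implicit Types (U W Z : set V).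

(** Subspaces are plain sets because the function field is infinite dimensional over [k]. *)
Definition subspace U := U 0 /\ forall a u v, U u -> U v -> U (a *: u + v).

Lemma subspaceD U u v : subspace U -> U u -> U v -> U (u + v).
Proof. by move=> [_ sU] Uu Uv; rewrite -[u]scale1r; exact: sU. Qed.

Lemma subspaceZ U a u : subspace U -> U u -> U (a *: u).
Proof. by move=> [U0 sU] Uu; rewrite -[_ *: _]addr0; exact: sU. Qed.

Lemma subspaceN U u : subspace U -> U u -> U (- u).
Proof. by move=> sU Uu; rewrite -scaleN1r; exact: subspaceZ. Qed.

Lemma subspaceB U u v : subspace U -> U u -> U v -> U (u - v).
Proof. by move=> sU Uu Uv; apply: subspaceD => //; exact: subspaceN. Qed.

Lemma subspace_sum U (I : finType) (P : pred I) (F : I -> V) : subspace U ->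
  (forall i, P i -> U (F i)) -> U (\sum_(i | P i) F i).
Proof.
move=> sU UF; elim/big_ind: _ => //; first by case: sU.
by move=> x y; exact: subspaceD.
Qed.

Lemma subspace0 : subspace [set 0 : V].
Proof. by split=> // a u v /= -> ->; rewrite scaler0 addr0. Qed.

Definition comb n (e : 'I_n -> V) (r : 'rV[k]_n) := \sum_i r 0 i *: e i.

Lemma combP n (e : 'I_n -> V) a r s :
  comb e (a *: r + s) = a *: comb e r + comb e s.
Proof.
rewrite /comb scaler_sumr -big_split /=; apply: eq_bigr => i _.
by rewrite !mxE scalerDl scalerA.
Qed.

Lemma comb0 n (e : 'I_n -> V) : comb e 0 = 0.
Proof. by rewrite /comb big1// => i _; rewrite mxE scale0r. Qed.

Lemma combD n (e : 'I_n -> V) r s : comb e (r + s) = comb e r + comb e s.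
Proof. by have := combP e 1 r s; rewrite !scale1r. Qed.

Lemma combN n (e : 'I_n -> V) r : comb e (- r) = - comb e r.
Proof. by have := combP e (-1) r 0; rewrite comb0 !addr0 !scaleN1r. Qed.

Lemma combB n (e : 'I_n -> V) r s : comb e (r - s) = comb e r - comb e s.
Proof. by rewrite combD combN. Qed.

Lemma comb_delta n (e : 'I_n -> V) i : comb e (delta_mx 0 i) = e i.
Proof.
rewrite /comb (bigD1 i)//= mxE !eqxx scale1r big1 ?addr0// => j ji.
by rewrite mxE (negPf ji) andbF scale0r.
Qed.

Lemma comb_mul m n (e : 'I_n -> V) (M : 'M_(m, n)) r :
  comb (fun i => comb e (row i M)) r = comb e (r *m M).
Proof.
rewrite /comb; under eq_bigr do rewrite scaler_sumr.
rewrite exchange_big /=; apply: eq_bigr => j _.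
rewrite mxE scaler_suml; apply: eq_bigr => i _.
by rewrite scalerA mxE.
Qed.

Lemma comb_cong W m (e e' : 'I_m -> V) r : subspace W ->
  (forall i, W (e i - e' i)) -> W (comb e r - comb e' r).
Proof.
move=> sW Wee; rewrite /comb -sumrB; apply: subspace_sum => // i _.
by rewrite -scalerBr; exact: subspaceZ.
Qed.

Lemma subspace_comb U n (e : 'I_n -> V) r : subspace U ->
  (forall i, U (e i)) -> U (comb e r).
Proof.
by move=> sU Ue; apply: subspace_sum => // i _; exact: subspaceZ.
Qed.

(** Quotient spaces are never formed: independence, spanning and bases of [U / W] are statements
    about representatives in [V], read modulo [W]. *)
Definition freemod W n (e : 'I_n -> V) := forall r, W (comb e r) -> r = 0.

Definition spanmod U W n (e : 'I_n -> V) :=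
  forall u, U u -> exists r, W (u - comb e r).

Definition basmod U W n (e : 'I_n -> V) :=
  [/\ forall i, U (e i), freemod W e & spanmod U W e].

Lemma family_mx U W n (e : 'I_n -> V) m (e' : 'I_m -> V) :
  spanmod U W e -> (forall i, U (e' i)) ->
  exists M : 'M_(m, n), forall i, W (e' i - comb e (row i M)).
Proof.
move=> spe Ue'; have /choice[f fP] : forall i, exists r, W (e' i - comb e r).
  by move=> i; exact: spe.
exists (\matrix_i f i) => i; rewrite rowK; exact: fP.
Qed.

(** If [e'] were longer than [e], its coordinate matrix would have a nonzero left kernel, and a row
    of the kernel is a relation modulo [W]. *)
Lemma freemod_le U W n (e : 'I_n -> V) m (e' : 'I_m -> V) : subspace W ->
  spanmod U W e -> (forall i, U (e' i)) -> freemod W e' -> (m <= n)%N.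
Proof.
move=> sW spe Ue' fe'; rewrite leqNgt; apply/negP => nm.
have [M MP] := family_mx spe Ue'.
have : kermx M != 0.
  rewrite -mxrank_eq0 mxrank_ker subn_eq0 -ltnNge.
  exact: leq_ltn_trans (rank_leq_col M) nm.
case/eqP; apply/row_matrixP => i; rewrite row0; apply: fe'.
have := comb_cong (row i (kermx M)) sW MP.
rewrite comb_mul -row_mul mulmx_ker row0 comb0 subr0.
by apply.
Qed.

Lemma basmod_unit U W n (e e' : 'I_n -> V) M : subspace W ->
  freemod W e' -> (forall i, W (e' i - comb e (row i M))) -> M \in unitmx.
Proof.
move=> sW fe' MP; rewrite -row_free_unit -kermx_eq0; apply/eqP.
apply/row_matrixP => i; rewrite row0; apply: fe'.
have := comb_cong (row i (kermx M)) sW MP.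
by rewrite comb_mul -row_mul mulmx_ker row0 comb0 subr0.
Qed.

Lemma freemod_basmod U W n (e e' : 'I_n -> V) : subspace W ->
  spanmod U W e -> (forall i, U (e' i)) -> freemod W e' -> basmod U W e'.
Proof.
move=> sW spe Ue' fe'; split=> // u Uu.
have [M MP] := family_mx spe Ue'.
have uM := basmod_unit U sW fe' MP.
have [r rP] := spe u Uu; exists (r *m invmx M).
have := comb_cong (r *m invmx M) sW MP.
rewrite comb_mul mulmxKV// => /(subspaceB sW rP).
by rewrite opprB addrA subrK.
Qed.

Definition catf n m (e1 : 'I_n -> V) (e2 : 'I_m -> V) (i : 'I_(n + m)) :=
  match fintype.split i with inl j => e1 j | inr j => e2 j end.

Lemma catf_lshift n m (e1 : 'I_n -> V) (e2 : 'I_m -> V) i :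
  catf e1 e2 (lshift m i) = e1 i.
Proof. by rewrite /catf (unsplitK (inl i)). Qed.

Lemma catf_rshift n m (e1 : 'I_n -> V) (e2 : 'I_m -> V) i :
  catf e1 e2 (rshift n i) = e2 i.
Proof. by rewrite /catf (unsplitK (inr i)). Qed.

Lemma comb_row_mx n m (e1 : 'I_n -> V) (e2 : 'I_m -> V) r s :
  comb (catf e1 e2) (row_mx r s) = comb e1 r + comb e2 s.
Proof.
rewrite /comb big_split_ord /=; congr (_ + _); apply: eq_bigr => i _.
  by rewrite row_mxEl catf_lshift.
by rewrite row_mxEr catf_rshift.
Qed.

Lemma comb_cat n m (e1 : 'I_n -> V) (e2 : 'I_m -> V) r :
  comb (catf e1 e2) r = comb e1 (lsubmx r) + comb e2 (rsubmx r).
Proof. by rewrite -{1}[r]hsubmxK comb_row_mx. Qed.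

Lemma catf_in U n m (e1 : 'I_n -> V) (e2 : 'I_m -> V) :
  (forall i, U (e1 i)) -> (forall i, U (e2 i)) -> forall i, U (catf e1 e2 i).
Proof. by move=> U1 U2 i; rewrite /catf; case: fintype.split. Qed.

Lemma freemod_cat U W n m (e1 : 'I_n -> V) (e2 : 'I_m -> V) : subspace U ->
  W `<=` U -> (forall i, U (e1 i)) ->
  freemod W e1 -> freemod U e2 -> freemod W (catf e1 e2).
Proof.
move=> sU WU Ue1 f1 f2 r; rewrite comb_cat => Wr.
have r2 : rsubmx r = 0.
  apply: f2; have := subspaceB sU (WU _ Wr) (subspace_comb (lsubmx r) sU Ue1).
  by rewrite addrC addKr.
move: Wr; rewrite r2 comb0 addr0 => /f1 r1.
by rewrite -[r]hsubmxK r1 r2 row_mx0.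
Qed.

Lemma basmod_cat Z U W n m (e1 : 'I_n -> V) (e2 : 'I_m -> V) : subspace U ->
  W `<=` U -> U `<=` Z -> basmod U W e1 -> basmod Z U e2 ->
  basmod Z W (catf e1 e2).
Proof.
move=> sU WU UZ [U1 f1 s1] [U2 f2 s2]; split.
- by apply: catf_in => // i; exact: UZ.
- by apply: (freemod_cat sU WU).
- move=> u Zu; have [r2 /s1[r1]] := s2 u Zu; rewrite -addrA -opprD => Wr.
  by exists (row_mx r1 r2); rewrite comb_row_mx (addrC (comb e1 r1)).
Qed.

(** A free family of maximal length, which the bound [N] provides, spans: a vector outside its span
    could be appended. *)
Lemma basmod_exists U W N : subspace U -> subspace W ->
  (forall n (e : 'I_n -> V), (forall i, U (e i)) -> freemod W e -> (n <= N)%N) ->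
  exists n (e : 'I_n -> V), basmod U W e.
Proof.
move=> sU sW bnd.
pose P n := `[< exists e : 'I_n -> V, (forall i, U (e i)) /\ freemod W e >].
have exP : exists n, P n.
  exists 0%N; apply/asboolP; exists (fun=> 0); split=> [[]//|r _].
  by rewrite thinmx0.
have bP n : P n -> (n <= N)%N by move/asboolP => [e [? ?]]; exact: (bnd _ e).
case: (ex_maxnP exP bP) => n /asboolP[e [Ue fe]] maxn.
exists n, e; split=> // u Uu; apply: contrapT => nspan.
have : P (n + 1)%N.
  apply/asboolP; exists (catf e (fun=> u)); split; first exact: catf_in.
  move=> r; rewrite comb_cat {2}/comb big_ord1 => Wr.
  have r2 : rsubmx r 0 0 = 0.
    apply/eqP; apply: contrapT => /negP r0; apply: nspan.
    exists (- (rsubmx r 0 0)^-1 *: lsubmx r).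
    have := subspaceZ (rsubmx r 0 0)^-1 sW Wr.
    rewrite scalerDr scalerA mulVf// scale1r addrC scaleNr combN opprK.
    by have := combP e (rsubmx r 0 0)^-1 (lsubmx r) 0;
      rewrite comb0 !addr0 => ->.
  move: Wr; rewrite r2 scale0r addr0 => /fe r1.
  rewrite -[r]hsubmxK r1 (_ : rsubmx r = 0) ?row_mx0//.
  by apply/matrixP => i j; rewrite !ord1 r2 mxE.
by move/maxn; rewrite addn1 ltnn.
Qed.

Definition dimq U W n := exists e : 'I_n -> V, basmod U W e.

Lemma dimq_unique U W n m : subspace W -> dimq U W n -> dimq U W m -> n = m.
Proof.
move=> sW [e [Ue fe se]] [e' [Ue' fe' se']]; apply/eqP.
by rewrite eqn_leq (freemod_le sW se' Ue fe) (freemod_le sW se Ue' fe').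
Qed.

Lemma dimq_cat Z U W n m : subspace U -> W `<=` U -> U `<=` Z ->
  dimq U W n -> dimq Z U m -> dimq Z W (n + m).
Proof.
move=> sU WU UZ [e1 b1] [e2 b2]; exists (catf e1 e2).
exact: (basmod_cat sU WU UZ b1 b2).
Qed.

(* [f] need not preserve [U] or [W]: only the classes modulo [W] of the images
   of a basis matter. *)
Definition quot_det (f : V -> V) U W n c := exists (e : 'I_n -> V) (A : 'M_n),
  [/\ basmod U W e, forall i, W (f (e i) - comb e (row i A)) & \det A = c].

(** In a basis adapted to the filtration the matrix is block triangular, [B] recording the
    components in [U / W] of the images of [e2]. Hence determinants multiply along a filtration. *)
Lemma quot_det_cat f Z U W n m c d : subspace U -> W `<=` U -> U `<=` Z ->
  quot_det f U W n c -> quot_det f Z U m d ->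
  quot_det f Z W (n + m) (c * d).
Proof.
move=> sU WU UZ [e1 [A [b1 fA <-]]] [e2 [D [b2 fD <-]]].
have [U1 f1 s1] := b1.
have [B BP] := family_mx s1 fD.
exists (catf e1 e2), (block_mx A 0 B D); split.
- exact: (basmod_cat sU WU UZ b1 b2).
- move=> i; case: (split_ordP i) => j ->.
    rewrite catf_lshift.
    have -> : row (lshift m j) (block_mx A 0 B D) = row_mx (row j A) 0.
      by rewrite /block_mx rowKu row_row_mx row0.
    by rewrite comb_row_mx comb0 addr0.
  rewrite catf_rshift.
  have -> : row (rshift n j) (block_mx A 0 B D) = row_mx (row j B) (row j D).
    by rewrite /block_mx rowKd row_row_mx.
  by rewrite comb_row_mx opprD addrA (addrAC _ _ (- comb e2 _)); exact: BP.
- by rewrite det_lblock.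
Qed.

Lemma comb_fin (I : finType) (e : I -> V) (r : 'rV_#|I|) :
  comb (fun i : 'I_#|I| => e (enum_val i)) r =
  \sum_i r 0 (enum_rank i) *: e i.
Proof.
rewrite /comb (reindex_onto (@enum_rank I) enum_val) /=; last first.
  by move=> j _; rewrite enum_valK.
rewrite (eq_bigl predT); last by move=> j; rewrite enum_rankK eqxx.
by apply: eq_bigr => j _; rewrite enum_rankK.
Qed.

Lemma freemod_of_fin (I : finType) (e : I -> V) W :
  (forall r : I -> k, W (\sum_i r i *: e i) -> forall i, r i = 0) ->
  freemod W (fun i : 'I_#|I| => e (enum_val i)).
Proof.
move=> fe r; rewrite comb_fin => /fe r0; apply/matrixP => z i.
by rewrite ord1 mxE -(enum_valK i).
Qed.

End Quotients.

(** * Symmetry of the resultant *)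

Section RowSwap.
Variables (k : fieldType) (n : nat).
Implicit Types (s t a b : seq 'rV[k]_n).

(** With the rows listed in a sequence, blocks move past each other by concatenation, without casts
    between sums of ordinals. *)
Definition det_rows s : k := \det (\matrix_(i < n) nth 0 s i).

Lemma det_rows_swap1 a u v b : size (a ++ u :: v :: b) = n ->
  det_rows (a ++ u :: v :: b) = - det_rows (a ++ v :: u :: b).
Proof.
move=> sz.
have i1P : (size a < n)%N by move: sz; rewrite size_cat /=; lia.
have i2P : ((size a).+1 < n)%N by move: sz; rewrite size_cat /=; lia.
pose i1 := Ordinal i1P; pose i2 := Ordinal i2P.
rewrite /det_rows.
have -> : \matrix_(i < n) nth 0 (a ++ u :: v :: b) i =
    xrow i1 i2 (\matrix_(i < n) nth 0 (a ++ v :: u :: b) i).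
  apply/row_matrixP => i; rewrite rowK.
  have -> : row i (xrow i1 i2 (\matrix_(i < n) nth 0 (a ++ v :: u :: b) i)) =
      nth 0 (a ++ v :: u :: b) (tperm i1 i2 i).
    by apply/rowP => j; rewrite !mxE.
  case: tpermP => [->|->|/eqP ne1 /eqP ne2] /=.
  - by rewrite !nth_cat /= ltnn subnn ltnNge leqnSn /= subSnn.
  - by rewrite !nth_cat /= ltnn subnn ltnNge leqnSn /= subSnn.
  rewrite !nth_cat; case: ltnP => // ai.
  have : (i - size a)%N != 0%N by apply: contra ne1 => /eqP; rewrite -val_eqE /=; lia.
  have : (i - size a)%N != 1%N by apply: contra ne2 => /eqP; rewrite -val_eqE /=; lia.
  by case: (_ - _)%N => [//|[//|j]].
rewrite xrowE det_mulmx det_perm odd_tperm.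
rewrite (_ : i1 == i2 = false) /= ?expr1 ?mulN1r//.
by apply/negP => /eqP/(congr1 val) /= /eqP; rewrite ltn_eqF.
Qed.

Lemma det_rows_swapl a u t b : size (a ++ u :: t ++ b) = n ->
  det_rows (a ++ u :: t ++ b) = (-1) ^+ size t * det_rows (a ++ t ++ u :: b).
Proof.
elim: t a => [|v t IHt] a sz /=; first by rewrite expr0 mul1r.
rewrite det_rows_swap1//= -cat_rcons IHt; last first.
  by move: sz; rewrite !(size_cat, size_rcons) /= ?size_cat; lia.
by rewrite exprS mulN1r cat_rcons mulNr.
Qed.

Lemma det_rows_swap a s t b : size (a ++ s ++ t ++ b) = n ->
  det_rows (a ++ s ++ t ++ b) =
  (-1) ^+ (size s * size t) * det_rows (a ++ t ++ s ++ b).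
Proof.
elim: s a => [|u s IHs] a sz /=; first by rewrite mul0n expr0 mul1r.
rewrite -cat_rcons IHs; last by move: sz; rewrite !(size_cat, size_rcons) /= ?size_cat; lia.
rewrite cat_rcons det_rows_swapl; last first.
  by move: sz; rewrite !(size_cat, size_rcons) /= ?size_cat; lia.
by rewrite mulrA -exprD mulSn addnC.
Qed.

Definition rowseq m (M : 'M[k]_(m, n)) := [seq row i M | i <- enum 'I_m].

Lemma size_rowseq m (M : 'M[k]_(m, n)) : size (rowseq M) = m.
Proof. by rewrite size_map size_enum_ord. Qed.

Lemma rowseq_cast m m' (e : m = m') (M : 'M[k]_(m, n)) :
  rowseq (castmx (e, erefl) M) = rowseq M.
Proof. by case: m' / e. Qed.

Lemma rowseq_col m1 m2 (A : 'M[k]_(m1, n)) (B : 'M[k]_(m2, n)) :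
  rowseq (col_mx A B) = rowseq A ++ rowseq B.
Proof.
apply: (@eq_from_nth _ 0) => [|i]; rewrite ?size_cat !size_rowseq// => ilt.
rewrite nth_cat size_rowseq.
rewrite (nth_map (Ordinal ilt)) ?size_enum_ord//.
have -> : nth (Ordinal ilt) (enum 'I_(m1 + m2)) i = Ordinal ilt.
  exact: (nth_ord_enum (Ordinal ilt) (Ordinal ilt)).
case: (ltnP i m1) => im1.
  rewrite (nth_map (Ordinal im1)) ?size_enum_ord//.
  rewrite (nth_ord_enum (Ordinal im1) (Ordinal im1)) -(rowKu _ A B).
  by congr (row _ _); exact: val_inj.
have im2 : (i - m1 < m2)%N by rewrite ltn_subLR.
rewrite (nth_map (Ordinal im2)) ?size_enum_ord//.
rewrite (nth_ord_enum (Ordinal im2) (Ordinal im2)) -(rowKd _ A B).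
by congr (row _ _); apply: val_inj; rewrite /= subnKC.
Qed.

Lemma det_rowseq (M : 'M[k]_n) : det_rows (rowseq M) = \det M.
Proof.
congr (\det _); apply/row_matrixP => i; rewrite rowK (nth_map i) ?size_enum_ord//.
by rewrite nth_ord_enum.
Qed.

Lemma det_swap N p q (e1 : (N + p + q)%N = n) (e2 : (N + q + p)%N = n)
    (X : 'M[k]_(N, n)) (Y : 'M[k]_(p, n)) (Z : 'M[k]_(q, n)) :
  \det (castmx (e1, erefl) (col_mx (col_mx X Y) Z)) =
  (-1) ^+ (p * q) * \det (castmx (e2, erefl) (col_mx (col_mx X Z) Y)).
Proof.
rewrite -!det_rowseq !rowseq_cast !rowseq_col -!catA.
have := @det_rows_swap (rowseq X) (rowseq Y) (rowseq Z) [::].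
by rewrite !cats0 !size_cat !size_rowseq addnA; apply.
Qed.

End RowSwap.

Lemma det_castmx_mul (k : fieldType) m n (e : m = n) (M : 'M[k]_m)
    (Q : 'M[k]_(m, n)) :
  \det (castmx (e, erefl) (M *m Q)) = \det M * \det (castmx (e, erefl) Q).
Proof. by case: n / e Q => Q; rewrite !castmx_id det_mulmx. Qed.

Section Sylvester.
Variable k : fieldType.

(** Replacing [f Cg] by [Df Cg] plus a multiple of [g] factors the family [[f g e0, g Cf, f Cg]]
    through [[Ga, Cg]], with a block triangular matrix as first factor. The sign comes from moving
    the rows [Cg] past the [p] rows that contain [B]. *)
Let half n N p q (e1 : (N + p + q)%N = n) (e2 : (N + q + p)%N = n)
    (F0 : 'M[k]_(N, N + p)) (G0 : 'M[k]_(N, N + q))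
    (Cf : 'M[k]_(p, N + p)) (Cg : 'M[k]_(q, N + q))
    (FA : 'M[k]_(q, N + p)) (A : 'M[k]_q)
    (GB : 'M[k]_(p, N + q)) (B : 'M[k]_p) (X : 'M[k]_(q, N + p)) (Df : 'M[k]_q) :
  let Fb := castmx (erefl, e1) (block_mx F0 0 FA A) in
  let Ga := castmx (erefl, e2) (block_mx G0 0 GB B) in
  Cg *m Fb = Df *m castmx (erefl, e2) (row_mx Cg 0) + X *m Ga ->
  \det (castmx (e1, erefl) (col_mx (col_mx (F0 *m Ga) (Cf *m Ga)) (Cg *m Fb))) =
  \det (col_mx F0 Cf) * \det Df * ((-1) ^+ (p * q) *
    (\det (col_mx G0 Cg) * \det B)).
Proof.
move=> Fb Ga ->; set Cg' := castmx _ (row_mx Cg 0).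
have -> : col_mx (col_mx (F0 *m Ga) (Cf *m Ga)) (Df *m Cg' + X *m Ga) =
    block_mx (col_mx F0 Cf) 0 X Df *m col_mx Ga Cg'.
  by rewrite mul_block_col mul0mx addr0 mul_col_mx addrC.
rewrite det_castmx_mul det_lblock; congr (_ * _).
have -> : Ga = col_mx (castmx (erefl, e2) (row_mx G0 0))
                      (castmx (erefl, e2) (row_mx GB B)).
  by rewrite /Ga /block_mx; clear; case: n / e2; rewrite !castmx_id.
rewrite (det_swap e1 e2) /Cg'; congr (_ * _).
clear; case: n / e2; rewrite !castmx_id.
have -> : col_mx (col_mx (row_mx G0 0) (row_mx Cg 0)) (row_mx GB B) =
    block_mx (col_mx G0 Cg) 0 GB B.
  by rewrite [RHS]/block_mx -[0 in RHS]col_mx0 -block_mxEh.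
by rewrite det_lblock.
Qed.

(* Both sides come from computing the determinant of the family
   [f g e0, g Cf, f Cg] in two ways; [Df] (resp. [Dg]) is the matrix of
   multiplication by [f] on the cokernel of [g] (resp. of [g] on the cokernel
   of [f]), with basis [Cg] (resp. [Cf]). *)
Lemma det_resultant_sym n N p q (e1 : (N + p + q)%N = n) (e2 : (N + q + p)%N = n)
    (F0 : 'M[k]_(N, N + p)) (G0 : 'M[k]_(N, N + q))
    (Cf : 'M[k]_(p, N + p)) (Cg : 'M[k]_(q, N + q))
    (FA : 'M[k]_(q, N + p)) (A : 'M[k]_q)
    (GB : 'M[k]_(p, N + q)) (B : 'M[k]_p)
    (X : 'M[k]_(q, N + p)) (Df : 'M[k]_q) (Y : 'M[k]_(p, N + q)) (Dg : 'M[k]_p) :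
  let Fb := castmx (erefl, e1) (block_mx F0 0 FA A) in
  let Ga := castmx (erefl, e2) (block_mx G0 0 GB B) in
  col_mx F0 Cf \in unitmx -> col_mx G0 Cg \in unitmx ->
  F0 *m Ga = G0 *m Fb ->
  Cg *m Fb = Df *m castmx (erefl, e2) (row_mx Cg 0) + X *m Ga ->
  Cf *m Ga = Dg *m castmx (erefl, e1) (row_mx Cf 0) + Y *m Fb ->
  \det Df * (-1) ^+ (p * q) * \det B = \det Dg * \det A.
Proof.
move=> Fb Ga; rewrite !unitmxE !unitfE => uf ug com HF HG.
have DF := @half n N p q e1 e2 F0 G0 Cf Cg FA A GB B X Df HF.
have DG := @half n N q p e2 e1 G0 F0 Cg Cf GB B FA A Y Dg HG.
rewrite (det_swap e1 e2) -/Fb -/Ga com in DF.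
rewrite /= -/Fb -/Ga in DG; rewrite DG in DF.
have s1 : (-1) ^+ (p * q) * (-1) ^+ (p * q) = 1 :> k.
  by rewrite -expr2 sqrr_sign.
apply: (mulIf (mulf_neq0 uf ug)).
transitivity (\det (col_mx F0 Cf) * \det Df *
   ((-1) ^+ (p * q) * (\det (col_mx G0 Cg) * \det B))); first by ring.
rewrite -{}DF (mulnC q p).
transitivity ((-1) ^+ (p * q) * (-1) ^+ (p * q) *
    (\det (col_mx G0 Cg) * \det Dg * (\det (col_mx F0 Cf) * \det A))).
  by ring.
by rewrite s1; ring.
Qed.

End Sylvester.

(** * Quotients identified with a residue field *)

Section LeadMap.
Variables (k : fieldType) (V : lmodType k) (L : fieldExtType k).
Variables (U W : set V) (l : V -> L).
Hypotheses (sU : subspace U) (sW : subspace W).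
Hypothesis l_lin : forall a u v, U u -> U v -> l (a *: u + v) = a *: l u + l v.
Hypothesis l_ker : forall u, U u -> (l u = 0 <-> W u).

Let l0 : l 0 = 0.
Proof. by have [U0 _] := sU; apply/l_ker => //; case: sW. Qed.

Lemma lead_comb n (e : 'I_n -> V) r : (forall i, U (e i)) ->
  l (comb e r) = comb (l \o e) r.
Proof.
move=> Ue; rewrite /comb.
suff : U (\sum_i r 0 i *: e i) /\
    l (\sum_i r 0 i *: e i) = \sum_i r 0 i *: l (e i) by case.
elim/big_ind2: _ => [|x1 x2 y1 y2 [Ux <-] [Uy <-]|i _].
- by split=> //; case: sU.
- split; first exact: subspaceD.
  by have := l_lin 1 Ux Uy; rewrite !scale1r.
split; first exact: subspaceZ.
have U0 : U 0 by case: sU.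
by have := l_lin (r 0 i) (Ue i) U0; rewrite l0 !addr0.
Qed.

Lemma lead_free_le n (e : 'I_n -> V) : (forall i, U (e i)) -> freemod W e ->
  (n <= \dim {:L})%N.
Proof.
move=> Ue fe; pose b (i : 'I_(\dim {:L})) := (vbasis {:L})`_i.
apply: (@freemod_le _ _ [set: L] [set 0] _ b _ (l \o e)) => //.
- exact: subspace0.
- move=> u _; exists (\row_i coord (vbasis {:L}) i u) => /=.
  rewrite /comb; apply/eqP; rewrite subr_eq0; apply/eqP.
  rewrite {1}(coord_vbasis (memvf u)); apply: eq_bigr => i _.
  by rewrite mxE.
- move=> r /=; rewrite -lead_comb// => lr; apply: fe; apply/l_ker => //.
  exact: subspace_comb.
Qed.

(** The basis of [U / W] lifts the fixed basis of [L], so that multiplication by [c] gets exactly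
    the matrix whose determinant defines [normf]. *)
Lemma lead_basis (lonto : forall c, exists2 u, U u & l u = c) :
  exists2 e : 'I_(\dim {:L}) -> V, basmod U W e &
    forall i, l (e i) = (vbasis {:L})`_i.
Proof.
have /choice[e eP] (i : 'I_(\dim {:L})) : exists u, U u /\ l u = (vbasis {:L})`_i.
  by have [u] := lonto (vbasis {:L})`_i; exists u.
have Ue i := proj1 (eP i); have le i := proj2 (eP i).
have bfree := basis_free (vbasisP {:L}).
exists e => //; split=> // [r Wr|u Uu].
  have : \sum_i r 0 i *: (vbasis {:L})`_i = 0.
    have /(l_ker (subspace_comb r sU Ue)) := Wr.
    rewrite lead_comb// => lr; rewrite -[RHS]lr; apply: eq_bigr => i _ /=.
    by rewrite le.
  by move=> r0; apply/rowP => i; rewrite mxE; have /freeP fr := bfree;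
    exact: (fr (fun i => r 0 i) r0).
exists (\row_i coord (vbasis {:L}) i (l u)).
have Uc : U (comb e (\row_i coord (vbasis {:L}) i (l u))).
  exact: subspace_comb.
apply/l_ker; first exact: subspaceB.
have := l_lin (-1) Uc Uu; rewrite addrC scaleN1r => ->.
rewrite lead_comb// scaleN1r /comb /= {2}(coord_vbasis (memvf (l u))).
apply/eqP; rewrite addrC subr_eq0; apply/eqP/eq_bigr => i _.
by rewrite mxE le.
Qed.

Lemma lead_det f c (lonto : forall c, exists2 u, U u & l u = c) :
  (forall u, U u -> U (f u) /\ l (f u) = c * l u) ->
  quot_det f U W (\dim {:L}) (normf c).
Proof.
move=> fP; have [e be le] := lead_basis lonto.
have [Ue fe se] := be.
exists e, (passmx.mxof (vbasis {:L}) (vbasis {:L}) (amull c)); split=> // i.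
set A := passmx.mxof _ _ _.
have [Uf lf] := fP _ (Ue i).
have Uc : U (comb e (row i A)) by exact: subspace_comb.
apply/l_ker; first exact: subspaceB.
have := l_lin (-1) Uc Uf; rewrite addrC scaleN1r => ->.
rewrite lead_comb// scaleN1r lf le.
have -> : comb (l \o e) (row i A) = passmx.vecof (vbasis {:L}) (row i A).
  by apply: eq_bigr => j _ /=; rewrite le.
rewrite rowE -passmx.hom_vecof ?passmx.vecof_delta ?lfunE /= ?addNr//.
exact: vbasisP.
Qed.

(** The map [l] always embeds [U / W] into [L]; equal dimensions make the embedding onto. *)
Lemma lead_onto n (e : 'I_n -> V) : basmod U W e -> n = \dim {:L} ->
  forall c, exists2 u, U u & l u = c.
Proof.
move=> [Ue fe se] nE; subst n => c.
pose b (i : 'I_(\dim {:L})) := (vbasis {:L})`_i.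
have spb : spanmod [set: L] [set 0] b.
  move=> u _; exists (\row_i coord (vbasis {:L}) i u) => /=.
  rewrite /comb; apply/eqP; rewrite subr_eq0; apply/eqP.
  by rewrite {1}(coord_vbasis (memvf u)); apply: eq_bigr => i _; rewrite mxE.
have fle : freemod [set 0] (l \o e).
  move=> r /=; rewrite -lead_comb// => lr; apply: fe; apply/l_ker => //.
  exact: subspace_comb.
have [_ _ sp] := freemod_basmod (@subspace0 _ _) spb (fun=> I) fle.
have [r /= /eqP] := sp c I; rewrite subr_eq0 => /eqP ->.
exists (comb e r); first exact: subspace_comb.
exact: lead_comb.
Qed.

End LeadMap.

(** * The function field as a vector space over [k] *)

Section FunctionField.
Variables (k : fieldType) (X : curve k).

(** A copy of [fun_field X] that can carry the [k]-module structure given by [constf]. *)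
Definition ffield : Type := fun_field X.
HB.instance Definition _ := GRing.Field.copy ffield (fun_field X).

Definition ffield_scale (a : k) (u : ffield) : ffield := constf X a * u.

Fact ffield_scaleA a b u :
  ffield_scale a (ffield_scale b u) = ffield_scale (a * b) u.
Proof. by rewrite /ffield_scale mulrA rmorphM. Qed.
Fact ffield_scale1 : left_id 1 ffield_scale.
Proof. by move=> u; rewrite /ffield_scale rmorph1 mul1r. Qed.
Fact ffield_scaleDr : right_distributive ffield_scale +%R.
Proof. by move=> a u v; rewrite /ffield_scale mulrDr. Qed.
Fact ffield_scaleDl u : {morph ffield_scale^~ u : a b / a + b}.
Proof. by move=> a b; rewrite /ffield_scale rmorphD mulrDl. Qed.

HB.instance Definition _ := GRing.Zmodule_isLmodule.Build k ffield
  ffield_scaleA ffield_scale1 ffield_scaleDr ffield_scaleDl.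

Lemma ffield_scaleE (a : k) (u : ffield) : a *: u = constf X a * u.
Proof. by []. Qed.

End FunctionField.

(** * Transcendental functions *)

Section Independence.
Variables (k : fieldType) (X : curve k).
Local Notation F := (ffield X).
Implicit Types (p q : {poly k}) (h : F).

Definition pev (h : F) (p : {poly k}) : F := (map_poly (constf X) p).[h].

Lemma pevE h p n : (size p <= n)%N -> pev h p = \sum_(i < n) p`_i *: h ^+ i.
Proof.
move=> pn; rewrite /pev (@horner_coef_wide _ n) ?size_map_poly//.
by apply: eq_bigr => i _; rewrite coef_map ffield_scaleE.
Qed.

Lemma pev0 h : pev h 0 = 0. Proof. by rewrite /pev rmorph0 horner0. Qed.

Lemma pevD h p q : pev h (p + q) = pev h p + pev h q.
Proof. by rewrite /pev rmorphD hornerD. Qed.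

Lemma pevN h p : pev h (- p) = - pev h p.
Proof. by rewrite /pev rmorphN hornerN. Qed.

Lemma pevM h p q : pev h (p * q) = pev h p * pev h q.
Proof. by rewrite /pev rmorphM hornerM. Qed.

Lemma pevC h (a : k) : pev h a%:P = constf X a.
Proof. by rewrite /pev map_polyC hornerC. Qed.

Lemma pevX h : pev h 'X = h.
Proof. by rewrite /pev map_polyX hornerX. Qed.

Lemma pevZ h a p : pev h (a *: p) = a *: pev h p.
Proof. by rewrite -mul_polyC pevM pevC. Qed.

Lemma pev_exp h p n : pev h (p ^+ n) = pev h p ^+ n.
Proof. by rewrite /pev rmorphXn horner_exp. Qed.

Lemma pev_poly h n (r : nat -> k) :
  pev h (\poly_(i < n) r i) = \sum_(i < n) r i *: h ^+ i.
Proof.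
rewrite (@pevE _ _ n) ?size_poly//; apply: eq_bigr => i _.
by rewrite coef_poly ltn_ord.
Qed.

Definition transc (h : F) := forall p, pev h p = 0 -> p = 0.

Lemma transcP (h : F) : ~ algebraicOver (constf X) h -> transc h.
Proof.
move=> nalg p ph; apply/eqP; apply: contrapT => /negP p0.
by apply: nalg; exists p => //; apply/rootP.
Qed.

(** Linear independence over [k[h]]. For transcendental [h] a bound on [N] expresses that the
    function field has finite degree over [k(h)]; for algebraic [h] only the empty family
    qualifies. *)
Definition indep h N (u : 'I_N -> F) := forall phi : 'I_N -> {poly k},
  \sum_i pev h (phi i) * u i = 0 -> forall i, phi i = 0.

Section Bound.
Variables (t : F) (n : nat) (b : 'I_n -> F).
Hypothesis ttr : transc t.
Hypothesis bspan : forall f : F, exists (q : {poly k}) (p : 'I_n -> {poly k}),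
  q != 0 /\ f * pev t q = \sum_i pev t (p i) * b i.

Let W m : set F := fun f => exists p : 'I_n -> {poly k},
  (forall i, size (p i) <= m)%N /\ f = \sum_i pev t (p i) * b i.

Let WP m : subspace (W m).
Proof.
split; first by exists (fun=> 0); split=> [i|]; rewrite ?size_poly0// big1// => i _; rewrite pev0 mul0r.
move=> a _ _ [p [sp ->]] [q [sq ->]]; exists (fun i => a *: p i + q i); split.
  move=> i; apply: leq_trans (size_polyD _ _) _; rewrite geq_max sq andbT.
  exact: leq_trans (size_scale_leq _ _) (sp i).
rewrite scaler_sumr -big_split; apply: eq_bigr => i _.
by rewrite pevD pevZ mulrDl !ffield_scaleE mulrA.
Qed.

Let W_le m m' : (m <= m')%N -> W m `<=` W m'.
Proof. by move=> mm f [p [sp fE]]; exists p; split=> // i; exact: leq_trans (sp i) mm. Qed.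

Let W_pev m q f : W m f -> W (m + size q) (pev t q * f).
Proof.
move=> [p [sp ->]]; exists (fun i => q * p i); split.
  move=> i; apply: leq_trans (size_polyMleq _ _) _.
  by apply: leq_trans (leq_pred _) _; rewrite addnC leq_add2r.
by rewrite mulr_sumr; apply: eq_bigr => i _; rewrite pevM mulrA.
Qed.

Let common N (u : 'I_N -> F) :
  exists (q : {poly k}) m, q != 0 /\ forall i, W m (pev t q * u i).
Proof.
have /choice[f fP] (i : 'I_N) : exists qm : {poly k} * nat,
    qm.1 != 0 /\ W qm.2 (pev t qm.1 * u i).
  have [q [p [q0 qp]]] := bspan (u i).
  exists (q, \max_i size (p i)); split=> //=; exists p; split.
    by move=> j; exact: (leq_bigmax j).
  by rewrite mulrC.
exists (\prod_i (f i).1), (\sum_i ((f i).2 + \sum_j size (\prod_(l | l != j) (f l).1)%R))%N.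
split; first by apply/prodf_neq0 => i _; case: (fP i).
move=> i; have -> : \prod_i (f i).1 = (f i).1 * \prod_(l | l != i) (f l).1.
  by rewrite (bigD1 i).
rewrite pevM (mulrC (pev t _)) -mulrA.
have /(W_pev (\prod_(l | l != i) (f l).1)) := (fP i).2.
have le_sum (g : 'I_N -> nat) : (g i <= \sum_j g j)%N.
  by rewrite (bigD1 i)//= leq_addr.
apply: W_le; apply: leq_trans (le_sum (fun i => _ + _)%N).
by rewrite leq_add2l (le_sum (fun j => size (\prod_(l | l != j) (f l).1)%R)).
Qed.

Let Wmul (h : F) : exists (q : {poly k}) d, q != 0 /\ forall m f, W m f ->
  W (m + d) (pev t q * h * f) /\ W (m + d) (pev t q * f).
Proof.
have [q [d [q0 qd]]] := common (fun i => h * b i).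
exists q, (d + size q)%N; split=> // m f Wf; split; last first.
  by apply: W_le (W_pev q Wf); rewrite leq_add2l leq_addl.
have [p [sp ->]] := Wf; rewrite mulr_sumr. refine (subspace_sum (WP _) _) => i _.
rewrite mulrCA -[_ * h * b i]mulrA.
apply: W_le (W_pev (p i) (qd i)).
by rewrite addnC leq_add ?sp// leq_addr.
Qed.

Let Wspan m : exists e : 'I_#|{: 'I_n * 'I_m}| -> F, spanmod (W m) [set 0] e.
Proof.
exists (fun i : 'I_#|{: 'I_n * 'I_m}| => t ^+ (enum_val i).2 * b (enum_val i).1) => _ [p [sp ->]].
exists (\row_(i < #|{: 'I_n * 'I_m}|) (p (enum_val i).1)`_((enum_val i).2)) => /=.
apply/eqP; rewrite subr_eq0; apply/eqP.
rewrite (comb_fin (fun ij : 'I_n * 'I_m => t ^+ ij.2 * b ij.1)).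
transitivity (\sum_(ij : 'I_n * 'I_m) (p ij.1)`_ij.2 *: (t ^+ ij.2 * b ij.1)).
  rewrite -(pair_bigA _ (fun (i : 'I_n) (j : 'I_m) => (p i)`_j *: (t ^+ j * b i)))/=.
  apply: eq_bigr => i _; rewrite (pevE t (sp i)) mulr_suml.
  by apply: eq_bigr => j _; rewrite !ffield_scaleE mulrA.
by apply: eq_bigr => j _; rewrite mxE enum_rankK.
Qed.

(** Up to denominators in [t], multiplying by [h] raises the degree in [t] by a fixed [d]. So the
    products of the [u l] with the powers of [h] up to [M] lie in a space whose dimension grows like
    [n * d * M], while independence makes them [N * (M + 1)] free vectors. *)
Lemma indep_bound_aux (h : F) :
  exists B, forall N (u : 'I_N -> F), indep h u -> (N <= B)%N.
Proof.
have [Q [d [Q0 Qd]]] := Wmul h.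
exists (n * d)%N => N u iu; rewrite leqNgt; apply/negP => Nnd.
have [q [m [q0 qm]]] := common u.
(* With this value [N * (M + 1) <= n * (m + M * d)] fails as soon as [N] exceeds [n * d]. *)
pose M := (n * m)%N.
(* The factor [q] clears the denominators of the [u l]. Each power [h ^+ i] uses [i] of the [M]
   factors [Q], and the other [M - i] only pad the degree, so that all products land in one
   space. *)
pose c := pev t Q ^+ M * pev t q.
have c0 : c != 0.
  apply: mulf_neq0; last by apply: contra_neq q0; exact: ttr.
  by apply: expf_neq0; apply: contra_neq Q0; exact: ttr.
pose v (li : 'I_N * 'I_M.+1) := c * h ^+ li.2 * u li.1.
have Wv li : W (m + M * d) (v li).
  case: li => l i; rewrite /v/=.
  have key0 a : W (m + a * d) (pev t Q ^+ a * (pev t q * u l)).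
    elim: a => [|a /Qd[_]]; first by rewrite mul0n addn0 expr0 mul1r.
    by rewrite mulrA -exprS -addnA -mulSnr.
  have key a j : W (m + a * d + j * d)
      ((pev t Q * h) ^+ j * (pev t Q ^+ a * (pev t q * u l))).
    elim: j => [|j /Qd[+ _]]; first by rewrite mul0n addn0 expr0 mul1r.
    by rewrite mulrA -exprS -[(_ + j * d + d)%N]addnA -mulSnr.
  have := key (M - i)%N i.
  have iM : (i <= M)%N by rewrite -ltnS.
  rewrite -addnA -mulnDl subnK//; congr (W _ _).
  have -> : c = pev t Q ^+ (M - i) * pev t Q ^+ i * pev t q.
    by rewrite -exprD subnK.
  by rewrite exprMn; ring.
have [e espan] := Wspan (m + M * d).
have vfree : freemod [set 0] (fun i : 'I_#|{: 'I_N * 'I_M.+1}| => v (enum_val i)).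
  apply: freemod_of_fin => r /= r0 [l i].
  have : \sum_l pev h (\poly_(i < M.+1) r (l, inord i)) * u l = 0.
    apply: (mulfI c0); rewrite mulr0 -[RHS]r0 mulr_sumr.
    rewrite [RHS](eq_bigr (fun z : 'I_N * 'I_M.+1 => r (z.1, z.2) *: v (z.1, z.2))); last by case.
    rewrite -(pair_bigA _ (fun (l : 'I_N) (i : 'I_M.+1) => r (l, i) *: v (l, i)))/=.
    apply: eq_bigr => l' _; rewrite pev_poly mulr_suml mulr_sumr.
    apply: eq_bigr => i' _; rewrite inord_val /v /= !ffield_scaleE; ring.
  move/iu => /(_ l)/(congr1 (fun p : {poly k} => p`_i)).
  by rewrite coef_poly ltn_ord inord_val coef0.
have := freemod_le (@subspace0 _ _) espan (fun i => Wv (enum_val i)) vfree.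
rewrite !card_prod !card_ord /M; nia.
Qed.

End Bound.

Lemma indep_bound (h : F) :
  exists B, forall N (u : 'I_N -> F), indep h u -> (N <= B)%N.
Proof.
have [t tt [n [b bP]]] := fun_field_trdeg1 X.
exact: (indep_bound_aux (transcP tt) bP h).
Qed.

End Independence.

(** * Existence of places *)

Section Places.
Variables (k : fieldType) (X : curve k).
Local Notation F := (ffield X).
Local Notation cst := (constf X : k -> F).

Record subring_over (A : set F) : Prop := {
  sr_const : forall c, A (cst c);
  srB : forall a b, A a -> A b -> A (a - b);
  srM : forall a b, A a -> A b -> A (a * b) }.

Section SubringTheory.
Variables (A : set F) (sA : subring_over A).

Lemma sr1 : A 1. Proof. by have := sr_const sA 1; rewrite rmorph1. Qed.
Lemma sr0 : A 0. Proof. by rewrite -(subrr 1); apply: srB sr1 sr1. Qed.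
Lemma srN a : A a -> A (- a).
Proof. by rewrite -[- a]add0r => Aa; apply: srB => //; exact: sr0. Qed.
Lemma srD a b : A a -> A b -> A (a + b).
Proof. by move=> Aa /srN Ab; rewrite -[b]opprK; exact: srB. Qed.
Lemma srX a n : A a -> A (a ^+ n).
Proof.
move=> Aa; elim: n => [|n IHn]; first by rewrite expr0; exact: sr1.
by rewrite exprS; exact: srM.
Qed.
Lemma sr_sum (I : finType) (P : pred I) (f : I -> F) :
  (forall i, P i -> A (f i)) -> A (\sum_(i | P i) f i).
Proof. by move=> Af; elim/big_ind: _ => //; [exact: sr0|exact: srD]. Qed.

Lemma sr_pev z (p : {poly k}) : A z -> A (pev z p).
Proof.
move=> Az; rewrite (pevE z (leqnn _)); apply: sr_sum => i _.
by rewrite ffield_scaleE; apply: srM => //; [exact: sr_const|exact: srX].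
Qed.

Lemma subring_adjoin u :
  subring_over [set a | exists2 p : {poly F}, forall i, A p`_i & a = p.[u]].
Proof.
split=> [c|_ _ [p Ap ->] [q Aq ->]|_ _ [p Ap ->] [q Aq ->]].
- exists (cst c)%:P; last by rewrite hornerC.
  by move=> i; rewrite coefC; case: eqP => _; [exact: sr_const|exact: sr0].
- exists (p - q); last by rewrite hornerD hornerN.
  by move=> i; rewrite coefB; exact: srB.
exists (p * q); last by rewrite hornerM.
by move=> i; rewrite coefM; apply: sr_sum => j _; exact: srM.
Qed.

End SubringTheory.

Lemma maximal_subring_avoiding (z h : F) :
  (exists A, [/\ subring_over A, A z & ~ A h]) ->
  exists A, [/\ subring_over A, A z, ~ A h &
    forall B, subring_over B -> A `<=` B -> ~ B h -> B `<=` A].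
Proof.
move=> [A0 [sA0 A0z A0h]].
pose P (A : set F) := A = set0 \/ [/\ subring_over A, A z & ~ A h].
have [C CP Ctot|A [[->|[sA Az Ah]] Amax]] := @Zorn_bigcup F P; last first.
- exists A; split=> // B sB AB Bh.
  have [BA|nBA] := pselect (B `<=` A) => //; exfalso.
  apply: (Amax B); first by split.
  by right; split=> //; exact: AB.
- exfalso; apply: (Amax A0); last by right.
  by split=> // /(_ 0); apply; exact: sr0.
have [C0|/existsNP[A1 /not_implyP[CA1 A1n0]]] := pselect (forall A, C A -> A = set0).
  by left; rewrite -subset0 => a [A CA]; rewrite (C0 _ CA).
have srP A : C A -> A !=set0 -> [/\ subring_over A, A z & ~ A h].
  by move=> CA [a Aa]; have [A0E|//] := CP A CA; move: Aa; rewrite A0E.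
have /set0P A1n : A1 != set0 by apply/eqP.
have [sA1 A1z A1h] := srP _ CA1 A1n.
right; split.
- split.
  + by move=> c; exists A1 => //; exact: sr_const.
  + move=> a b [A CA Aa] [B CB Bb].
    have [sA _ _] := srP _ CA (ex_intro _ a Aa).
    have [sB _ _] := srP _ CB (ex_intro _ b Bb).
    have [AB|BA] := Ctot _ _ CA CB.
      by exists B => //; apply: srB => //; exact: AB.
    by exists A => //; apply: srB => //; exact: BA.
  + move=> a b [A CA Aa] [B CB Bb].
    have [sA _ _] := srP _ CA (ex_intro _ a Aa).
    have [sB _ _] := srP _ CB (ex_intro _ b Bb).
    have [AB|BA] := Ctot _ _ CA CB.
      by exists B => //; apply: srM => //; exact: AB.
    by exists A => //; apply: srM => //; exact: BA.
- by exists A1.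
- by move=> [A CA Ah]; have [_ _] := srP _ CA (ex_intro _ h Ah).
Qed.

Section ValuationRing.
Variables (z h : F) (A : set F).
Hypotheses (z0 : z != 0) (hE : h = z^-1).
Hypotheses (sA : subring_over A) (Az : A z) (Ah : ~ A h).
Hypothesis Amax : forall B, subring_over B -> A `<=` B -> ~ B h -> B `<=` A.

(* As [h] is the inverse of [z], [A (a * h)] says that [a] is in the ideal [z A]. *)
Let no_relation N : forall (u : F) (p q : {poly F}), u != 0 ->
  (size p + size q <= N)%N ->
  (forall i, A (p`_i * h)) -> (forall i, A (q`_i * h)) ->
  p.[u] = 1 -> q.[u^-1] = 1 -> False.
Proof.
elim: N => [|N IHN] u p q u0 szN Ip Iq pu qu.
  move: szN; rewrite leqn0 addn_eq0 size_poly_eq0 => /andP[/eqP p0 _].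
  by move: pu; rewrite p0 horner0 => /eqP; rewrite eq_sym oner_eq0.
wlog szqp : u p q u0 szN Ip Iq pu qu / (size q <= size p)%N.
  move=> W; have [qp|/ltnW pq] := leqP (size q) (size p); first exact: (W u p q).
  by apply: (W u^-1 q p) => //; rewrite ?invr_eq0 ?invrK// addnC.
have AI a : A (a * h) -> A a.
  by move=> Aah; have := srM sA Aah Az; rewrite -mulrA hE mulVf// mulr1.
case szp: (size p) => [|[|n]].
- move/eqP: szp; rewrite size_poly_eq0 => /eqP p0.
  by move: pu; rewrite p0 horner0 => /eqP; rewrite eq_sym oner_eq0.
- have [c c0 pE] := size_poly1P _ (introT eqP szp).
  have := Ip 0%N; rewrite pE coefC eqxx.
  by move: pu; rewrite pE hornerC => ->; rewrite mul1r.
pose a := p`_n.+1; pose b0 := q`_0.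
(* Multiply [1 = p(u)] by [1 - b0] and remove its top term by [(1 - b0) u^(n+1) = \sum_(j > 0) q_j
   u^(n+1-j)], which is [q(1/u) = 1] times [u^(n+1)]. The relation stays in the ideal [z A] and
   becomes shorter. *)
pose p' := b0%:P + \poly_(i < n.+1) ((1 - b0) * p`_i + a * q`_(n.+1 - i)).
apply: (IHN u p' q) => //.
- have : (size p' <= n.+1)%N.
    apply: leq_trans (size_polyD _ _) _; rewrite geq_max size_poly andbT.
    exact: leq_trans (size_polyC_leq1 _) _.
  by move: szN; rewrite szp; lia.
- move=> i; rewrite coefD coefC coef_poly mulrDl; apply: srD => //.
    by case: eqP => _; rewrite ?mul0r; [exact: Iq|exact: sr0].
  case: ifP => _; last by rewrite mul0r; exact: sr0.
  rewrite mulrDl -!mulrA; apply: srD => //.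
    apply: srM => //; apply: srB => //; first exact: sr1.
    by apply: AI; exact: Iq.
  by apply: srM => //; apply: AI; exact: Ip.
have szq : (size q <= n.+2)%N by rewrite -szp.
rewrite hornerD hornerC horner_poly.
under eq_bigr do rewrite mulrDl.
rewrite big_split /=.
have -> : \sum_(i < n.+1) (1 - b0) * p`_i * u ^+ i = (1 - b0) * (1 - a * u ^+ n.+1).
  have -> : 1 - a * u ^+ n.+1 = \sum_(i < n.+1) p`_i * u ^+ i.
    by rewrite -pu horner_coef szp big_ord_recr /= -/a addrK.
  by rewrite mulr_sumr; apply: eq_bigr => i _; rewrite mulrA.
have -> : \sum_(i < n.+1) a * q`_(n.+1 - i) * u ^+ i = (1 - b0) * (a * u ^+ n.+1).
  move: qu; rewrite (horner_coef_wide _ szq) big_ord_recl /= expr0 mulr1 => <-.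
  rewrite -/b0 addrAC subrr add0r mulr_suml (reindex_inj rev_ord_inj) /=.
  apply: eq_bigr => i _; rewrite /bump /= add1n.
  have iN : (i < n.+1)%N := ltn_ord i.
  rewrite subSS subSn; last by rewrite leq_subr.
  rewrite subKn -1?ltnS//.
  have -> : u ^+ n.+1 = u ^+ i.+1 * u ^+ (n - i) by rewrite -exprD; congr (_ ^+ _); lia.
  by rewrite exprVn; field; rewrite expf_neq0.
by ring.
Qed.

(** If neither [u] nor its inverse lies in [A], maximality puts [h] in both [A[u]] and [A[u^-1]].
    Multiplying by [z] gives the two relations that [no_relation] excludes. *)
Lemma valuation_ring u : A u \/ A u^-1.
Proof.
apply: contrapT => /not_orP[nAu nAV].
have u0 : u != 0 by apply/eqP => u0; apply: nAu; rewrite u0; exact: sr0.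
have key w : ~ A w -> exists2 p : {poly F}, forall i, A (p`_i * h) & p.[w] = 1.
  move=> nAw; pose B := [set a | exists2 p : {poly F}, forall i, A p`_i & a = p.[w]].
  have sB : subring_over B by exact: subring_adjoin.
  have AB : A `<=` B.
    move=> a Aa; exists a%:P; last by rewrite hornerC.
    by move=> i; rewrite coefC; case: eqP => // _; exact: sr0.
  have Bw : B w.
    exists 'X; last by rewrite hornerX.
    by move=> i; rewrite coefX; case: eqP => // _; [exact: sr1|exact: sr0].
  have [[p Ap pE]|nBh] := pselect (B h); last by case: nAw; exact: (Amax sB).
  exists (z *: p); last by rewrite hornerZ -pE hE mulfV.
  by move=> i; rewrite coefZ hE mulrAC mulfV// mul1r.
have [p Ip pu] := key _ nAu; have [q Iq qu] := key _ nAV.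
exact: (no_relation u0 (leqnn _) Ip Iq pu qu).
Qed.

(** The maximal ideal of [A], that is its non-units; zero is listed apart because [0^-1 = 0] lies in
    [A]. *)
Definition vmax (a : F) := A a /\ (a = 0 \/ ~ A a^-1).

Lemma vmax0 : vmax 0. Proof. by split; [exact: sr0|left]. Qed.

Lemma vmaxP a : a != 0 -> ~ A a^-1 -> vmax a.
Proof. by move=> a0 nA; split; [case: (valuation_ring a)|right]. Qed.

Lemma vmaxM a b : A a -> vmax b -> vmax (a * b).
Proof.
move=> Aa [Ab b0]; split; first exact: srM.
have [->|a0] := eqVneq a 0; first by left; rewrite mul0r.
case: b0 => [->|nA]; first by left; rewrite mulr0.
right=> Aab; apply: nA; have := srM sA Aa Aab.
by rewrite invfM mulrA mulfV// mul1r.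
Qed.

Lemma vmaxD a b : vmax a -> vmax b -> vmax (a + b).
Proof.
have W (x y : F) : vmax x -> vmax y -> y != 0 -> A (x / y) -> vmax (x + y).
  move=> mx my y0 Axy; have -> : x + y = (x / y + 1) * y.
    by rewrite mulrDl divfK// mul1r.
  by apply: vmaxM => //; apply: srD => //; exact: sr1.
move=> ma mb; have [->|a0] := eqVneq a 0; first by rewrite add0r.
have [->|b0] := eqVneq b 0; first by rewrite addr0.
have [ab|] := valuation_ring (a / b); first exact: W.
by rewrite invf_div addrC; exact: W.
Qed.

Lemma vmax_sum (I : finType) (P : pred I) (f : I -> F) :
  (forall i, P i -> vmax (f i)) -> vmax (\sum_(i | P i) f i).
Proof. by move=> mf; elim/big_ind: _ => //; [exact: vmax0|exact: vmaxD]. Qed.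

Lemma vmaxN a : vmax a -> vmax (- a).
Proof. by rewrite -mulN1r; apply: vmaxM; apply: srN => //; exact: sr1. Qed.

Lemma vmax_const c : vmax (cst c) -> c = 0.
Proof.
move=> [_ [/eqP|nA]]; first by rewrite fmorph_eq0 => /eqP.
by case: nA; rewrite -fmorphV; exact: sr_const.
Qed.

(** A strictly increasing chain of principal ideals between those of [w] and the maximal ideal.
    Bounding its length is what makes the valuation discrete. *)
Definition vchain (w : F) n (a : nat -> F) :=
  (forall i, (i < n)%N -> [/\ a i != 0, vmax (a i) & A (w / a i)]) /\
  (forall i j, (i < j < n)%N -> vmax (a i / a j)).

(** In a relation over [k[w]] some coefficient has a nonzero constant term, unless all can be
    divided by [w]. Take the last such index [j] and divide by [a j]: earlier terms lie in the
    maximal ideal by the chain condition, and terms with a factor [w] do because [a j] divides [w].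
    A nonzero constant would then be a non-unit. *)
Lemma vchain_indep w n a : vmax w -> w != 0 -> vchain w n a ->
  indep w (fun i : 'I_n => a i).
Proof.
move=> mw w0 [aP aij] phi phi0.
have [N] : exists N, forall i, (size (phi i) <= N)%N.
  by exists (\max_i size (phi i)) => i; exact: (leq_bigmax i).
elim: N phi phi0 => [|N IHN] phi phi0 sz.
  by move=> i; apply/eqP; rewrite -size_poly_eq0 -leqn0.
have phiE i : phi i = ((phi i)`_0)%:P + drop_poly 1 (phi i) * 'X.
  rewrite -[LHS](poly_take_drop 1) expr1; congr (_ + _).
  apply/polyP => l; rewrite coef_take_poly coefC.
  by case: l.
have pevphi i : pev w (phi i) =
    cst (phi i)`_0 + w * pev w (drop_poly 1 (phi i)).
  by rewrite {1}phiE pevD pevC pevM pevX mulrC.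
have c0 : forall i, (phi i)`_0 = 0.
  apply: contrapT => /existsNP[i0 /eqP ci0].
  have [j cj jmax] := @arg_maxnP _ i0 (fun i => (phi i)`_0 != 0) (fun i => val i) ci0.
  have [aj0 maj waj] := aP j (ltn_ord j).
  case/eqP: cj; apply: vmax_const.
  suff -> : cst (phi j)`_0 = - (\sum_(i | i != j) cst (phi i)`_0 * (a i / a j) +
      w / a j * \sum_i pev w (drop_poly 1 (phi i)) * a i).
    apply/vmaxN/vmaxD.
      apply: vmax_sum => i ij; have [lij|leij] := ltnP i j.
        apply: vmaxM; first exact: sr_const.
        by apply: aij; rewrite lij ltn_ord.
      have [->|/eqP/eqP/jmax] := eqVneq (phi i)`_0 0.
        by rewrite rmorph0 mul0r; exact: vmax0.
      by rewrite /geq /= => leji; move: ij; rewrite -val_eqE eqn_leq leij leji.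
    apply: vmaxM => //; apply: vmax_sum => i _.
    by apply: vmaxM; [apply: sr_pev => //; case: mw|case: (aP i (ltn_ord i))].
  apply/eqP; rewrite -addr_eq0 addrA; apply/eqP.
  apply: (mulIf aj0); rewrite mul0r -[RHS]phi0.
  under [RHS]eq_bigr do rewrite pevphi mulrDl.
  rewrite big_split /= [in RHS](bigD1 j)//= !mulrDl -!addrA; congr (_ + _).
  congr (_ + _).
    by rewrite mulr_suml; apply: eq_bigr => i _; rewrite -mulrA divfK.
  rewrite mulrAC divfK// mulr_sumr; apply: eq_bigr => i _.
  by rewrite mulrA.
have drop0 i : drop_poly 1 (phi i) = 0.
  apply: (IHN (fun i => drop_poly 1 (phi i))); last first.
    by move=> l; rewrite size_drop_poly leq_subLR add1n.
  apply: (mulfI w0); rewrite mulr0 -[RHS]phi0 mulr_sumr; apply: eq_bigr => l _.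
  by rewrite pevphi c0 rmorph0 add0r mulrA.
by move=> i; rewrite phiE c0 drop0 mul0r addr0.
Qed.

Lemma vchain_bound w : vmax w -> w != 0 ->
  exists B, forall n a, vchain w n a -> (n <= B)%N.
Proof.
move=> mw w0; have [B BP] := indep_bound w; exists B => n a aP.
exact: BP (vchain_indep mw w0 aP).
Qed.

Let mz : vmax z.
Proof. by apply: vmaxP => //; rewrite -hE. Qed.

(** The last element of a longest chain generates: an element of the maximal ideal that it does not
    divide would divide it properly and prolong the chain. *)
Lemma vmax_principal : exists pi, [/\ pi != 0, vmax pi &
  forall u, vmax u -> A (u / pi)].
Proof.
have [B BP] := vchain_bound mz z0.
pose P n := `[< exists a, vchain z n a >].
have P1 : P 1%N.
  apply/asboolP; exists (fun=> z); split=> [[|//] _|i j]; last by lia.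
  by split=> //; rewrite mulfV//; exact: sr1.
have bP n : P n -> (n <= B)%N by move=> /asboolP[a]; exact: BP.
have exP : exists n, P n by exists 1%N.
case: (ex_maxnP exP bP) => -[|n] /asboolP[a [aP aij]] maxn.
  by have := maxn _ P1.
have [pi0 mpi zpi] := aP n (ltnSn n).
exists (a n); split=> // u mu; have [->|u0] := eqVneq u 0.
  by rewrite mul0r; exact: sr0.
apply: contrapT => nA.
have mpu : vmax (a n / u).
  by apply: vmaxP; rewrite ?invf_div// mulf_neq0 ?invr_eq0.
have : P n.+2.
  apply/asboolP; exists (fun i => if i == n.+1 then u else a i); split.
    move=> i; rewrite ltnS leq_eqVlt; case: eqP => [_ _|_ /= ilt].
      split=> //; have -> : z / u = (z / a n) * (a n / u) by rewrite mulrA divfK.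
      by apply: srM => //; case: mpu.
    exact: aP.
  move=> i j /andP[ij]; rewrite ltnS leq_eqVlt; case: (eqVneq j n.+1) => [jE _|_ /= jlt].
    have ilt : (i < n.+1)%N by rewrite -jE.
    rewrite (ltn_eqF ilt); move: ilt; rewrite ltnS leq_eqVlt => /orP[/eqP ->//|iltn].
    have -> : a i / u = (a i / a n) * (a n / u) by rewrite mulrA divfK.
    apply: vmaxM => //.
    have iltn2 : (i < n < n.+1)%N by rewrite iltn ltnSn.
    by case: (aij _ _ iltn2).
  rewrite ltn_eqF; first by apply: aij; rewrite ij.
  exact: ltn_trans jlt.
by move/maxn; rewrite ltnn.
Qed.

(** The valuation is the exponent of the generator [pi] of the maximal ideal; what needs an argument
    is that only boundedly many powers of [pi] divide a nonzero element. *)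
Lemma valuation_of_ring : exists v : F -> int, [/\ discrete_valuation v,
  forall c, c != 0 -> v (cst c) = 0 & v h < 0].
Proof.
have [pi [pi0 mpi piP]] := vmax_principal.
have Api : A pi by case: mpi.
pose unit u := [/\ u != 0, A u & A u^-1].
have unitM u u' : unit u -> unit u' -> unit (u * u').
  move=> [u0 Au AV] [u'0 Au' AV']; split; first exact: mulf_neq0.
    exact: srM.
  by rewrite invfM; exact: srM.
have unitV u : unit u -> unit u^-1.
  by move=> [u0 Au AV]; split; rewrite ?invr_eq0 ?invrK.
have unit_notin u : A u -> u != 0 -> ~ vmax u -> unit u.
  by move=> Au u0 nm; split=> //; apply: contrapT => /(vmaxP u0).
have piX n : vmax (pi ^+ n.+1) by rewrite exprSr; apply: vmaxM => //; exact: srX.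
have decA u : A u -> u != 0 -> exists e : nat, unit (u / pi ^+ e).
  move=> Au u0; have [mu|nm] := pselect (vmax u); last first.
    by exists 0%N; rewrite expr0 divr1; exact: unit_notin.
  have [B BP] := vchain_bound mu u0.
  pose P e := `[< A (u / pi ^+ e) >].
  have P0 : P 0%N by apply/asboolP; rewrite expr0 divr1.
  have bP e : P e -> (e <= B)%N.
    (* If [pi^e] divides [u], then [pi^e, ..., pi] is a chain of length [e] for [u]. *)
    move/asboolP => Ae; apply: (BP e (fun i => pi ^+ (e - i))); split.
      move=> i ie; split; first by rewrite expf_neq0.
        by rewrite -(subnSK ie); exact: piX.
      have -> : u / pi ^+ (e - i) = u / pi ^+ e * pi ^+ i.
        rewrite -{2}(subnK (ltnW ie)) exprD; field.
        by rewrite !expf_neq0.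
      by apply: srM => //; exact: srX.
    move=> i j /andP[ij je].
    have -> : pi ^+ (e - i) / pi ^+ (e - j) = pi ^+ (j - i.+1).+1.
      have -> : (e - i = (j - i.+1).+1 + (e - j))%N by lia.
      by rewrite exprD mulfK// expf_neq0.
    exact: piX.
  have exP : exists e, P e by exists 0%N.
  case: (ex_maxnP exP bP) => e /asboolP Ae maxe; exists e.
  apply: unit_notin => //; first by rewrite mulf_neq0// invr_eq0 expf_neq0.
  move/piP; rewrite -mulrA -invfM -exprSr => Ae1.
  by have := maxe e.+1 (asboolT Ae1); rewrite ltnn.
have dec u : exists e : int, u != 0 -> unit (u / pi ^ e).
  have [->|u0] := eqVneq u 0; first by exists 0.
  have [/decA/(_ u0)[e ue]|/decA] := valuation_ring u; first by exists e%:Z.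
  rewrite invr_eq0 => /(_ u0)[e ue]; exists (- e%:Z) => _.
  rewrite -[_ / _]invrK; apply: unitV; rewrite invfM invrK -exprnN.
  exact: ue.
have /choice[v vP] := dec.
have pie (e : int) : pi ^ e != 0 by exact: expfz_neq0.
have unit_pi (e : int) : unit (pi ^ e) -> e = 0.
  have npi n : ~ A (pi ^- n.+1).
    move=> AV; have [_ [/eqP|//]] := piX n.
    by rewrite expf_eq0 (negPf pi0) andbF.
  move=> [_ A1 A2]; case: e A1 A2 => [[|n]|n] //.
    by rewrite -exprnP => _ /npi.
  by rewrite NegzE -exprnN => /npi.
have v_eq u e : u != 0 -> unit (u / pi ^ e) -> v u = e.
  move=> u0 ue; have /unitV := vP _ u0; move/(unitM _ _ ue).
  rewrite invf_div mulrC mulrA divfK//.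
  have -> : pi ^ v u / pi ^ e = pi ^ (v u - e) by rewrite expfzDr// invr_expz.
  by move/unit_pi/eqP; rewrite subr_eq0 => /eqP.
have v_ge u (e : int) : u != 0 -> A (u / pi ^ e) -> e <= v u.
  move=> u0 Au; rewrite leNgt; apply/negP => ve.
  have [_ _ A2] := vP _ u0.
  have A3 : A (pi ^ (v u - e)).
    rewrite expfzDr// -invr_expz.
    have -> : pi ^ v u / pi ^ e = (u / pi ^ e) * (u / pi ^ v u)^-1.
      by field; rewrite u0 !pie.
    exact: srM.
  have : unit (pi ^ (v u - e)).
    split=> //; rewrite invr_expz opprB.
    have : 0 <= e - v u by rewrite subr_ge0 ltW.
    by case: (e - v u) => // n _; exact: srX.
  by move/unit_pi; lia.
have A_ge u (e : int) : u != 0 -> e <= v u -> A (u / pi ^ e).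
  move=> u0 ev; have [_ A1 _] := vP _ u0.
  have -> : u / pi ^ e = (u / pi ^ v u) * pi ^ (v u - e).
    by rewrite expfzDr// -invr_expz; field; rewrite !pie.
  apply: srM => //; have : 0 <= v u - e by rewrite subr_ge0.
  by case: (v u - e) => // n _; exact: srX.
exists v; split.
- split.
  + move=> a b a0 b0; apply: v_eq; first exact: mulf_neq0.
    have := unitM _ _ (vP _ a0) (vP _ b0).
    by rewrite mulrACA -invfM -expfzDr.
  + move=> a b a0 b0 ab0; apply: v_ge => //; rewrite mulrDl.
    by apply: srD => //; apply: A_ge; rewrite // ge_min lexx ?orbT.
  + exists pi => //; apply: v_eq => //; rewrite expr1z mulfV//.
    by split; rewrite ?oner_neq0 ?invr1//; exact: sr1.
- move=> c c0; apply: v_eq; first by rewrite fmorph_eq0.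
  rewrite expr0z divr1; split; first by rewrite fmorph_eq0.
    exact: sr_const.
  by rewrite -fmorphV; exact: sr_const.
have h0 : h != 0 by rewrite hE invr_eq0.
rewrite ltNge; apply/negP => vh; apply: Ah.
by have := A_ge _ _ h0 vh; rewrite expr0z divr1.
Qed.

End ValuationRing.

(** The ring [k[h^-1]] contains [h^-1] but not [h]. A maximal ring with this property is a discrete
    valuation ring over which [h] has a pole, and completeness of the curve makes it the ring of a
    point. *)
Lemma exists_pole (h : F) : transc h -> exists x, pval x h < 0.
Proof.
move=> htr; have h0 : h != 0.
  by apply/eqP => h0; have := htr 'X; rewrite pevX => /(_ h0)/eqP; rewrite polyX_eq0.
have [|A [sA Az Ah Amax]] := @maximal_subring_avoiding h^-1 h.
  exists (range (pev h^-1)); split.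
  - split=> [c|_ _ [p _ <-] [q _ <-]|_ _ [p _ <-] [q _ <-]].
    + by exists c%:P => //; rewrite pevC.
    + by exists (p - q) => //; rewrite pevD pevN.
    + by exists (p * q) => //; rewrite pevM.
  - by exists 'X => //; rewrite pevX.
  - move=> [p _ pE].
    pose n := size p.
    (* From [p(1/h) = h], multiplying by [h^n] reverses [p] and yields a monic equation for [h]. *)
    pose q : {poly k} := 'X^(n.+1) - \poly_(i < n.+1) p`_(n - i).
    have q0 : q = 0.
      apply: htr; rewrite pevD pevN pev_exp pevX pev_poly.
      apply/eqP; rewrite subr_eq0; apply/eqP.
      rewrite exprS -{1}pE (pevE _ (leqnSn n)) mulr_suml.
      rewrite (reindex_inj rev_ord_inj) /=; apply: eq_bigr => i _.
      rewrite subSS !ffield_scaleE -mulrA; congr (_ * _).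
      have -> : h ^+ n = h ^+ (n - i) * h ^+ i.
        by rewrite -exprD subnK// -ltnS.
      by rewrite exprVn mulKf// expf_neq0.
    have := congr1 (fun q : {poly k} => q`_n.+1) q0.
    rewrite coefB coefXn eqxx coef_poly ltnn subr0 coef0 => /eqP.
    by rewrite oner_eq0.
have [v [vP vc vh]] := valuation_of_ring (invr_neq0 h0) (esym (invrK h)) sA Az Ah Amax.
have vP' : @discrete_valuation (fun_field X) v by case: vP.
have [x [xP _]] := curve_complete vP' vc.
by exists x; rewrite xP.
Qed.

End Places.

(** * Valuations and residues at the points of a curve *)

Section ValuationExtra.
Variables (F : fieldType) (v : F -> int) (vP : discrete_valuation v).

Lemma val_ge_le m n a : m <= n -> val_ge v n a -> val_ge v m a.
Proof. by rewrite /val_ge => mn /orP[->//|na]; rewrite (le_trans mn na) orbT. Qed.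

Lemma val_ge0 n : val_ge v n 0. Proof. by rewrite /val_ge eqxx. Qed.

Lemma val_ge_refl a : val_ge v (v a) a. Proof. by rewrite /val_ge lexx orbT. Qed.

Lemma val_geE n a : a != 0 -> val_ge v n a = (n <= v a).
Proof. by rewrite /val_ge => /negPf ->. Qed.

Lemma val_geB n a b : val_ge v n a -> val_ge v n b -> val_ge v n (a - b).
Proof. by move=> na nb; apply: val_geD => //; exact: val_geN. Qed.

Lemma val_ge_sum I (r : seq I) (P : pred I) (f : I -> F) n :
  (forall i, P i -> val_ge v n (f i)) -> val_ge v n (\sum_(i <- r | P i) f i).
Proof. by move=> nf; elim/big_ind: _ => //; [exact: val_ge0|exact: val_geD]. Qed.

Lemma val_geX n a (m : nat) : val_ge v n a -> val_ge v (n *+ m) (a ^+ m).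
Proof.
move=> na; elim: m => [|m IHm]; first by rewrite expr0 val_geE ?oner_neq0// dval1.
by rewrite exprS mulrS; exact: val_geM.
Qed.

Lemma dvalN a : v (- a) = v a.
Proof.
have [->|a0] := eqVneq a 0; first by rewrite oppr0.
by rewrite -mulN1r (dvalM vP) ?oppr_eq0 ?oner_eq0// dvalN1// add0r.
Qed.

Lemma dvalD_lt a b : a != 0 -> b != 0 -> v a < v b ->
  a + b != 0 /\ v (a + b) = v a.
Proof.
move=> a0 b0 ab.
have ab0 : a + b != 0.
  by apply/eqP => /eqP; rewrite addr_eq0 => /eqP aE; move: ab; rewrite aE dvalN ltxx.
split=> //; apply/eqP; rewrite eq_le; apply/andP; split; last first.
  by apply: le_trans (dvalD vP a0 b0 ab0); rewrite le_min lexx ltW.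
rewrite leNgt; apply/negP => lt.
have := dvalD vP ab0 (_ : - b != 0); rewrite oppr_eq0 addrK => /(_ b0 a0).
by rewrite dvalN ge_min !leNgt ab lt.
Qed.

End ValuationExtra.

Section Points.
Variables (k : fieldType) (X : curve k).
Local Notation F := (ffield X).
Local Notation point := (closed_point X).
Implicit Types x y : point.

Definition vv x : F -> int := pval x.

Lemma vvP x : @discrete_valuation F (vv x). Proof. by case: (pvalP x). Qed.

Lemma vv_const x (c : k) : c != 0 -> vv x (constf X c : F) = 0.
Proof. exact: pval_const. Qed.

Lemma subspace_vge x n : subspace [set u : F | val_ge (vv x) n u].
Proof.
split=> [|a u w /= nu nw]; first exact: val_ge0.
apply: (val_geD (vvP x)) => //.
rewrite ffield_scaleE; have [->|a0] := eqVneq a 0.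
  by rewrite rmorph0 mul0r val_ge0.
rewrite -[n]add0r; apply: (val_geM (vvP x)) => //.
by rewrite -(vv_const x a0) val_ge_refl.
Qed.

Definition unif x : F := s2val (cid2 (dval_uniformizer (vvP x))).

Lemma unif_neq0 x : unif x != 0.
Proof. exact: (s2valP (cid2 (dval_uniformizer (vvP x)))). Qed.

Lemma vv_unif x : vv x (unif x) = 1.
Proof. exact: (s2valP' (cid2 (dval_uniformizer (vvP x)))). Qed.

Lemma unifX_neq0 x (n : int) : unif x ^ n != 0.
Proof. by rewrite expfz_neq0// unif_neq0. Qed.

Lemma vv_unifX x n : vv x (unif x ^ n) = n.
Proof. by rewrite (dvalXz (vvP x)) ?unif_neq0// vv_unif mul1r. Qed.

(** Units at [x] are units at [y], so [vv y] is a multiple [e] of [vv x]. Both are normalized, hence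
    [e = 1], and a valuation determines its point. *)
Lemma vv_incl_eq x y :
  (forall u : F, u != 0 -> 0 <= vv x u -> 0 <= vv y u) -> x = y.
Proof.
move=> xy.
have xy0 (u : F) : u != 0 -> vv x u = 0 -> vv y u = 0.
  move=> u0 xu; apply/eqP; rewrite eq_le xy ?xu// andbT -oppr_ge0.
  rewrite -(dvalV (vvP y))//; apply: xy; first by rewrite invr_eq0.
  by rewrite (dvalV (vvP x))// xu.
pose e := vv y (unif x).
have e0 : 0 <= e by apply: xy; rewrite ?unif_neq0// vv_unif.
have vyE (u : F) : u != 0 -> vv y u = e * vv x u.
  move=> u0; have p0 := unifX_neq0 x (- vv x u).
  have := xy0 (u * unif x ^ (- vv x u)).
  rewrite mulf_neq0// !(dvalM (vvP _))// vv_unifX subrr => /(_ isT erefl).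
  rewrite (dvalXz (vvP y)) ?unif_neq0// -/e mulrN => /eqP.
  by rewrite subr_eq0 => /eqP.
have e1 : e = 1.
  have := vyE _ (unif_neq0 y); rewrite vv_unif => /esym.
  move: (vv x _) e e0 {vyE} => m e e0 em.
  have m0 : 0 < m by rewrite ltNge; apply/negP => m0; nia.
  by apply/eqP; rewrite eq_le; apply/andP; split; [rewrite leNgt; apply/negP|]; nia.
have [z [_ zuniq]] := curve_complete (pvalP y) (fun c => @pval_const _ _ y c).
rewrite -(zuniq x); last first.
  by move=> u u0; have := vyE u u0; rewrite e1 mul1r /vv => ->.
by rewrite -(zuniq y).
Qed.

Lemma separate_points x y : x != y ->
  exists z : F, [/\ z != 0, 0 < vv y z & vv x z < 0].
Proof.
have one a b : a != b -> exists u : F, [/\ u != 0, 0 <= vv a u & vv b u < 0].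
  move=> /eqP ab; apply: contrapT => H; apply: ab; apply: vv_incl_eq => u u0 au.
  by rewrite leNgt; apply/negP => bu; apply: H; exists u.
move=> xy; have [u [u0 xu yu]] := one _ _ xy.
have [w [w0 yw xw]] := one y x (contra_neq (@esym _ _ _) xy).
have uV0 : u^-1 != 0 by rewrite invr_eq0.
have vE a : vv a (w / u) = vv a w - vv a u.
  by rewrite (dvalM (vvP a))// (dvalV (vvP a)).
by exists (w / u); split; [exact: mulf_neq0|rewrite vE; lia|rewrite vE; lia].
Qed.

Lemma separate_from y (s : seq point) : y \notin s ->
  exists z : F, [/\ z != 0, 0 < vv y z & forall x, x \in s -> vv x z < 0].
Proof.
elim: s => [_|x s IHs].
  by exists (unif y); rewrite unif_neq0 vv_unif; split.
rewrite inE negb_or => /andP[yx /IHs[z [z0 yz sz]]].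
have [xz|xz] := ltP (vv x z) 0.
  by exists z; split=> // a; rewrite inE => /predU1P[->|/sz].
have [w [w0 yw xw]] := separate_points (contra_neq (@esym _ _ _) yx).
(* As [r] exceeds every [|vv a z|] with [a] in [s] and these orders are negative, none is a multiple
   of [r]: no cancellation can occur in [w ^+ r + z]. *)
pose r := (\sum_(a <- s) `|vv a z|%N).+1.
have wr0 : w ^+ r != 0 by rewrite expf_neq0.
have vwr a : vv a (w ^+ r) = vv a w * r%:Z.
  by rewrite (dvalX (vvP a))// -mulr_natr natz.
have [s0 vx] : w ^+ r + z != 0 /\ vv x (w ^+ r + z) = vv x (w ^+ r).
  apply: (dvalD_lt (vvP x)) => //; rewrite vwr; apply: lt_le_trans xz.
  by rewrite pmulr_llt0.
exists (w ^+ r + z); split=> //.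
  apply: lt_le_trans (dvalD (vvP y) wr0 z0 s0).
  by rewrite lt_min yz andbT vwr mulr_gt0.
move=> a; rewrite inE => /predU1P[->|sa]; first by rewrite vx vwr pmulr_llt0.
have az := sz _ sa.
have ar : (`|vv a z| < r)%N.
  by rewrite ltnS (big_rem a)//= leq_addr.
have ne : vv a (w ^+ r) != vv a z.
  rewrite vwr; apply/eqP; move: (vv a w) (vv a z) az ar => m l l0 lr mE.
  have rpos : 0 < r%:Z by [].
  have [m0|m0] := lerP 0 m; first by have := mulr_ge0 m0 (ltW rpos); lia.
  have : (m + 1) * r%:Z <= 0 by rewrite pmulr_lle0//; lia.
  by rewrite mulrDl mul1r; lia.
move: ne; rewrite neq_lt => /orP[lt|lt].
  by have [_ ->] := dvalD_lt (vvP a) wr0 z0 lt; exact: lt_trans az.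
by rewrite addrC; have [_ ->] := dvalD_lt (vvP a) z0 wr0 lt.
Qed.

(** For [z] vanishing at [y] with poles on [s], the function [1 / (1 + z^M)] is close to 1 at [y]
    and close to 0 on [s]. *)
Lemma approx_indicator y (s : seq point) (N : nat) : y \notin s ->
  exists e : F, val_ge (vv y) N (e - 1) /\
    forall x, x \in s -> val_ge (vv x) N e.
Proof.
move=> ys; have [z [z0 yz sz]] := separate_from ys.
pose M := N.+1; have zM0 : z ^+ M != 0 by rewrite expf_neq0.
have vzM a : vv a (z ^+ M) = vv a z * M%:Z.
  by rewrite (dvalX (vvP a))// -mulr_natr natz.
have [n0 vy] : 1 + z ^+ M != 0 /\ vv y (1 + z ^+ M) = vv y 1.
  apply: (dvalD_lt (vvP y)) => //; first exact: oner_neq0.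
  by rewrite (dval1 (vvP y)) vzM mulr_gt0.
exists (1 + z ^+ M)^-1; split.
  have -> : (1 + z ^+ M)^-1 - 1 = - (z ^+ M / (1 + z ^+ M)) by field.
  rewrite val_geE; last by rewrite oppr_eq0 mulf_neq0// invr_eq0.
  rewrite (dvalN (vvP y)) (dvalM (vvP y)) ?(dvalV (vvP y)) ?invr_eq0//.
  by rewrite vy (dval1 (vvP y)) oppr0 addr0 vzM /M; nia.
move=> x sx; have xz := sz _ sx.
rewrite val_geE ?invr_eq0// (dvalV (vvP x))// addrC.
have [_ ->] : z ^+ M + 1 != 0 /\ vv x (z ^+ M + 1) = vv x (z ^+ M).
  apply: (dvalD_lt (vvP x)) => //; first exact: oner_neq0.
  by rewrite (dval1 (vvP x)) vzM pmulr_llt0.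
by rewrite vzM /M; nia.
Qed.

Lemma weak_approximation (s : seq point) (n : point -> int) (h : point -> F) :
  uniq s ->
  exists u : F, forall x, x \in s -> val_ge (vv x) (n x) (u - h x).
Proof.
move=> us.
have /choice[f fP] y : exists u : F, y \in s ->
    val_ge (vv y) (n y) (u - h y) /\
    forall x, x \in s -> x != y -> val_ge (vv x) (n x) u.
  have [ys|] := boolP (y \in s); last by exists 0.
  (* The precision also absorbs the poles of the factor [h y] at all points of [s]. *)
  pose N := (\sum_(x <- s) (`|n x| + `|vv x (h y)|))%N.
  have [|e [ye se]] := @approx_indicator y (rem y s) N.
    by rewrite mem_rem_uniq// inE eqxx.
  have NP x : x \in s -> n x <= N%:Z + vv x (h y).
    by move=> xs; rewrite /N (big_rem x)//=; lia.
  exists (e * h y) => _; split.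
    have -> : e * h y - h y = (e - 1) * h y by rewrite mulrBl mul1r.
    apply: val_ge_le (NP y ys) _.
    by apply: (val_geM (vvP y)) => //; exact: val_ge_refl.
  move=> x xs xy; apply: val_ge_le (NP x xs) _.
  apply: (val_geM (vvP x)); last exact: val_ge_refl.
  by apply: se; rewrite mem_rem_uniq// inE xy.
exists (\sum_(y <- s) f y) => x xs.
rewrite (big_rem x)//= addrAC.
have [f1 _] := fP x xs.
apply: (val_geD (vvP x)) => //.
rewrite big_seq; apply: (val_ge_sum (vvP x)) => y.
rewrite mem_rem_uniq// inE => /andP[yx ys].
by have [_] := fP y ys; apply; rewrite // eq_sym.
Qed.

End Points.

(** * Residues and leading coefficients *)

Section Residues.
Variables (k : fieldType) (X : curve k).
Variable K : forall x : closed_point X, completion x.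
Local Notation F := (ffield X).
Local Notation point := (closed_point X).
Implicit Types x y : point.

Definition rho x (u : F) : rfield (K x) := @res _ _ _ (K x) (embed (K x) u).

Lemma val_ge_embed x n (u : F) :
  val_ge (@lval _ _ _ (K x)) n (embed (K x) u) = val_ge (vv x) n u.
Proof.
rewrite /val_ge fmorph_eq0; have [//|u0] := eqVneq u 0.
by rewrite lval_embed.
Qed.

Lemma rhoD x (u w : F) : val_ge (vv x) 0 u -> val_ge (vv x) 0 w ->
  rho x (u + w) = rho x u + rho x w.
Proof.
move=> u0 w0; rewrite /rho -resD ?val_ge_embed//.
by congr (res _); exact: (rmorphD (embed (K x))).
Qed.

Lemma rhoM x (u w : F) : val_ge (vv x) 0 u -> val_ge (vv x) 0 w ->
  rho x (u * w) = rho x u * rho x w.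
Proof.
move=> u0 w0; rewrite /rho -resM ?val_ge_embed//.
by congr (res _); exact: (rmorphM (embed (K x))).
Qed.

Lemma rho_const x (c : k) : rho x (constf X c : F) = c%:A.
Proof. exact: res_const. Qed.

Lemma rho1 x : rho x 1 = 1.
Proof. by have := rho_const x 1; rewrite scale1r rmorph1. Qed.

Lemma vge0_const x (c : k) : val_ge (vv x) 0 (constf X c : F).
Proof.
have [->|c0] := eqVneq c 0; first by rewrite rmorph0 val_ge0.
by rewrite -(vv_const x c0) val_ge_refl.
Qed.

Lemma rho_lin x a (u w : F) : val_ge (vv x) 0 u -> val_ge (vv x) 0 w ->
  rho x (a *: u + w) = a *: rho x u + rho x w.
Proof.
move=> u0 w0; have c0 := vge0_const x a.
rewrite ffield_scaleE rhoD//; last by rewrite -[0]addr0; exact: (val_geM (vvP x)).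
by rewrite rhoM// rho_const -scalerAl mul1r.
Qed.

Lemma rho_eq0 x (u : F) : val_ge (vv x) 0 u -> (rho x u == 0) = val_ge (vv x) 1 u.
Proof. by move=> u0; rewrite /rho res_eq0 ?val_ge_embed. Qed.

(** Functions are dense in the completion, and congruence modulo the maximal ideal preserves the
    residue. *)
Lemma rho_surj x c : exists2 u : F, val_ge (vv x) 0 u & rho x u = c.
Proof.
have [a a0 <-] := res_surj c.
have [f af] := lfield_dense a 1.
have vP := lvalP (K x).
have af0 : val_ge (@lval _ _ _ (K x)) 0 (a - embed (K x) f).
  by apply: val_ge_le af.
have f0 : val_ge (@lval _ _ _ (K x)) 0 (embed (K x) f).
  by have := val_geB vP a0 af0; rewrite opprB addrC subrK.
exists f; first by rewrite -val_ge_embed.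
have := resD af0 f0; rewrite subrK => ->.
by have /eqP -> : @res _ _ _ (K x) (a - embed (K x) f) == 0; rewrite ?add0r// res_eq0.
Qed.

(* Meaningful only if [u] has order at least [n] at [x]. *)
Definition lead x (n : int) (u : F) := rho x (u * unif x ^ (- n)).

Lemma val_ge_shift x n (u : F) :
  val_ge (vv x) 0 (u * unif x ^ (- n)) = val_ge (vv x) n u.
Proof.
rewrite /val_ge mulf_eq0 (negPf (unifX_neq0 _ _)) orbF.
have [//|u0] := eqVneq u 0.
by rewrite (dvalM (vvP x)) ?unifX_neq0// vv_unifX subr_ge0.
Qed.

Lemma lead_lin x n a (u w : F) : val_ge (vv x) n u -> val_ge (vv x) n w ->
  lead x n (a *: u + w) = a *: lead x n u + lead x n w.
Proof.
rewrite -!(val_ge_shift x n) => nu nw.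
by rewrite /lead -rho_lin// mulrDl !ffield_scaleE mulrA.
Qed.

Lemma lead_eq0 x n (u : F) : val_ge (vv x) n u ->
  (lead x n u == 0) = val_ge (vv x) (n + 1) u.
Proof.
rewrite -(val_ge_shift x n) => nu; rewrite /lead rho_eq0//.
rewrite /val_ge mulf_eq0 (negPf (unifX_neq0 _ _)) orbF.
have [//|u0] := eqVneq u 0.
by rewrite (dvalM (vvP x)) ?unifX_neq0// vv_unifX lerBrDl.
Qed.

Lemma leadM x m n (u w : F) : val_ge (vv x) m u -> val_ge (vv x) n w ->
  lead x (m + n) (u * w) = lead x m u * lead x n w.
Proof.
rewrite -(val_ge_shift x m) -(val_ge_shift x n) => mu nw.
by rewrite /lead -rhoM// opprD expfzDr ?unif_neq0// mulrACA.
Qed.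

Lemma lead_neq0 x (u : F) : u != 0 -> lead x (vv x u) u != 0.
Proof.
move=> u0; rewrite lead_eq0 ?val_ge_refl// val_geE// -subr_ge0.
by rewrite opprD addrA subrr.
Qed.

Lemma lead_surj x n c : exists2 u : F, val_ge (vv x) n u & lead x n u = c.
Proof.
have [u u0 uc] := rho_surj c.
have E : u * unif x ^ n * unif x ^ (- n) = u.
  by rewrite -mulrA -expfzDr ?unif_neq0// subrr expr0z mulr1.
by exists (u * unif x ^ n); rewrite -?(val_ge_shift x n) /lead E.
Qed.

Lemma lead0 x (u : F) : lead x 0 u = rho x u.
Proof. by rewrite /lead oppr0 expr0z mulr1. Qed.

End Residues.

Lemma fsbig_single (T : choiceType) (R : Type) (idx : R)
    (op : Monoid.com_law idx) (x : T) (f : T -> R) :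
  (forall z, z != x -> f z = idx) -> \big[op/idx]_(z \in [set: T]) f z = f x.
Proof.
move=> f1; rewrite -(@fsbig_widen _ _ _ _ [set x])//; first exact: fsbig_set1.
by move=> z [_ /eqP]; exact: f1.
Qed.

(** * Divisors and functions of prescribed order *)

Section Divisors.
Variables (k : fieldType) (X : curve k).
Variable K : forall x : closed_point X, completion x.
Local Notation F := (ffield X).
Local Notation point := (closed_point X).
Local Notation Div := (Div X).
Local Notation deg := (div_degree K).
Implicit Types (x y : point) (D E : Div) (T : set point).

Lemma divDE D E x : sval (D + E) x = sval D x + sval E x. Proof. by []. Qed.
Lemma divNE D x : sval (- D) x = - sval D x. Proof. by []. Qed.
Lemma divBE D E x : sval (D - E) x = sval D x - sval E x. Proof. by []. Qed.
Lemma div0E x : sval (0 : Div) x = 0. Proof. by []. Qed.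
Lemma divMnE D n x : sval (D *+ n) x = sval D x *+ n.
Proof. by elim: n => [//|n IHn]; rewrite !mulrS divDE IHn. Qed.

Lemma div_ext D E : (forall x, sval D x = sval E x) -> D = E.
Proof. by move=> DE; apply: val_inj; exact: funext. Qed.

Lemma div_sumE (s : seq point) (f : point -> Div) x :
  sval (\sum_(y <- s) f y) x = \sum_(y <- s) sval (f y) x.
Proof.
elim: s => [|y s IHs]; first by rewrite !big_nil.
by rewrite !big_cons divDE IHs.
Qed.

Lemma div_degree0 : deg (0 : Div) = 0.
Proof. by have := div_degreeB K (0 : Div) 0; rewrite !subrr. Qed.

Lemma div_degreeN D : deg (- D) = - deg D.
Proof. by have := div_degreeB K 0 D; rewrite sub0r div_degree0 sub0r. Qed.

Lemma div_degreeD D E : deg (D + E) = deg D + deg E.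
Proof. by rewrite -{1}[E]opprK div_degreeB div_degreeN opprK. Qed.

Lemma div_degreeMn D n : deg (D *+ n) = deg D *+ n.
Proof.
elim: n => [|n IHn]; first by rewrite !mulr0n div_degree0.
by rewrite !mulrS div_degreeD IHn.
Qed.

Lemma div_of_finite (f : point -> int) : finite_set [set x | f x != 0] ->
  exists D, forall x, sval D x = f x.
Proof. by move=> ff; exists (exist _ f (asboolT ff)). Qed.

Fact dpt_subproof x : (fun z : point => (z == x)%:Z) \in @div_pred k X.
Proof.
apply/asboolP; apply: sub_finite_set (finite_set1 x) => z /=.
by case: (z =P x).
Qed.

Definition dpt x : Div :=
  exist _ (fun z : point => (z == x)%:Z) (dpt_subproof x).

Lemma dptE x z : sval (dpt x) z = (z == x)%:Z. Proof. by []. Qed.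

Lemma div_degree_dpt x : deg (dpt x) = (pdeg K x)%:Z.
Proof.
rewrite /div_degree (@fsbig_single _ _ _ _ x)/= ?eqxx ?mulr1// => z /negPf ->.
by rewrite mulr0.
Qed.

Lemma pdeg_gt0 x : (0 < pdeg K x)%N.
Proof. exact: adim_gt0. Qed.

Definition effective_on T E := forall x, 0 <= sval E x /\ (~ T x -> sval E x = 0).

Lemma div_sum_dpt D : exists2 s : seq point, uniq s &
  (forall x, (x \in s) = (sval D x != 0)) /\
  D = \sum_(x <- s) if 0 <= sval D x then dpt x *+ `|sval D x|
                    else - dpt x *+ `|sval D x|.
Proof.
have /asboolP/finite_seqP[s0 s0E] := svalP D.
have sE x : (x \in undup s0) = (sval D x != 0).
  by rewrite mem_undup; apply/idP/idP => [xs|D0];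
    [have : [set` s0] x by []; rewrite -s0E | have : [set x | sval D x != 0] x by []; rewrite s0E].
exists (undup s0); first exact: undup_uniq.
split=> //; apply: div_ext => x; rewrite div_sumE.
have t y : sval (if 0 <= sval D y then dpt y *+ `|sval D y|
                    else - dpt y *+ `|sval D y|) x = (x == y)%:Z * sval D y.
  have [D0|D0] := leP 0 (sval D y); rewrite divMnE ?divNE dptE -mulr_natr natz.
    by rewrite gez0_abs.
  by rewrite ltz0_abs// mulrNN.
under eq_bigr do rewrite t.
have [D0|D0] := eqVneq (sval D x) 0.
  by rewrite D0 big1// => y _; case: (x =P y) => [<-|_]; rewrite ?D0 ?mul1r ?mul0r.
rewrite (big_rem x) ?sE//= eqxx mul1r big_seq big1 ?addr0// => y.
rewrite mem_rem_uniq ?undup_uniq// inE eq_sym => /andP[/negPf -> _].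
by rewrite mul0r.
Qed.

Lemma effective_ind T (P : Div -> Prop) : P 0 ->
  (forall E x, T x -> effective_on T E -> P E -> P (E + dpt x)) ->
  forall E, effective_on T E -> P E.
Proof.
move=> P0 PS E effE; have [s us [sE ->]] := div_sum_dpt E.
suff : effective_on T (\sum_(x <- s) if 0 <= sval E x then dpt x *+ `|sval E x|
   else - dpt x *+ `|sval E x|) /\ P (\sum_(x <- s) if 0 <= sval E x then
     dpt x *+ `|sval E x| else - dpt x *+ `|sval E x|) by case.
have : forall x, x \in s -> T x.
  move=> x; rewrite sE => Ex; apply: contrapT => nT.
  by have [_ /(_ nT) E0] := effE x; rewrite E0 eqxx in Ex.
elim: s {us sE} => [_|x s IHs sT].
  by rewrite big_nil; split.
rewrite big_cons; have [Ex _] := effE x; rewrite Ex.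
have Tx : T x by apply: sT; rewrite mem_head.
elim: `|sval E x|%N => [|n [IHeff IHn]].
  by rewrite mulr0n add0r; apply: IHs => y ys; apply: sT; rewrite inE ys orbT.
rewrite mulrSr addrAC; split; last exact: PS.
move=> z; have [e0 eT] := IHeff z; rewrite divDE dptE; split.
  by rewrite addr_ge0.
move=> nT; rewrite eT//; case: eqP => // zx.
by case: nT; rewrite zx.
Qed.

Lemma effective_degree_ge0 T E : effective_on T E -> 0 <= deg E.
Proof.
apply: (effective_ind (P := fun E => 0 <= deg E)) => [|E' x _ _ E'0].
  by rewrite div_degree0.
by rewrite div_degreeD div_degree_dpt addr_ge0.
Qed.

(** Orders are constrained on [T] only. Finite [T] gives semi-local rings, the complement of a point
    gives the affine ring and its ideals, and all points give the Riemann-Roch spaces. *)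
Definition vset T D : set F :=
  [set u | forall x, T x -> val_ge (vv x) (sval D x) u].

Lemma subspace_vset T D : subspace (vset T D).
Proof.
split=> [x _|a u w nu nw x Tx]; first exact: val_ge0.
by have [_ /(_ a u w)] := subspace_vge x (sval D x); apply; [exact: nu|exact: nw].
Qed.

Lemma vset_le T D E : (forall x, T x -> sval D x <= sval E x) ->
  vset T E `<=` vset T D.
Proof. by move=> DE u uE x Tx; apply: val_ge_le (DE x Tx) (uE x Tx). Qed.

Lemma vsetM T D E u w : vset T D u -> vset T E w -> vset T (D + E) (u * w).
Proof. by move=> Du Ew x Tx; exact: (val_geM (vvP x) (Du x Tx) (Ew x Tx)). Qed.

Lemma vset_dpt_sub T D x : vset T (D + dpt x) `<=` vset T D.
Proof. by apply: vset_le => z _; rewrite divDE dptE lerDl. Qed.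

Lemma lead_vset_ker T D x (u : F) : T x -> vset T D u ->
  (lead K x (sval D x) u = 0 <-> vset T (D + dpt x) u).
Proof.
move=> Tx Du; have le := lead_eq0 K (Du x Tx); split=> [/eqP|H].
  rewrite le => l1 z Tz; rewrite divDE dptE; case: eqP => [->//|_].
  by rewrite addr0; exact: Du.
by apply/eqP; rewrite le; have := H x Tx; rewrite divDE dptE eqxx.
Qed.

Lemma lead_vset_lin T D x a (u w : F) : T x -> vset T D u -> vset T D w ->
  lead K x (sval D x) (a *: u + w) =
  a *: lead K x (sval D x) u + lead K x (sval D x) w.
Proof. by move=> Tx Du Dw; rewrite lead_lin//; [exact: Du|exact: Dw]. Qed.

Definition strong_approx T := forall D x, T x -> forall c : rfield (K x),
  exists2 u, vset T D u & lead K x (sval D x) u = c.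

Lemma strong_approx_finite T : finite_set T -> strong_approx T.
Proof.
move=> /finite_seqP[s0 ->] D x xs c; pose s := undup s0.
have [w w1 wc] := lead_surj (sval D x) c.
have [u uP] := @weak_approximation _ X s (fun y => sval (D + dpt x) y)
  (fun y => if y == x then w else 0) (undup_uniq s0).
have ux : val_ge (vv x) (sval D x + 1) (u - w).
  by have := uP x; rewrite mem_undup eqxx divDE dptE eqxx; exact.
have ux0 : val_ge (vv x) (sval D x) (u - w) by apply: val_ge_le ux; rewrite lerDl.
exists u.
  move=> y /= ys; have := uP y; rewrite mem_undup divDE dptE => /(_ ys).
  case: eqP => [->|_]; last by rewrite addr0 subr0.
  by move=> _; have := val_geD (vvP x) ux0 w1; rewrite subrK.
have := lead_lin K 1 ux0 w1; rewrite !scale1r subrK => ->.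
have /eqP -> : lead K x (sval D x) (u - w) == 0 by rewrite lead_eq0.
by rewrite add0r wc.
Qed.

(** Intended for effective [E]; the absolute value only turns the multiplicity into a natural
    exponent. *)
Definition norm_at (f : F) E : k :=
  \big[*%R/1]_(x \in [set: point]) normf (rho K x f) ^+ `|sval E x|.

Lemma norm_at0 f : norm_at f 0 = 1.
Proof. by apply: fsbig1 => x _; rewrite expr0. Qed.

Lemma norm_atD f D E : (forall x, 0 <= sval D x) -> (forall x, 0 <= sval E x) ->
  norm_at f (D + E) = norm_at f D * norm_at f E.
Proof.
move=> D0 E0; have /asboolP fD := svalP D; have /asboolP fE := svalP E.
have fDE : finite_set ([set x | sval D x != 0] `|` [set x | sval E x != 0]).
  by rewrite finite_setU.
rewrite /norm_at -(fsbig_split_supp _ fDE)/=.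
- apply: eq_fsbigr => x _; rewrite -exprD fctE; congr (_ ^+ _).
  by move: (D0 x) (E0 x); lia.
- by move=> x /not_orP[/negP/negPn/eqP-> _].
- by move=> x /not_orP[_ /negP/negPn/eqP->].
Qed.

Lemma norm_at_dpt f x : norm_at f (dpt x) = normf (rho K x f).
Proof.
rewrite /norm_at (@fsbig_single _ _ _ _ x)/= ?eqxx ?expr1// => z /negPf ->.
by rewrite expr0.
Qed.

(** Each point [x] added to [E] contributes a quotient isomorphic, by leading coefficients, to the
    residue field at [x], where [f] acts as multiplication by its value. *)
Lemma vset_quot_det T f E : strong_approx T -> vset T 0 f ->
  effective_on T E ->
  quot_det (fun u : F => f * u) (vset T 0) (vset T E) `|deg E|
    (norm_at f E).
Proof.
move=> saT f0; move: E.
apply: effective_ind => [|E x Tx effE IHE].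
  rewrite div_degree0 norm_at0; exists (fun=> 0), 0; split; last exact: det_mx00.
    by split=> [[]//|r _|u u0]; [rewrite thinmx0|exists 0; rewrite comb0 subr0].
  by case.
have E0 := effective_degree_ge0 effE.
have -> : `|deg (E + dpt x)%R|%N = (pdeg K x + `|deg E|)%N.
  by rewrite div_degreeD div_degree_dpt; lia.
rewrite norm_atD; [|by move=> y; case: (effE y)|by []].
rewrite norm_at_dpt [X in quot_det _ _ _ _ X]mulrC.
apply: (quot_det_cat (subspace_vset T E)) IHE.
- exact: vset_dpt_sub.
- by apply: vset_le => y _; case: (effE y).
apply: (lead_det (l := lead K x (sval E x))).
- exact: subspace_vset.
- exact: subspace_vset.
- by move=> a u w; exact: lead_vset_lin.
- by move=> u; exact: lead_vset_ker.
- exact: saT.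
move=> u Eu; split; first by have := vsetM f0 Eu; rewrite add0r.
have := leadM K (f0 x Tx) (Eu x Tx).
by rewrite div0E add0r lead0.
Qed.

Lemma vset_dimq T E : strong_approx T -> effective_on T E ->
  dimq (vset T 0) (vset T E) `|deg E|.
Proof.
move=> saT effE.
have f1 : vset T 0 1.
  by move=> x _; rewrite val_geE ?oner_neq0// (dval1 (vvP x)).
by have [e [A [be _ _]]] := vset_quot_det saT f1 effE; exists e.
Qed.

(** Divide a relation of degree [n] in [h] by [h^n]: since [h^-1] vanishes to order at least [E] on
    [T], the combination of the [u i] by the top coefficients lies in [vset T E]. So these
    coefficients vanish, and the degree drops. *)
Lemma indep_of_freemod T E (h : F) N (u : 'I_N -> F) : h != 0 ->
  (forall x, T x -> 0 <= sval E x <= vv x h^-1) ->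
  (forall i, vset T 0 (u i)) -> freemod (vset T E) u -> indep h u.
Proof.
move=> h0 hE u0 fu phi phi0.
have [n] : exists n, forall i, (size (phi i) <= n)%N.
  by exists (\max_i size (phi i)) => i; exact: (leq_bigmax i).
elim: n phi phi0 => [|n IHn] phi phi0 sz.
  by move=> i; apply/eqP; rewrite -size_poly_eq0 -leqn0.
apply: IHn => // i.
suff ci : (phi i)`_n = 0.
  apply/leq_sizeP => j nj; have [->//|nej] := eqVneq j n.
  by move/leq_sizeP: (sz i); apply; rewrite ltn_neqAle eq_sym nej.
suff /rowP/(_ i) : \row_i (phi i)`_n = 0 :> 'rV_N by rewrite !mxE.
apply: fu => x Tx; rewrite /comb; under eq_bigr do rewrite mxE.
have /andP[E0 Eh] := hE x Tx.
have hV0 : val_ge (vv x) 0 h^-1 by rewrite val_geE ?invr_eq0// (le_trans E0 Eh).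
have -> : \sum_i (phi i)`_n *: u i =
    - \sum_i \sum_(j < n) (phi i)`_j *: (h^-1 ^+ (n - j) * u i).
  apply/eqP; rewrite -addr_eq0 -big_split /=; apply/eqP.
  apply: (mulfI (expf_neq0 n h0)); rewrite mulr0 -[RHS]phi0 mulr_sumr.
  apply: eq_bigr => i' _; rewrite (pevE h (sz i')) big_ord_recr /= mulrDl.
  rewrite mulrDr addrC mulr_sumr mulr_suml; congr (_ + _).
    apply: eq_bigr => j _; rewrite !ffield_scaleE.
    have -> : h ^+ n = h ^+ (n - j) * h ^+ j by rewrite -exprD subnK// ltnW.
    by rewrite exprVn; field; rewrite expf_neq0.
  by rewrite !ffield_scaleE; ring.
apply/(val_geN (vvP x))/(val_ge_sum (vvP x)) => i' _.
apply: (val_ge_sum (vvP x)) => j _.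
rewrite ffield_scaleE -[sval E x]add0r; apply: (val_geM (vvP x)).
  exact: vge0_const.
rewrite -[sval E x]addr0; apply: (val_geM (vvP x)); last exact: u0.
have -> : (n - j = (n - j.+1).+1)%N by rewrite subnSK.
rewrite exprS -[sval E x]addr0; apply: (val_geM (vvP x)).
  by rewrite val_geE ?invr_eq0.
by have := val_geX (vvP x) (n - j.+1) hV0; rewrite mul0rn.
Qed.

(** With more than [B] poles, let [E] be their sum: a basis of regular functions modulo [E] on these
    points would be independent over [k[h]] and longer than [B]. *)
Lemma finite_poles (h : F) : h != 0 -> finite_set [set x | vv x h < 0].
Proof.
move=> h0; apply: contrapT => infp.
have [B BP] := indep_bound h.
have [A Asub sA] := infinite_set_fset B.+1 infp.
pose s : seq point := finmap.enum_fset A.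
have us : uniq s by exact: finmap.fset_uniq.
pose T := [set` s]; pose E := \sum_(x <- s) dpt x.
have Ex x : sval E x = (x \in s)%:Z.
  rewrite div_sumE; have [xs|xs] := boolP (x \in s).
    rewrite (big_rem x)//= eqxx big_seq big1 ?addr0// => y.
    by rewrite mem_rem_uniq// inE eq_sym => /andP[/negPf -> _].
  by rewrite big_seq big1// => y ys; rewrite dptE; case: eqP xs => // ->; rewrite ys.
have effE : effective_on T E.
  by move=> x; rewrite Ex; split=> // /negP/negPf ->.
have [e [Te fe _]] := vset_dimq (strong_approx_finite (finite_seq s)) effE.
have /BP : indep h e.
  apply: indep_of_freemod fe => // x xs; rewrite Ex xs /=.
  have : vv x h < 0 by apply: Asub.
  by rewrite (dvalV (vvP x))//; lia.
apply/negP; rewrite -ltnNge; apply: leq_trans sA _.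
suff : (size s)%:Z <= deg E by rewrite finmap.cardfE -?cardfE; lia.
rewrite /E; elim: (s) => [|x s' IHs]; first by rewrite big_nil div_degree0.
by rewrite big_cons div_degreeD div_degree_dpt /= -add1n PoszD lerD// lez_nat pdeg_gt0.
Qed.

End Divisors.

(** * Riemann's theorem *)

Lemma intmulrn (a : int) (n : nat) : a *+ n = a * n%:Z.
Proof. by rewrite -mulr_natr natz. Qed.

Section Riemann.
Variables (k : fieldType) (X : curve k).
Variable K : forall x : closed_point X, completion x.
Hypothesis kX : alg_closed_in_fun_field X.
Local Notation F := (ffield X).
Local Notation point := (closed_point X).
Local Notation Div := (Div X).
Local Notation deg := (div_degree K).
Local Notation vset := (@vset k X).
Implicit Types (x y : point) (D E P Z : Div) (u w h : F).

Lemma const_or_transc h : (exists c, h = constf X c) \/ transc h.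
Proof.
have [/kX|/transcP] := pselect (algebraicOver (constf X) (h : fun_field X)).
  by left.
by right.
Qed.

Lemma const_not_transc (c : k) : ~ transc (constf X c : F).
Proof.
move=> tc; have := tc ('X - c%:P); rewrite pevD pevN pevX pevC subrr.
by move=> /(_ erefl)/eqP; rewrite polyXsubC_eq0.
Qed.

Lemma transc_neq0 h : transc h -> h != 0.
Proof.
by move=> th; apply/eqP => h0; apply: (@const_not_transc 0); rewrite rmorph0 -h0.
Qed.

Lemma transcV h : transc h -> transc h^-1.
Proof.
move=> th; have [[c hE]|//] := const_or_transc h^-1.
have : h = constf X c^-1 by rewrite fmorphV -hE invrK.
by move: th => /[swap] -> /const_not_transc.
Qed.

Lemma exists_fdiv u : u != 0 -> exists D, forall x, sval D x = vv x u.
Proof.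
move=> u0; apply: div_of_finite.
have uV0 : u^-1 != 0 by rewrite invr_eq0.
have ff : finite_set ([set x | vv x u < 0] `|` [set x | vv x u^-1 < 0]).
  by rewrite finite_setU; split; exact: (finite_poles K).
apply: sub_finite_set ff => x /=; rewrite (dvalV (vvP x))// oppr_lt0 neq_lt.
by move=> /orP.
Qed.

Definition fdiv u : Div := xget 0 [set D : Div | forall x, sval D x = vv x u].

Lemma fdivE u x : u != 0 -> sval (fdiv u) x = vv x u.
Proof.
by move=> /exists_fdiv[D DE]; rewrite /fdiv; case: xgetP => [E _ ->//|/(_ D)].
Qed.

Lemma fdivM u w : u != 0 -> w != 0 -> fdiv (u * w) = fdiv u + fdiv w.
Proof.
move=> u0 w0; apply: div_ext => x; rewrite divDE !fdivE ?mulf_neq0//.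
exact: (dvalM (vvP x)).
Qed.

Lemma fdivV u : u != 0 -> fdiv u^-1 = - fdiv u.
Proof.
move=> u0; apply: div_ext => x; rewrite divNE !fdivE ?invr_eq0//.
exact: (dvalV (vvP x)).
Qed.

Lemma fdivX u n : u != 0 -> fdiv (u ^+ n) = fdiv u *+ n.
Proof.
move=> u0; apply: div_ext => x; rewrite divMnE !fdivE ?expf_neq0//.
exact: (dvalX (vvP x)).
Qed.

Definition rrspace D := vset [set: point] (- D).

Lemma subspace_rr D : subspace (rrspace D).
Proof. exact: subspace_vset. Qed.

Lemma rr_le D E : (forall x, sval D x <= sval E x) -> rrspace D `<=` rrspace E.
Proof. by move=> DE; apply: vset_le => x _; rewrite !divNE lerN2. Qed.

Lemma rr0_const u : rrspace 0 u -> exists c, u = constf X c.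
Proof.
move=> u0; have [//|/exists_pole[x]] := const_or_transc u.
have [->|un0] := eqVneq u 0; first by exists 0; rewrite rmorph0.
have := u0 x I; rewrite oppr0 div0E val_geE// leNgt /vv => /negbTE.
by move=> H; rewrite H.
Qed.

Lemma dimq_rr0 : dimq (rrspace 0) [set 0] 1.
Proof.
have v1 x : vv x (1 : F) = 0 by exact: (dval1 (vvP x)).
exists (fun=> 1); split.
- by move=> _ x _; rewrite oppr0 div0E val_geE ?oner_neq0// v1.
- move=> r; rewrite /comb big_ord1 /= ffield_scaleE mulr1 => /eqP.
  rewrite fmorph_eq0 => /eqP r0; apply/rowP => i; rewrite ord1 mxE; exact: r0.
move=> u /rr0_const[c ->]; exists (const_mx c).
by rewrite /comb big_ord1 /= mxE ffield_scaleE mulr1 subrr.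
Qed.

(** Leading coefficients at [x] embed the quotient of the two spaces into the residue field; the
    last clause keeps track of when this embedding is onto. *)
Lemma dimq_rr_step D x n : dimq (rrspace D) [set 0] n ->
  exists m, [/\ (m <= pdeg K x)%N, dimq (rrspace (D + dpt x)) [set 0] (n + m) &
    m = pdeg K x -> forall c, exists2 u, rrspace (D + dpt x) u &
      lead K x (sval (- (D + dpt x)) x) u = c].
Proof.
move=> dD; pose D' := - (D + dpt x).
have DE : - D = D' + dpt x by rewrite /D' opprD subrK.
pose l := lead K x (sval D' x).
have sW := subspace_rr D; have sU := subspace_rr (D + dpt x).
have llin a u w : rrspace (D + dpt x) u -> rrspace (D + dpt x) w ->
    l (a *: u + w) = a *: l u + l w by exact: lead_vset_lin.
have lker u : rrspace (D + dpt x) u -> (l u = 0 <-> rrspace D u).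
  by move=> Du; rewrite /rrspace DE; exact: lead_vset_ker.
have [m [e be]] := basmod_exists sU sW (fun n e => lead_free_le sU sW llin lker (e := e)).
have [Ue fe _] := be.
exists m; split.
- exact: (lead_free_le sU sW llin lker Ue fe).
- apply: (dimq_cat sW) dD _; last by exists e.
    by move=> _ ->; case: sW.
  by apply: rr_le => z; rewrite divDE dptE lerDl.
by move=> mE; exact: (lead_onto sU sW llin lker be mE).
Qed.

Lemma dimq_rr_effective E : effective_on [set: point] E ->
  exists2 n, dimq (rrspace E) [set 0] n & n%:Z <= 1 + deg E.
Proof.
apply: (effective_ind (P := fun E => exists2 n, dimq (rrspace E) [set 0] n &
   n%:Z <= 1 + deg E)) => [|E' x _ _ [n dn nE]].
  by exists 1%N; [exact: dimq_rr0|rewrite div_degree0].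
have [m [mx dm _]] := dimq_rr_step x dn; exists (n + m)%N => //.
by rewrite div_degreeD div_degree_dpt PoszD addrA lerD ?lez_nat.
Qed.

Lemma exists_pos_part D : exists2 E, effective_on [set: point] E &
  forall x, sval E x = Num.max 0 (sval D x).
Proof.
have /asboolP fD := svalP D.
have [|E EE] := @div_of_finite _ X (fun x => Num.max 0 (sval D x)).
  apply: sub_finite_set fD => x /=; apply: contra_neq => ->.
  by rewrite maxxx.
by exists E => // x; rewrite EE le_max lexx; split=> // /(_ I).
Qed.

Lemma dimq_rr_exists D : exists n, dimq (rrspace D) [set 0] n.
Proof.
have [E effE EE] := exists_pos_part D.
have [n [e [Ue fe se]] _] := dimq_rr_effective effE.
have DE : rrspace D `<=` rrspace E.
  by apply: rr_le => x; rewrite EE le_max lexx orbT.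
apply: (basmod_exists (N := n) (subspace_rr D) (@subspace0 _ _)) => m e' Ue' fe'.
exact: (freemod_le (@subspace0 _ _) se (fun i => DE _ (Ue' i)) fe').
Qed.

Definition ell D := sval (cid (dimq_rr_exists D)).
Arguments ell D%_ring_scope.

Lemma ellP D : dimq (rrspace D) [set 0] (ell D).
Proof. exact: (svalP (cid (dimq_rr_exists D))). Qed.

Lemma ell_unique D n : dimq (rrspace D) [set 0] n -> ell D = n.
Proof. exact: dimq_unique (@subspace0 _ _) (ellP D). Qed.

Lemma ell_ge D n (e : 'I_n -> F) : (forall i, rrspace D (e i)) ->
  freemod [set 0] e -> (n <= ell D)%N.
Proof.
have [e' [_ _ se']] := ellP D; exact: (freemod_le (@subspace0 _ _) se').
Qed.

Lemma ell_mono D E : (forall x, sval D x <= sval E x) -> (ell D <= ell E)%N.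
Proof.
move=> DE; have [e [De fe _]] := ellP D.
by apply: ell_ge fe => i; exact: (rr_le DE).
Qed.

Lemma ell_effective E : effective_on [set: point] E -> (ell E)%:Z <= 1 + deg E.
Proof. by move=> /dimq_rr_effective[n /ell_unique ->]. Qed.

Lemma ell_step D x : (ell (D + dpt x) <= ell D + pdeg K x)%N.
Proof.
have [m [mx dm _]] := dimq_rr_step x (ellP D).
by rewrite (ell_unique dm) leq_add2l.
Qed.

Lemma ell_step_onto D x : ell (D + dpt x) = (ell D + pdeg K x)%N ->
  forall c, exists2 u, rrspace (D + dpt x) u &
    lead K x (sval (- (D + dpt x)) x) u = c.
Proof.
have [m [mx dm onto]] := dimq_rr_step x (ellP D).
by rewrite (ell_unique dm) => /addnI; exact: onto.
Qed.

Lemma ell_fdiv D u : u != 0 -> ell (D - fdiv u) = ell D.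
Proof.
have le E w : w != 0 -> (ell E <= ell (E - fdiv w))%N.
  move=> w0; have [e [Ee fe _]] := ellP E.
  apply: (ell_ge (e := fun i => w * e i)) => [i x _|r].
    rewrite opprB divDE fdivE//; apply: (val_geM (vvP x)).
      exact: val_ge_refl.
    exact: Ee.
  have -> : comb (fun i => w * e i) r = w * comb e r.
    rewrite /comb mulr_sumr; apply: eq_bigr => i _.
    by rewrite !ffield_scaleE mulrCA.
  by move=> /= /eqP; rewrite mulf_eq0 (negPf w0) => /eqP/fe.
move=> u0; apply/eqP; rewrite eqn_leq le// andbT.
by have := le (D - fdiv u) u^-1; rewrite invr_eq0 fdivV// opprK subrK; apply.
Qed.

(** Riemann's theorem says that this quantity, nondecreasing in [D], is bounded; the least bound is
    the genus minus one. *)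
Definition phi D : int := deg D - (ell D)%:Z.

Lemma phiE D : phi D = deg D - (ell D)%:Z. Proof. by []. Qed.

Lemma phi_mono D E : (forall x, sval D x <= sval E x) -> phi D <= phi E.
Proof.
move=> DE; have -> : E = D + (E - D) by rewrite addrC subrK.
have : effective_on [set: point] (E - D).
  by move=> x; rewrite divBE subr_ge0; split=> // /(_ I).
apply: (effective_ind (P := fun E' => phi D <= phi (D + E'))) => [|E' x _ _ IH].
  by rewrite addr0.
apply: le_trans IH _; rewrite addrA /phi [deg (_ + dpt x)]div_degreeD.
rewrite div_degree_dpt; have := ell_step (D + E') x.
by move: (ell _) (ell _) (pdeg K x) (deg _) => a b c d; lia.
Qed.

(** The powers of [u] satisfy a relation over [k[h]]. With leading coefficient [f r], the element
    [c = f r(h) u] satisfies a monic one; divided by [c^(r-1)], it expresses [c] through [k[h]] and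
    powers of [c^-1], which is impossible at a pole of [c] where [h] is regular. *)
Lemma integral_multiple h u : transc h -> exists2 q : {poly k}, q != 0 &
  forall x, val_ge (vv x) 0 h -> val_ge (vv x) 0 (pev h q * u).
Proof.
move=> th; have [B BP] := indep_bound h.
have : ~ indep h (fun i : 'I_B.+1 => u ^+ i) by move=> /BP; rewrite ltnn.
move=> /existsNP[f /not_implyP[f0 /existsNP[i0 /eqP fi0]]].
have [r fr rmax] := @arg_maxnP _ i0 (fun i => f i != 0) (fun i => val i) fi0.
have r0 : (0 < r)%N.
  rewrite lt0n; apply/eqP => r0; case/eqP: fr; apply: th.
  rewrite -[RHS]f0 (bigD1 r)//= r0 expr0 mulr1 big1 ?addr0// => i ir.
  have [->|/rmax] := eqVneq (f i) 0; first by rewrite pev0 mul0r.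
  by rewrite /geq /= r0 leqn0 -{1}r0 => /eqP/val_inj; move/eqP: ir.
exists (f r) => // x hx; set c := _ * u.
have [//|] := boolP (val_ge (vv x) 0 c).
rewrite /val_ge negb_or -ltNge => /andP[c0 cx].
have pevx p : val_ge (vv x) 0 (pev h p).
  rewrite (pevE h (leqnn _)); apply: (val_ge_sum (vvP x)) => i _.
  rewrite ffield_scaleE -[0]addr0; apply: (val_geM (vvP x)); first exact: vge0_const.
  by have := val_geX (vvP x) i hx; rewrite mul0rn.
have cVx : val_ge (vv x) 0 c^-1.
  by rewrite val_geE ?invr_eq0// (dvalV (vvP x))// oppr_ge0 ltW.
suff : val_ge (vv x) 0 c by rewrite val_geE// leNgt cx.
have -> : c = - \sum_(i < B.+1 | (i < r)%N)
    pev h (f i) * pev h (f r) ^+ (r.-1 - i) * c^-1 ^+ (r.-1 - i).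
  apply/eqP; rewrite -addr_eq0; apply/eqP.
  apply: (mulIf (expf_neq0 r.-1 c0)); rewrite mul0r mulrDl -exprS prednK//.
  transitivity (pev h (f r) ^+ r.-1 * (\sum_(i < B.+1) pev h (f i) * u ^+ i));
    last by rewrite f0 mulr0.
  rewrite [in RHS](bigD1 r)//= mulrDr.
  congr (_ + _).
    by rewrite /c exprMn mulrA -exprSr prednK.
  rewrite mulr_sumr mulr_suml [RHS](bigID (fun i : 'I__ => (i < r)%N)) /=.
  rewrite [X in _ + X]big1 ?addr0; last first.
    move=> i /andP[ir]; rewrite -leqNgt => ri.
    have [->|/rmax] := eqVneq (f i) 0; first by rewrite pev0 mul0r mulr0.
    by rewrite /geq /= => ir'; case/eqP: ir; apply: val_inj => /=; lia.
  apply: eq_big => [i|i ilt].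
    by rewrite andb_idl// => ilt; apply: contraTneq ilt => ->; rewrite ltnn.
  have XE (z : F) : z ^+ r.-1 = z ^+ (r.-1 - i) * z ^+ i.
    by rewrite -exprD subnK//; lia.
  rewrite !XE exprVn [c ^+ i]exprMn.
  have : c ^+ (r.-1 - i) != 0 by rewrite expf_neq0.
  by move: (c ^+ _) => z z0; field.
apply/(val_geN (vvP x))/(val_ge_sum (vvP x)) => i ilt.
rewrite -[0]addr0; apply: (val_geM (vvP x)); last first.
  by have := val_geX (vvP x) (r.-1 - i) cVx; rewrite mul0rn.
rewrite -[0]addr0; apply: (val_geM (vvP x)) => //.
by rewrite -pev_exp.
Qed.

Lemma exists_pole_div h : h != 0 -> exists2 P,
  effective_on [set x | vv x h < 0] P & forall x, sval P x = Num.max 0 (- vv x h).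
Proof.
move=> h0; have [P _ PE] := exists_pos_part (- fdiv h).
exists P => x; last by rewrite PE divNE fdivE.
rewrite PE divNE fdivE//; split; first by rewrite le_max lexx.
by move=> /= /negP; rewrite -leNgt => vh; apply/max_idPl; rewrite oppr_le0.
Qed.

(** There are [deg P] functions independent over [k[h]]. Made regular away from the poles of [h] and
    multiplied by the powers of [h], they fill the space of [m P] up to a defect independent of
    [m]. *)
Lemma phi_pole_bounded h P : transc h ->
  (forall x, sval P x = Num.max 0 (- vv x h)) ->
  exists g : int, forall m : nat, phi (P *+ m) <= g.
Proof.
move=> th PE; have h0 := transc_neq0 th.
pose T := [set x | vv x h < 0].
have finT : finite_set T by exact: (finite_poles K).
have effP : effective_on T P.
  move=> x; rewrite PE; split; first by rewrite le_max lexx.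
  by move=> /= /negP; rewrite -leNgt => vh; apply/max_idPl; rewrite oppr_le0.
have [e [Te fe _]] := vset_dimq (K := K) (strong_approx_finite finT) effP.
pose N := `|deg P|%N; have NE : deg P = N%:Z.
  by rewrite /N gez0_abs// (effective_degree_ge0 K effP).
have ie : indep h e.
  apply: indep_of_freemod fe => // x Tx.
  rewrite PE le_max lexx /= (dvalV (vvP x))// ge_max lexx andbT.
  by rewrite oppr_ge0 ltW.
have /choice[q qP] (i : 'I_N) : exists q : {poly k}, q != 0 /\
    forall x, val_ge (vv x) 0 h -> val_ge (vv x) 0 (pev h q * e i).
  by have [q] := integral_multiple (e i) th; exists q.
pose c i := pev h (q i) * e i.
have /finite_seqP[s sE] := finT.
(* A bound for the pole orders of all [c i] at the poles of [h]. As [P] is at least 1 at each of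
   these, [h^j c i] belongs to the space of [m P] whenever [j + kap <= m]. *)
pose kap := (\sum_i \sum_(x <- s) `|vv x (c i)|)%N.
have ckap i x : T x -> val_ge (vv x) (- (kap%:Z)) (c i).
  rewrite sE => /= xs; apply: val_ge_le (val_ge_refl _ _).
  have : (`|vv x (c i)| <= kap)%N.
    rewrite /kap (bigD1 i)//= (big_rem x)//= -addnA; exact: leq_addr.
  lia.
exists (N * kap)%:Z => m.
have lem : (N * (m - kap) <= ell (P *+ m))%N.
  pose v (ij : 'I_N * 'I_(m - kap)) : F := h ^+ ij.2 * c ij.1.
  have fv : freemod [set 0] (fun i : 'I_#|{: 'I_N * 'I_(m - kap)}| => v (enum_val i)).
    apply: freemod_of_fin => r /= r0 [i j].
    have : \sum_i pev h (\poly_(j < m - kap)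
        (if insub j is Some j' then r (i, j') else 0) * q i) * e i = 0.
      rewrite -[RHS]r0.
      rewrite [RHS](eq_bigr (fun z : 'I_N * 'I_(m - kap) =>
        r (z.1, z.2) *: v (z.1, z.2))); last by case.
      rewrite -(pair_bigA _ (fun (l : 'I_N) (i : 'I_(m - kap)) => r (l, i) *: v (l, i)))/=.
      apply: eq_bigr => l _; rewrite pevM pev_poly -mulrA mulr_suml.
      apply: eq_bigr => j' _; rewrite valK /v /= /c !ffield_scaleE; ring.
    move/ie => /(_ i)/eqP; rewrite mulf_eq0; have [/negPf -> _] := qP i.
    rewrite orbF => /eqP/(congr1 (fun p : {poly k} => p`_j)).
    by rewrite coef_poly ltn_ord valK coef0.
  have <- : #|{: 'I_N * 'I_(m - kap)}| = (N * (m - kap))%N.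
    by rewrite card_prod !card_ord.
  apply: ell_ge fv => i; case: (enum_val i) => {}i j x _; rewrite divNE divMnE /v /=.
  have [Tx|nTx] := pselect (T x).
    have hx : val_ge (vv x) (vv x h) h by exact: val_ge_refl.
    apply: val_ge_le (val_geM (vvP x) (val_geX (vvP x) j hx) (ckap i x Tx)).
    have vh : vv x h < 0 by [].
    have -> : sval P x = - vv x h by rewrite PE; apply/max_idPr; rewrite oppr_ge0 ltW.
    rewrite !intmulrn.
    have jm : (j < m - kap)%N := ltn_ord j.
    have {jm} : j%:Z + kap%:Z <= m%:Z by lia.
    move: (vv x h) vh (Posz j) (Posz kap) (Posz m) (isT : 0 <= Posz kap) => a a0 b c' d kk jm.
    have : (a + 1) * (d - b) <= 0 by rewrite mulr_le0_ge0; lia.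
    by rewrite mulrDl mulrBr mulNr opprK; lia.
  have [_ /(_ nTx) ->] := effP x; rewrite mul0rn oppr0 -[0]addr0.
  have hx : val_ge (vv x) 0 h.
    by rewrite val_geE// leNgt; apply/negP.
  apply: (val_geM (vvP x)); first by have := val_geX (vvP x) j hx; rewrite mul0rn.
  by have [_] := qP i; exact.
rewrite /phi div_degreeMn NE intmulrn.
have : (N * m <= ell (P *+ m) + N * kap)%N.
  by apply: leq_trans (leq_add lem (leqnn _)); rewrite -mulnDr leq_mul2l; lia.
by rewrite -PoszM; move: (ell _) (N * m)%N (N * kap)%N => a b d; lia.
Qed.

(** For zeros [Z] and poles [P] of [u], multiplication by a power of [u] identifies the spaces of
    [m P] and [m Z]. Their common dimension is [m deg P] and also [m deg Z] up to bounded errors, so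
    the degrees agree. *)
Lemma deg_fdiv u : u != 0 -> deg (fdiv u) = 0.
Proof.
move=> u0; have [[c uc]|tu] := const_or_transc u.
  suff -> : fdiv u = 0 by rewrite div_degree0.
  apply: div_ext => x; rewrite fdivE// div0E uc; apply: vv_const.
  by apply: contra_neq u0 => c0; rewrite uc c0 rmorph0.
have uV0 : u^-1 != 0 by rewrite invr_eq0.
have [P effP PE] := exists_pole_div u0.
have [Z effZ ZE] := exists_pole_div uV0.
have uE : fdiv u = Z - P.
  apply: div_ext => x; rewrite divBE fdivE// PE ZE (dvalV (vvP x))// opprK.
  by move: (vv x u) => a; lia.
have [g gP] := phi_pole_bounded tu PE.
have [g' gP'] := phi_pole_bounded (transcV tu) ZE.
have ellE m : ell (P *+ m) = ell (Z *+ m).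
  rewrite -(ell_fdiv (P *+ m) (expf_neq0 m uV0)) fdivX// fdivV// uE.
  by rewrite opprB -mulrnBl opprB addrC subrK.
have eff T E m : effective_on T E -> effective_on [set: point] (E *+ m).
  move=> effE x; split=> [|/(_ I)//].
  by rewrite divMnE mulrn_wge0//; case: (effE x).
have bP m := ell_effective (eff _ _ m effP).
have bZ m := ell_effective (eff _ _ m effZ).
rewrite uE div_degreeB.
have key m : (deg Z - deg P) * m%:Z <= g' + 1 /\ (deg P - deg Z) * m%:Z <= g + 1.
  have := gP m; have := gP' m; have := bP m; have := bZ m.
  rewrite /phi !div_degreeMn ellE !intmulrn.
  by move: (ell _) => l; lia.
(* This multiple exceeds both error bounds, which forces both differences to be at most zero. *)
have [k1 k2] := (key (`|g| + `|g'| + 2)%N).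
have small (d : int) (N : nat) : d * N%:Z < N%:Z -> d <= 0.
  by move=> dN; rewrite leNgt; apply/negP => d0; move: dN; rewrite ltNge ler_peMl//; lia.
have n1 : g' + 1 < (`|g| + `|g'| + 2)%N%:Z by lia.
have n2 : g + 1 < (`|g| + `|g'| + 2)%N%:Z by lia.
by have := small _ _ (le_lt_trans k1 n1); have := small _ _ (le_lt_trans k2 n2); lia.
Qed.

End Riemann.

Arguments ell [k X] K kX D%_ring_scope.

(** * Stabilization along the multiples of a point *)

Section RiemannRoch.
Variables (k : fieldType) (X : curve k).
Variable K : forall x : closed_point X, completion x.
Hypothesis kX : alg_closed_in_fun_field X.
Local Notation F := (ffield X).
Local Notation point := (closed_point X).
Local Notation Div := (Div X).
Local Notation deg := (div_degree K).
Local Notation vset := (@vset k X).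
Local Notation phi := (@phi k X K kX).
Local Notation ell := (@ell k X K kX).
Implicit Types (x y : point) (D E : Div) (u w h : F).

Lemma phi_dpt_bounded y : exists g : int, forall m : nat, phi (dpt y *+ m) <= g.
Proof.
pose h := (unif y)^-1.
have h0 : h != 0 by rewrite invr_eq0 unif_neq0.
have hy : vv y h = -1 by rewrite (dvalV (vvP y)) ?unif_neq0// vv_unif.
have th : transc h.
  have [[c hE]|//] := const_or_transc kX h.
  by move: hy h0; rewrite hE => /eqP; have [->|c0] := eqVneq c 0;
    [rewrite rmorph0 eqxx|rewrite vv_const].
have [P effP PE] := exists_pole_div K h0.
have [g gP] := phi_pole_bounded K kX th PE.
exists g => m; apply: le_trans (gP m); apply: phi_mono => x.
rewrite !divMnE !intmulrn ler_wpM2r//; have [P0 _] := effP x.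
by rewrite dptE; case: eqP => // ->; rewrite PE hy.
Qed.

Lemma phi_add_effective D E : effective_on [set: point] E ->
  phi (D + E) <= phi D + deg E.
Proof.
move=> effE; rewrite !phiE div_degreeD.
have : (ell D <= ell (D + E))%N.
  by apply: ell_mono => x; rewrite divDE lerDl; case: (effE x).
by move: (ell _) (ell _) (deg _) (deg _) => a b c d; lia.
Qed.

(** A nondecreasing bounded sequence of integers is eventually constant. *)
Lemma phi_stable D y : exists (c : int) (m0 : nat), forall m : nat,
  phi (D + dpt y *+ m) <= c /\ ((m0 <= m)%N -> phi (D + dpt y *+ m) = c).
Proof.
have [g gP] := phi_dpt_bounded y.
have [E effE EE] := exists_pos_part D.
have bnd m : phi (D + dpt y *+ m) <= g + deg E.
  apply: (@le_trans _ _ (phi (dpt y *+ m + E))).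
    by apply: phi_mono => x; rewrite !divDE addrC lerD2l EE le_max lexx orbT.
  by apply: le_trans (phi_add_effective _ effE) _; rewrite lerD2r.
have mono m n : (m <= n)%N -> phi (D + dpt y *+ m) <= phi (D + dpt y *+ n).
  move=> mn; apply: phi_mono => x; rewrite !divDE lerD2l !divMnE !intmulrn.
  by rewrite ler_wpM2l ?lez_nat// dptE.
pose P (n : nat) := `[< exists m, phi (D + dpt y *+ 0) + n%:Z <= phi (D + dpt y *+ m) >].
have exP : exists n, P n by exists 0%N; apply/asboolP; exists 0%N; rewrite addr0.
have bP n : P n -> (n <= `|(g + deg E - phi (D + dpt y *+ 0))%R|)%N.
  by move=> /asboolP[m le]; have := bnd m; move: le;
    move: (phi _) (phi _) (deg _) => a b c; lia.
case: (ex_maxnP exP bP) => n /asboolP[m0 le0] maxn.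
exists (phi (D + dpt y *+ 0) + n%:Z), m0 => m.
have ub m' : phi (D + dpt y *+ m') <= phi (D + dpt y *+ 0) + n%:Z.
  rewrite leNgt; apply/negP => lt.
  have : P n.+1.
    apply/asboolP; exists m'; move: lt; move: (phi _) (phi _) => a b; lia.
  by move/maxn; rewrite ltnn.
split; first exact: ub.
move=> mm; apply/eqP; rewrite eq_le ub /=.
exact: le_trans le0 (mono _ _ mm).
Qed.

Lemma exists_vanishing y x : x != y -> exists2 w, w != 0 &
  exists b : nat, forall z, sval (dpt x - dpt y *+ b) z <= vv z w.
Proof.
move=> xy; have [g gP] := phi_dpt_bounded y.
(* Large enough that [ell (b y) > deg x], so that imposing a zero at [x] leaves a nonzero
   function. *)
pose b := (`|g| + pdeg K x + 1)%N.
have : (0 < ell (dpt y *+ b - dpt x))%N.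
  have := ell_step K kX (dpt y *+ b - dpt x) x; rewrite subrK.
  have := gP b; rewrite !phiE div_degreeMn div_degree_dpt intmulrn.
  have := pdeg_gt0 K y.
  have : b%:Z <= (pdeg K y)%:Z * b%:Z by rewrite ler_peMl// lez_nat pdeg_gt0.
  rewrite /b; lia.
have [e [De fe _]] := ellP K kX (dpt y *+ b - dpt x).
move: (ell _) e De fe => [//|n] e De fe _.
have e0 : e ord0 != 0.
  apply/eqP => e0; have := fe (delta_mx 0 ord0); rewrite /= comb_delta e0.
  by move=> /(_ erefl)/rowP/(_ ord0)/eqP; rewrite !mxE !eqxx oner_eq0.
exists (e ord0) => //; exists b => z.
by have := De ord0 z I; rewrite opprB val_geE.
Qed.

(** A function [w] vanishing at [x], with poles only at [y], trades the point [x] for [b] more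
    copies of [y] within a linear equivalence class; by then [phi] has already reached its limit. *)
Lemma phi_step_stable D x y : exists m0, forall m : nat, (m0 <= m)%N ->
  phi (D + dpt y *+ m + dpt x) = phi (D + dpt y *+ m).
Proof.
have [c [m0 cP]] := phi_stable D y.
have [->|xy] := eqVneq x y.
  exists m0 => m mm; rewrite -addrA -mulrSr.
  by rewrite !(proj2 (cP _))//; exact: leqW.
have [w w0 [b wb]] := exists_vanishing xy.
exists m0 => m mm; apply/eqP; rewrite eq_le; apply/andP; split; last first.
  by apply: phi_mono => z; rewrite [X in _ <= X]divDE lerDl dptE.
rewrite (proj2 (cP m) mm); apply: le_trans (proj1 (cP (m + b)%N)).
have -> : phi (D + dpt y *+ m + dpt x) = phi (D + dpt y *+ m + dpt x - fdiv w).
  by rewrite !phiE ell_fdiv// div_degreeB deg_fdiv// subr0.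
apply: phi_mono => z; have := wb z.
rewrite !(divBE, divDE) (fdivE K)// !divMnE !intmulrn PoszD mulrDr.
by move: (_ * b%:Z) => a; lia.
Qed.

(* [phi (D + m y)] is eventually constant in [m] by Riemann's theorem; allowing
   one more order at [x] then enlarges the space by exactly [deg x]. *)
Lemma rr_lead_onto D x y : exists m0, forall m : nat, (m0 <= m)%N ->
  forall c : rfield (K x), exists2 u, vset [set: point] (D - dpt y *+ m) u &
    lead K x (sval (D - dpt y *+ m) x) u = c.
Proof.
have [m0 mP] := phi_step_stable (- D - dpt x) x y.
exists m0 => m /mP; rewrite addrAC !phiE !subrK.
set A := - D - dpt x + dpt y *+ m => phA c.
have AE : - (A + dpt x) = D - dpt y *+ m.
  by rewrite /A addrAC subrK opprD opprK.
rewrite -AE; apply: ell_step_onto.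
have AE' : - D + dpt y *+ m = A + dpt x by rewrite /A addrAC subrK.
move: phA; rewrite AE' div_degreeD div_degree_dpt.
by move: (ell _) (ell _) (deg _) (pdeg K x) => a b d e; lia.
Qed.

(** Orders at [y] are free here, so the large pole at [y] required by [rr_lead_onto] costs
    nothing. *)
Lemma strong_approx_affine y : strong_approx K (~` [set y]).
Proof.
move=> D x xy c; have [m0 mP] := rr_lead_onto D x y.
have [u uD uc] := mP _ (leqnn m0) c.
have yx : (x == y) = false by apply/eqP.
exists u; last by rewrite -uc divBE divMnE dptE yx mul0rn subr0.
move=> z zy; have := uD z I; rewrite divBE divMnE dptE.
by rewrite (_ : (z == y) = false) ?mul0rn ?subr0//; apply/eqP.
Qed.

End RiemannRoch.

(** * The ring of functions regular away from a point *)

Lemma amull_vbasis (k : fieldType) (L : fieldExtType k) (c : L)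
    (i : 'I_(\dim {:L})) :
  c * (vbasis {:L})`_i = comb (fun j : 'I_(\dim {:L}) => (vbasis {:L})`_j)
    (row i (passmx.mxof (vbasis {:L}) (vbasis {:L}) (amull c))).
Proof.
transitivity (passmx.vecof (vbasis {:L})
  (row i (passmx.mxof (vbasis {:L}) (vbasis {:L}) (amull c)))); last by [].
rewrite rowE -passmx.hom_vecof ?passmx.vecof_delta ?lfunE//.
exact: vbasisP.
Qed.

Section AffineRing.
Variables (k : fieldType) (X : curve k).
Variable K : forall x : closed_point X, completion x.
Hypothesis kX : alg_closed_in_fun_field X.
Local Notation F := (ffield X).
Local Notation point := (closed_point X).
Local Notation Div := (Div X).
Local Notation deg := (div_degree K).
Local Notation vset := (@vset k X).
Variable y : point.
Local Notation d := (pdeg K y).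
Local Notation V m := (rrspace (dpt y *+ m)).
Local Notation R := (vset (~` [set y]) 0).
Implicit Types (u w f g h : F) (a b m n : nat).

Lemma sub_V m n : (m <= n)%N -> V m `<=` V n.
Proof.
by move=> mn; apply: rr_le => x; rewrite !divMnE !intmulrn ler_wpM2l// dptE.
Qed.

Lemma V_sub_R m : V m `<=` R.
Proof.
move=> u Vu x xy; have := Vu x I; rewrite divNE divMnE dptE.
by rewrite (_ : (x == y) = false) ?mul0rn ?oppr0//; apply/eqP.
Qed.

Lemma R_V u m : R u -> val_ge (vv y) (- m%:Z) u -> V m u.
Proof.
move=> Ru yu x _; rewrite divNE divMnE dptE; case: eqP => [->|/eqP xy].
  by rewrite intmulrn mul1r.
by rewrite mul0rn oppr0; apply: Ru => /= /eqP; rewrite (negPf xy).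
Qed.

Lemma V_val m u : V m u -> val_ge (vv y) (- m%:Z) u.
Proof.
by move=> Vu; have := Vu y I; rewrite divNE divMnE dptE eqxx intmulrn mul1r.
Qed.

Lemma VM m n u w : V m u -> V n w -> V (m + n)%N (u * w).
Proof.
by move=> mu nw; move: (vsetM mu nw); rewrite /rrspace -opprD -mulrnDr.
Qed.

Lemma R_absV u n : R u -> (`|vv y u| <= n)%N -> V n u.
Proof. by move=> Ru un; apply: R_V => //; apply: val_ge_le (val_ge_refl _ _); lia. Qed.

Section Blocks.
Variable m0 : nat.
Hypothesis m0P : forall m, (m0 <= m)%N -> forall c : rfield (K y),
  exists2 u, vset [set: point] (0 - dpt y *+ m) u &
    lead K y (sval ((0 : Div) - dpt y *+ m) y) u = c.

Let leadV m := lead K y (- m%:Z).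

Lemma lead_V_onto m (c : rfield (K y)) : (m0 <= m)%N ->
  exists2 u, V m u & leadV m u = c.
Proof.
move=> /m0P/(_ c)[u um uc]; exists u; first by move: um; rewrite sub0r.
by rewrite -uc /leadV sub0r divNE divMnE dptE eqxx intmulrn mul1r.
Qed.

Lemma leadV_ker m u : V m.+1 u -> (leadV m.+1 u = 0 <-> V m u).
Proof.
have E : - (dpt y *+ m) = - (dpt y *+ m.+1) + dpt y.
  by rewrite mulrSr opprD subrK.
move=> Vu; rewrite /rrspace E -(@lead_vset_ker _ _ K)//.
by rewrite divNE divMnE dptE eqxx intmulrn mul1r.
Qed.

Lemma leadV_lin m c u w : V m u -> V m w ->
  leadV m (c *: u + w) = c *: leadV m u + leadV m w.
Proof. by move=> /V_val um /V_val wm; exact: lead_lin. Qed.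

(** Lifts of one fixed basis of the residue field at [y], the same for every [m], so that blocks at
    different levels can be compared. The zero family is only a default, excluded by [m0 <= m]. *)
Definition block (m : nat) : 'I_d -> F :=
  xget (fun=> 0) [set e | basmod (V m.+1) (V m) e /\
     forall i, leadV m.+1 (e i) = (vbasis {: rfield (K y)})`_i].

Lemma blockP m : (m0 <= m)%N -> basmod (V m.+1) (V m) (block m) /\
  forall i, leadV m.+1 (block m i) = (vbasis {: rfield (K y)})`_i.
Proof.
move=> mm; rewrite /block; case: xgetP => // nE.
have [e be le] := lead_basis (l := leadV m.+1) (subspace_rr (dpt y *+ m.+1))
  (subspace_rr (dpt y *+ m)) (@leadV_lin m.+1) (@leadV_ker m)
  (fun c => lead_V_onto c (leqW mm)).
by case: (nE e).
Qed.

Fixpoint tail (m b : nat) : 'I_(b * d) -> F :=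
  match b with
  | 0 => fun=> 0
  | b'.+1 => catf (block m) (@tail m.+1 b')
  end.
Arguments tail : clear implicits.

Lemma tail_basmod m b : (m0 <= m)%N ->
  basmod (V (m + b)%N) (V m) (tail m b).
Proof.
elim: b m => [|b IHb] m mm.
  by split=> [[]//|r _|u]; [rewrite thinmx0|exists 0; rewrite comb0 subr0 -[m]addn0].
have bs := IHb m.+1 (leqW mm); rewrite addSnnS in bs.
apply: (basmod_cat (subspace_rr (dpt y *+ m.+1))) (proj1 (blockP mm)) bs.
  exact: sub_V.
by apply: sub_V; rewrite -addSnnS leq_addr.
Qed.

(** Multiplication by [f] carries each block to the block [a] levels higher, acting by its leading
    coefficient at [y] modulo lower levels: the matrix is block triangular with [b] equal diagonal
    blocks. *)
Lemma tail_mul f a : V a f -> forall m b, (m0 <= m)%N ->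
  exists2 A : 'M[k]_(b * d), \det A = normf (leadV a f) ^+ b &
    forall i, V (m + a)%N (f * tail m b i - comb (tail (m + a) b) (row i A)).
Proof.
move=> Vf m b; elim: b m => [|b IHb] m mm.
  by exists 0; [rewrite det_mx00 expr0|case].
have [A detA AP] := IHb m.+1 (leqW mm).
have ma : (m0 <= m + a)%N by rewrite (leq_trans mm)// leq_addr.
have [bl lbl] := blockP mm; have [bl' lbl'] := blockP ma.
have [inV _ _] := bl; have [inV' _ sp'] := bl'.
have [B BP] := family_mx sp' AP.
pose M := passmx.mxof (vbasis {: rfield (K y)}) (vbasis {: rfield (K y)})
  (amull (leadV a f)).
exists (block_mx M 0 B A); first by rewrite det_lblock detA exprS.
move=> i; case: (split_ordP i) => j ->.
  rewrite [tail m b.+1 _]catf_lshift.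
  have -> : row (lshift (b * d) j) (block_mx M 0 B A) = row_mx (row j M) 0.
    by rewrite /block_mx rowKu row_row_mx row0.
  rewrite [comb _ _]comb_row_mx comb0 addr0.
  have Vfb : V (m + a).+1 (f * block m j).
    by have := VM Vf (inV j); rewrite addnS addnC.
  have sV := subspace_rr (dpt y *+ (m + a).+1).
  have Vc : V (m + a).+1 (comb (block (m + a)) (row j M)).
    exact: subspace_comb.
  apply/leadV_ker; first exact: (subspaceB sV).
  have := leadV_lin (-1) Vc Vfb; rewrite addrC scaleN1r => ->.
  rewrite (lead_comb (l := leadV (m + a).+1) sV
    (subspace_rr (dpt y *+ (m + a))) (@leadV_lin (m + a).+1) (@leadV_ker (m + a)))//.
  have -> : comb (leadV (m + a).+1 \o block (m + a)) (row j M) =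
      comb (fun j => (vbasis {: rfield (K y)})`_j) (row j M).
    by apply: eq_bigr => l _ /=; rewrite lbl'.
  rewrite -amull_vbasis -lbl scaleN1r.
  have := leadM K (V_val Vf) (V_val (inV j)).
  rewrite -opprD -PoszD addnS (addnC a) /leadV => ->.
  by rewrite addNr.
have -> : tail m b.+1 (rshift d j) = tail m.+1 b j by exact: catf_rshift.
have -> : row (rshift d j) (block_mx M 0 B A) = row_mx (row j B) (row j A).
  by rewrite /block_mx rowKd row_row_mx.
rewrite [comb _ _]comb_row_mx opprD addrA (addrAC _ _ (- comb _ (row j A))).
exact: BP.
Qed.

(** Division with remainder by [d] locates the block and the position in it, independently of how a
    tail was cut into parts. *)
Definition tail_seq m (i : nat) : F :=
  block (m + i %/ d) (Ordinal (ltn_pmod i (pdeg_gt0 K y))).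

Lemma tailE m b i : tail m b i = tail_seq m i.
Proof.
elim: b m i => [|b IHb] m i; first by case: i.
case: (split_ordP i) => j ->; rewrite /tail_seq.
  rewrite [LHS]catf_lshift /= divn_small// addn0; congr (block _ _).
  by apply: val_inj; rewrite /= modn_small.
transitivity (tail m.+1 b j); first exact: catf_rshift.
rewrite IHb /tail_seq /=.
rewrite divnDl ?dvdnn// divnn pdeg_gt0 addnA addn1; congr (block _ _).
by apply: val_inj; rewrite /= modnDl.
Qed.

(** Both families are [e0] followed by the blocks of levels [m] to [m + a + b - 1]; only the types
    of the indices differ. *)
Lemma cat_tail_swap N (e0 : 'I_N -> F) m a b
    (e : (N + b * d + a * d = N + a * d + b * d)%N) r :
  comb (catf (catf e0 (tail m a)) (tail (m + a) b)) (castmx (erefl, e) r) =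
  comb (catf (catf e0 (tail m b)) (tail (m + b) a)) r.
Proof.
pose s i := if insub i is Some j then e0 j else tail_seq m (i - N).
have sE a' b' i : catf (catf e0 (tail m a')) (tail (m + a') b') i = s (val i).
  case: (split_ordP i) => j ->; last first.
    rewrite catf_rshift tailE /s insubN /=; last first.
      by rewrite -leqNgt -addnA leq_addr.
    rewrite -addnA addKn /tail_seq divnMDl ?pdeg_gt0// addnA.
    by congr (block _ _); apply: val_inj; rewrite /= modnMDl.
  rewrite catf_lshift; case: (split_ordP j) => l ->.
    by rewrite catf_lshift /s valK.
  rewrite catf_rshift tailE /s insubN /=; last by rewrite -leqNgt leq_addr.
  by rewrite addKn.
rewrite /comb (reindex (cast_ord e)) /=; last first.
  by exists (cast_ord (esym e)) => i _; rewrite ?cast_ordK ?cast_ordKV.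
apply: eq_bigr => i _; rewrite !sE /= castmxE /=.
by congr (_ *: _); congr (r _ _); [apply: val_inj|rewrite cast_ordK].
Qed.

End Blocks.

Lemma R_quotient f (E : Div) u : f != 0 ->
  (forall z, z != y -> sval E z = vv z f) ->
  vset (~` [set y]) E u -> R (u / f).
Proof.
move=> f0 EE Eu z zy; rewrite div0E -(subrr (vv z f)) -(dvalV (vvP z))//.
apply: (val_geM (vvP z)); last exact: val_ge_refl.
by rewrite -EE; [exact: Eu|apply/eqP].
Qed.

Lemma deg_affine_zeros f a (E : Div) : f != 0 -> vv y f = - a%:Z ->
  (forall z, z != y -> sval E z = vv z f) -> sval E y = 0 ->
  deg E = (a * d)%:Z.
Proof.
move=> f0 ya EE Ey; have -> : E = fdiv f + dpt y *+ a.
  apply: div_ext => z; rewrite divDE (fdivE K)// divMnE dptE.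
  by case: eqP => [->|/eqP/EE ->]; rewrite ?mul0rn ?addr0// Ey ya intmulrn mul1r addNr.
rewrite div_degreeD deg_fdiv// add0r div_degreeMn div_degree_dpt intmulrn.
by rewrite -PoszM mulnC.
Qed.

(* The resultant of [f] and [g] is the determinant of [f] on [R / g R], where
   [R] is the ring of functions regular away from [y]. *)
Theorem resultant_symmetry f g a b (Ef Eg : Div) : f != 0 -> g != 0 ->
  R f -> R g -> vv y f = - a%:Z -> vv y g = - b%:Z ->
  (forall z, z != y -> sval Ef z = vv z f) -> sval Ef y = 0 ->
  (forall z, z != y -> sval Eg z = vv z g) -> sval Eg y = 0 ->
  norm_at K f Eg * (-1) ^+ (a * d * (b * d)) *
    normf (lead K y (- b%:Z) g) ^+ a =
  norm_at K g Ef * normf (lead K y (- a%:Z) f) ^+ b.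
Proof.
move=> f0 g0 Rf Rg ya yb EfE Efy EgE Egy.
have [m0 m0P] := rr_lead_onto K kX 0 y y.
have sa := @strong_approx_affine k X K kX y.
have eff (h : F) (E : Div) : R h -> (forall z, z != y -> sval E z = vv z h) ->
    sval E y = 0 -> h != 0 -> effective_on (~` [set y]) E.
  move=> Rh EE Ey h0 z; have [->|zy] := eqVneq z y; first by rewrite Ey.
  split=> [|/contrapT /= zy']; last by rewrite zy' eqxx in zy.
  by rewrite EE// -(val_geE _ _ h0); apply: Rh; exact/eqP.
have Rone : R 1.
  by move=> z _; rewrite val_geE ?oner_neq0// (dval1 (vvP z)).
have [cg [Df [bcg DfP detDf]]] := vset_quot_det sa Rf (eff _ _ Rg EgE Egy g0).
have [cf [Dg [bcf DgP detDg]]] := vset_quot_det sa Rg (eff _ _ Rf EfE Efy f0).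
(* As [g] has degree zero, its zeros away from [y] have degree [b * d]: the cokernel has as many
   basis vectors as the tail has elements. *)
move: cg Df bcg DfP detDf; rewrite (deg_affine_zeros g0 yb EgE Egy) absz_nat.
move=> cg Df [Rcg fcg _] DfP detDf.
move: cf Dg bcf DgP detDg; rewrite (deg_affine_zeros f0 ya EfE Efy) absz_nat.
move=> cf Dg [Rcf fcf _] DgP detDg.
(* Beyond [m0] the blocks are bases, and the remaining summands bound the poles at [y] of the chosen
   bases of both cokernels. *)
pose n0 := (m0 + \sum_i `|vv y (cg i)| + \sum_i `|vv y (cf i)|)%N.
have mn0 : (m0 <= n0)%N by rewrite /n0 -addnA leq_addr.
have Vcg i : V (n0 + b)%N (cg i).
  apply: R_absV; first exact: Rcg.
  by rewrite /n0 (bigD1 i)//=; lia.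
have Vcf i : V (n0 + a)%N (cf i).
  apply: R_absV; first exact: Rcf.
  by rewrite /n0 [X in (_ + X + _)%N](bigD1 i)//=; lia.
have Vf : V a f by apply: R_V => //; rewrite -ya val_ge_refl.
have Vg : V b g by apply: R_V => //; rewrite -yb val_ge_refl.
have [e0 be0] := ellP K kX (dpt y *+ n0).
have [Ve0 fe0 _] := be0.
set N := ell _ _ _ in e0 be0 Ve0 fe0.
(* The spaces of levels [n0 + a] and [n0 + b] get bases extending [e0]. Completed to level
   [n0 + a + b], they give the same family, in which all determinants are taken. *)
pose basA := catf e0 (@tail n0 a); pose basB := catf e0 (@tail n0 b).
pose bas1 := catf basA (@tail (n0 + a) b); pose bas2 := catf basB (@tail (n0 + b) a).
have base m j nj (e : 'I_nj -> F) : (m0 <= m)%N -> basmod (V m) [set 0] e ->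
    basmod (V (m + j)%N) [set 0] (catf e (@tail m j)).
  move=> mm be; apply: (basmod_cat (subspace_rr (dpt y *+ m))) be _.
  - by move=> _ ->; case: (subspace_rr (dpt y *+ m)).
  - by apply: sub_V; exact: leq_addr.
  - exact: (tail_basmod m0P).
have bA : basmod (V (n0 + a)%N) [set 0] basA by exact: base.
have bB : basmod (V (n0 + b)%N) [set 0] basB by exact: base.
have b1 : basmod (V (n0 + a + b)%N) [set 0] bas1.
  by apply: base => //; rewrite (leq_trans mn0)// leq_addr.
have [_ freeA spA] := bA; have [_ freeB spB] := bB; have [_ free1 _] := b1.
have e2 : (N + b * d + a * d = N + a * d + b * d)%N by rewrite addnAC.
have c12 r : comb bas1 (castmx (erefl, e2) r) = comb bas2 r.
  exact: cat_tail_swap.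
have eq0 (u w : F) : [set 0] (u - w) -> u = w.
  by move=> /= /eqP; rewrite subr_eq0 => /eqP.
have inj1 r r' : comb bas1 r = comb bas1 r' -> r = r'.
  move=> rr; apply/eqP; rewrite -subr_eq0; apply/eqP; apply: free1 => /=.
  by rewrite combB rr subrr.
have mulC h m' (e : 'I_m' -> F) r : h * comb e r = comb (fun i => h * e i) r.
  rewrite /comb mulr_sumr; apply: eq_bigr => i _.
  by rewrite !ffield_scaleE mulrCA.
have Vf0 i : V (n0 + a)%N (f * e0 i) by rewrite addnC; apply: VM.
have Vg0 i : V (n0 + b)%N (g * e0 i) by rewrite addnC; apply: VM.
have [F0 F0P] := family_mx spA Vf0; have [G0 G0P] := family_mx spB Vg0.
have [Cf CfP] := family_mx spA Vcf; have [Cg CgP] := family_mx spB Vcg.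
have [A detA AP] := tail_mul m0P Vf b mn0.
have [B detB BP] := tail_mul m0P Vg a mn0.
have [FA FAP] := family_mx spA AP; have [GB GBP] := family_mx spB BP.
pose Fb := castmx (erefl, erefl) (block_mx F0 0 FA A).
pose Ga := castmx (erefl, e2) (block_mx G0 0 GB B).
have FbP i : f * basB i = comb bas1 (row i Fb).
  rewrite /Fb castmx_id /basB /bas1; case: (split_ordP i) => j ->.
    rewrite catf_lshift (eq0 _ _ (F0P j)).
    by rewrite /block_mx rowKu row_row_mx row0 comb_row_mx comb0 addr0.
  rewrite catf_rshift /block_mx rowKd row_row_mx comb_row_mx.
  by rewrite -(eq0 _ _ (FAP j)) subrK.
have GaP i : g * basA i = comb bas1 (row i Ga).
  have -> : row i Ga = castmx (erefl, e2) (row i (block_mx G0 0 GB B)).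
    by apply/rowP => j; rewrite !mxE !castmxE /= !mxE cast_ord_id.
  rewrite c12 /basA /bas2; case: (split_ordP i) => j ->.
    rewrite catf_lshift (eq0 _ _ (G0P j)).
    by rewrite /block_mx rowKu row_row_mx row0 comb_row_mx comb0 addr0.
  rewrite catf_rshift /block_mx rowKd row_row_mx comb_row_mx.
  by rewrite -(eq0 _ _ (GBP j)) subrK.
have FbP' r : f * comb basB r = comb bas1 (r *m Fb).
  by rewrite mulC -comb_mul; congr (comb _ r); apply: funext => i; exact: FbP.
have GaP' r : g * comb basA r = comb bas1 (r *m Ga).
  by rewrite mulC -comb_mul; congr (comb _ r); apply: funext => i; exact: GaP.
have in1 r : comb basA r = comb bas1 (row_mx r 0).
  by rewrite /bas1 comb_row_mx comb0 addr0.
have in2 r : comb basB r = comb bas1 (castmx (erefl, e2) (row_mx r 0)).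
  by rewrite c12 /bas2 comb_row_mx comb0 addr0.
have row_cast m' (M : 'M[k]_(m', _)) i :
    row i (castmx (erefl, e2) M) = castmx (erefl, e2) (row i M).
  by apply/rowP => j; rewrite !mxE !castmxE /= !mxE cast_ord_id.
have comm : F0 *m Ga = G0 *m Fb.
  apply/row_matrixP => i; rewrite !row_mul; apply: inj1.
  by rewrite -GaP' -FbP' -(eq0 _ _ (F0P i)) -(eq0 _ _ (G0P i)) mulrCA.
have divV (h u : F) (E : Div) c : h != 0 -> vv y h = - c%:Z ->
    (forall z, z != y -> sval E z = vv z h) ->
    forall m, vset (~` [set y]) E u -> V (m + c)%N u -> V m (u / h).
  move=> h0 yh EE m Eu Vu; apply: R_V; first exact: (R_quotient h0 EE).
  have := val_geM (vvP y) (V_val Vu) (val_ge_refl (vv y) h^-1).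
  by rewrite (dvalV (vvP y))// yh opprK PoszD opprD addrNK.
have Cg'P j : comb bas1 (row j (castmx (erefl, e2) (row_mx Cg 0))) = cg j.
  by rewrite row_cast row_row_mx row0 -in2 -(eq0 _ _ (CgP j)).
have Cf'P j : comb bas1 (row j (castmx (erefl, erefl) (row_mx Cf 0))) = cf j.
  by rewrite castmx_id row_row_mx row0 -in1 -(eq0 _ _ (CfP j)).
(* The remainder of [f * cg i] modulo the span of [cg] vanishes where [g] does. Its quotient by [g]
   loses [b] orders of pole at [y], hence has coordinates in [basA]. *)
have cokF : exists Y, Cg *m Fb = Df *m castmx (erefl, e2) (row_mx Cg 0) + Y *m Ga.
  have Vw i : V (n0 + a)%N ((f * cg i - comb cg (row i Df)) / g).
    apply: (divV _ _ _ _ g0 yb EgE); first exact: DfP.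
    apply: (subspaceB (subspace_rr _)).
      by rewrite addnAC addnC; exact: VM.
    apply: subspace_comb => [|j]; first exact: subspace_rr.
    by apply: sub_V (Vcg j); rewrite addnAC leq_addr.
  have [Y YP] := family_mx spA Vw; exists Y.
  apply/row_matrixP => i; rewrite linearD /= !row_mul; apply: inj1.
  rewrite combD -FbP' -GaP' -(eq0 _ _ (YP i)) -(eq0 _ _ (CgP i)) -comb_mul.
  rewrite (_ : (fun j => comb bas1 _) = cg); last exact: funext.
  by rewrite [g * _]mulrC divfK// addrC subrK.
have cokG : exists Y, Cf *m Ga =
    Dg *m castmx (erefl, erefl) (row_mx Cf 0) + Y *m Fb.
  have Vw i : V (n0 + b)%N ((g * cf i - comb cf (row i Dg)) / f).
    apply: (divV _ _ _ _ f0 ya EfE); first exact: DgP.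
    apply: (subspaceB (subspace_rr _)).
      by rewrite addnAC addnC; exact: VM.
    apply: subspace_comb => [|j]; first exact: subspace_rr.
    by apply: sub_V (Vcf j); rewrite addnAC leq_addr.
  have [Y YP] := family_mx spB Vw; exists Y.
  apply/row_matrixP => i; rewrite linearD /= !row_mul; apply: inj1.
  rewrite combD -FbP' -GaP' -(eq0 _ _ (YP i)) -(eq0 _ _ (CfP i)) -comb_mul.
  rewrite (_ : (fun j => comb bas1 _) = cf); last exact: funext.
  by rewrite [f * _]mulrC divfK// addrC subrK.
have [Y1 Y1P] := cokF; have [Y2 Y2P] := cokG.
(* The vectors [h * e0 i] lie in the ideal of [h], modulo which [c] is free; the joint family is
   therefore free and its coordinate matrix invertible. *)
have unitC (h : F) (E : Div) p (c : 'I_p -> F) (e : 'I_(N + p) -> F)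
    (H0 : 'M_(N, N + p)) (C : 'M_(p, N + p)) : h != 0 ->
    (forall i, vset (~` [set y]) E (h * e0 i)) ->
    freemod (vset (~` [set y]) E) c ->
    (forall i, [set 0] (h * e0 i - comb e (row i H0))) ->
    (forall i, [set 0] (c i - comb e (row i C))) -> col_mx H0 C \in unitmx.
  move=> h0 hE fc H0P CP.
  apply: (basmod_unit setT (e := e) (e' := catf (fun i => h * e0 i) c)
    (@subspace0 _ _)).
    apply: freemod_cat fc => //; first exact: subspace_vset.
      by move=> _ ->; case: (subspace_vset (~` [set y]) E).
    by move=> r /= /eqP; rewrite -mulC mulf_eq0 (negPf h0) => /eqP/fe0.
  move=> i; case: (split_ordP i) => j ->.
    by rewrite catf_lshift rowKu; exact: H0P.
  by rewrite catf_rshift rowKd; exact: CP.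
have inE (h : F) (E : Div) i : (forall z, z != y -> sval E z = vv z h) ->
    vset (~` [set y]) E (h * e0 i).
  move=> EE z zy; rewrite -[sval E z]addr0; apply: (val_geM (vvP z)).
    by rewrite EE ?val_ge_refl//; apply/eqP.
  exact: (V_sub_R (Ve0 i)).
have uF : col_mx F0 Cf \in unitmx.
  exact: (unitC f Ef _ cf basA _ _ f0 (fun i => inE f Ef i EfE) fcf).
have uG : col_mx G0 Cg \in unitmx.
  exact: (unitC g Eg _ cg basB _ _ g0 (fun i => inE g Eg i EgE) fcg).
have := det_resultant_sym (e1 := erefl) (e2 := e2) uF uG comm Y1P Y2P.
by rewrite detDf detDg detA detB.
Qed.

End AffineRing.

(** * Weil reciprocity *)

Lemma normfX (k : fieldType) (L : fieldExtType k) (c : L) n :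
  normf (c ^+ n) = normf c ^+ n.
Proof.
elim: n => [|n IHn]; first by rewrite !expr0 Defs.normf1.
by rewrite !exprS normfM IHn.
Qed.

Lemma normf_neq0 (k : fieldType) (L : fieldExtType k) (c : L) :
  c != 0 -> normf c != 0.
Proof.
move=> c0; have := normfM c c^-1; rewrite mulfV// Defs.normf1.
by apply: contra_eq_neq => ->; rewrite mul0r oner_neq0.
Qed.

Section WeilReciprocity.
Variables (k : fieldType) (X : curve k).
Variable K : forall x : closed_point X, completion x.
Hypothesis kX : alg_closed_in_fun_field X.
Local Notation F := (ffield X).
Local Notation point := (closed_point X).
Local Notation Div := (Div X).
Local Notation vset := (@vset k X).
Implicit Types (x y z : point) (u w f g h : F).

Definition tame x f g : k := local_symbol (embed (K x) f) (embed (K x) g).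

Definition weil_symbol f g : k :=
  \big[*%R/1]_(x \in [set: point]) tame x f g.

Lemma embed_neq0 x f : f != 0 -> embed (K x) f != 0.
Proof. by move=> f0; rewrite fmorph_eq0. Qed.

Lemma lval_embedE x f : f != 0 -> lval (embed (K x) f) = vv x f.
Proof. exact: lval_embed. Qed.

Lemma tameMl x f g h : f != 0 -> g != 0 -> h != 0 ->
  tame x (f * g) h = tame x f h * tame x g h.
Proof.
move=> f0 g0 h0; rewrite /tame -local_symbolMl ?embed_neq0//.
by congr local_symbol; exact: (rmorphM (embed (K x))).
Qed.

Lemma tameC x f g : f != 0 -> g != 0 -> tame x f g * tame x g f = 1.
Proof. by move=> f0 g0; rewrite /tame local_symbolC ?embed_neq0. Qed.

Lemma tame_trivial x f g : f != 0 -> g != 0 -> vv x f = 0 -> vv x g = 0 ->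
  tame x f g = 1.
Proof. by move=> f0 g0 fx gx; rewrite /tame local_symbol1 ?lval_embedE. Qed.

Lemma finite_vv_support f : f != 0 -> finite_set [set x | vv x f != 0].
Proof.
move=> f0; have [D DE] := exists_fdiv K f0.
have /asboolP := svalP D; apply: sub_finite_set => x /=.
by rewrite DE.
Qed.

Lemma vv_unsupported f x : ~ [set x | vv x f != 0] x -> vv x f = 0.
Proof. by move=> /negP; rewrite negbK => /eqP. Qed.

Lemma weil_symbolMl f g h : f != 0 -> g != 0 -> h != 0 ->
  weil_symbol (f * g) h = weil_symbol f h * weil_symbol g h.
Proof.
move=> f0 g0 h0.
have fin : finite_set ([set x | vv x f != 0] `|` [set x | vv x g != 0] `|`
    [set x | vv x h != 0]).
  by rewrite !finite_setU; split; [split|]; exact: finite_vv_support.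
rewrite /weil_symbol -(fsbig_split_supp _ fin)/=.
- by apply: eq_fsbigr => x _; rewrite tameMl.
- move=> x /not_orP[/not_orP[/vv_unsupported fx _] /vv_unsupported hx].
  exact: tame_trivial.
- move=> x /not_orP[/not_orP[_ /vv_unsupported fx] /vv_unsupported hx].
  exact: tame_trivial.
Qed.

Lemma weil_symbolC f g : f != 0 -> g != 0 ->
  weil_symbol f g * weil_symbol g f = 1.
Proof.
move=> f0 g0.
have fin : finite_set ([set x | vv x f != 0] `|` [set x | vv x g != 0]).
  by rewrite finite_setU; split; exact: finite_vv_support.
rewrite /weil_symbol -(fsbig_split_supp _ fin)/=.
- by apply: fsbig1 => x _; rewrite tameC.
- by move=> x /not_orP[/vv_unsupported fx /vv_unsupported gx]; exact: tame_trivial.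
- by move=> x /not_orP[/vv_unsupported fx /vv_unsupported gx]; exact: tame_trivial.
Qed.

Lemma weil_symbol_sym f g : f != 0 -> g != 0 ->
  weil_symbol f g = 1 -> weil_symbol g f = 1.
Proof. by move=> f0 g0 fg; have := weil_symbolC f0 g0; rewrite fg mul1r. Qed.

Lemma weil_symbol_div f g h : f != 0 -> g != 0 -> h != 0 ->
  weil_symbol f h = 1 -> weil_symbol g h = 1 -> weil_symbol (f / g) h = 1.
Proof.
move=> f0 g0 h0 fh gh; have gV0 : g^-1 != 0 by rewrite invr_eq0.
have := weil_symbolMl (mulf_neq0 f0 gV0) g0 h0.
by rewrite divfK// fh gh mulr1.
Qed.

Lemma rhoX x u n : val_ge (vv x) 0 u -> rho K x (u ^+ n) = rho K x u ^+ n.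
Proof.
move=> u0; elim: n => [|n IHn]; first by rewrite !expr0 rho1.
by rewrite !exprS rhoM// ?IHn//; have := val_geX (vvP x) n u0; rewrite mul0rn.
Qed.

Lemma tame_unitl x f g (n : nat) : f != 0 -> g != 0 -> vv x f = 0 ->
  vv x g = n%:Z -> tame x f g = normf (rho K x f) ^+ n.
Proof.
move=> f0 g0 fx gx; rewrite /tame /local_symbol !lval_embedE// fx gx.
rewrite mulr0 mul0r !expr0z mul1r divr1 -normfX; congr normf.
have fx0 : val_ge (vv x) 0 f by rewrite val_geE// fx.
by rewrite -rhoX// -exprnP /rho; congr (res _); rewrite rmorphXn.
Qed.

(** The powers of the uniformizer cancel in [f^(-b) / g^(-a)], which leaves leading coefficients,
    the form in which [y] enters [resultant_symmetry]. *)
Lemma tame_poles y f g (a b : nat) : f != 0 -> g != 0 ->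
  vv y f = - a%:Z -> vv y g = - b%:Z ->
  tame y f g * normf (lead K y (- a%:Z) f) ^+ b =
  (-1) ^+ (a * b * pdeg K y) * normf (lead K y (- b%:Z) g) ^+ a.
Proof.
move=> f0 g0 yf yg; rewrite /tame /local_symbol !lval_embedE// yf yg.
have -> : (pdeg K y)%:Z * - a%:Z * - b%:Z = (a * b * pdeg K y)%N%:Z.
  by rewrite !PoszM; ring.
rewrite -exprnP -mulrA; congr (_ * _).
rewrite -!normfX -normfM; congr normf.
have E n h : embed (K y) h ^ n = embed (K y) (h ^ n).
  by case: n => m; rewrite ?NegzE -?exprnN -?exprnP ?fmorphV ?rmorphXn.
have -> : embed (K y) f ^ (- b%:Z) / embed (K y) g ^ (- a%:Z) =
    embed (K y) (f ^ (- b%:Z) / g ^ (- a%:Z)).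
  by rewrite !E -fmorphV -(rmorphM (embed (K y))).
have fa : val_ge (vv y) 0 (f * unif y ^ a%:Z).
  by have := val_ge_shift y (- a%:Z) f; rewrite opprK => ->; rewrite -yf val_ge_refl.
have gb : val_ge (vv y) 0 (g * unif y ^ b%:Z).
  by have := val_ge_shift y (- b%:Z) g; rewrite opprK => ->; rewrite -yg val_ge_refl.
rewrite /lead !opprK -!rhoX// -[res _]/(rho K y _) -rhoM//; last first.
- by have := val_geX (vvP y) b fa; rewrite mul0rn.
- rewrite val_geE ?mulf_neq0 ?invr_eq0 ?expfz_neq0//.
  rewrite (dvalM (vvP y)) ?invr_eq0 ?expfz_neq0// (dvalV (vvP y)) ?expfz_neq0//.
  by rewrite !(dvalXz (vvP y))// yf yg; lia.
congr (rho K y _).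
rewrite !exprMn -!exprnP -!exprnN invrK.
rewrite -!exprM (mulnC a b).
have : f ^+ b != 0 by rewrite expf_neq0.
by move: (f ^+ b) => z z0; field.
Qed.

Lemma val_lead_exact x n u : val_ge (vv x) n u -> lead K x n u != 0 ->
  u != 0 /\ vv x u = n.
Proof.
move=> nu; rewrite lead_eq0// /val_ge negb_or => /andP[u0].
rewrite -ltNge => lt; split=> //; move: nu.
by rewrite val_geE// => nu; apply/eqP; rewrite eq_le nu andbT -ltzD1.
Qed.

Lemma vv_near x u w : w != 0 -> val_ge (vv x) (vv x w + 1) (u - w) ->
  u != 0 /\ vv x u = vv x w.
Proof.
move=> w0; have [/eqP|uw0] := eqVneq (u - w) 0.
  by rewrite subr_eq0 => /eqP ->.
rewrite val_geE// => lt.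
have [] := dvalD_lt (vvP x) w0 uw0 _; first by lia.
by rewrite addrC subrK.
Qed.

(** * Divisors meeting at one point only *)

Section AtPoint.
Variable y : point.
Local Notation R := (vset (~` [set y]) 0).

Lemma R_val f z : R f -> z != y -> f != 0 -> 0 <= vv z f.
Proof. by move=> Rf /eqP zy f0; rewrite -val_geE//; exact: Rf. Qed.

Lemma R_pole_order f : R f -> f != 0 -> exists a : nat, vv y f = - a%:Z.
Proof.
move=> Rf f0; have [yf|/ltW yf] := leP 0 (vv y f); last first.
  by exists `|vv y f|%N; lia.
have [|c fc] := @rr0_const _ _ kX f.
  move=> z _; rewrite oppr0 div0E val_geE//.
  by have [->//|zy] := eqVneq z y; exact: R_val.
exists 0%N; rewrite fc oppr0; apply: vv_const.
by apply: contra_neq f0 => c0; rewrite fc c0 rmorph0.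
Qed.

Lemma exists_affine_div f : f != 0 -> exists E : Div,
  (forall z, z != y -> sval E z = vv z f) /\ sval E y = 0.
Proof.
move=> f0; have [|E EE] := @div_of_finite _ X (fun z => if z == y then 0 else vv z f).
  apply: sub_finite_set (finite_vv_support f0) => z /=.
  by case: (z == y); rewrite ?eqxx.
by exists E; split=> [z zy|]; rewrite EE ?(negPf zy) ?eqxx.
Qed.

Lemma norm_at_neq0 g (E : Div) : R g -> g != 0 ->
  effective_on [set z | z != y /\ vv z g = 0] E -> norm_at K g E != 0.
Proof.
move=> Rg g0; move: E; apply: effective_ind => [|E z [zy gz] effE IH].
  by rewrite norm_at0 oner_neq0.
rewrite norm_atD; [|by move=> w; case: (effE w)|by []].
rewrite norm_at_dpt mulf_neq0// normf_neq0// -lead0.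
by have := lead_neq0 K z g0; rewrite gz.
Qed.

(** Away from [y] each point contributes the norm of [f] at a zero of [g] or the inverse norm of [g]
    at a zero of [f]. These multiply to the quotient of the two resultants, which
    [resultant_symmetry] shows to be the inverse of the symbol at [y]. *)
Lemma weil_symbol_affine f g : f != 0 -> g != 0 -> R f -> R g ->
  (forall z, z != y -> vv z f = 0 \/ vv z g = 0) -> weil_symbol f g = 1.
Proof.
move=> f0 g0 Rf Rg cop.
have [a ya] := R_pole_order Rf f0; have [b yb] := R_pole_order Rg g0.
have [Ef [EfE Efy]] := exists_affine_div f0.
have [Eg [EgE Egy]] := exists_affine_div g0.
have res := resultant_symmetry K kX f0 g0 Rf Rg ya yb EfE Efy EgE Egy.
have tam := tame_poles f0 g0 ya yb.
have effEf : effective_on [set z | z != y /\ vv z g = 0] Ef.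
  move=> z; have [->|zy] := eqVneq z y; first by rewrite Efy.
  rewrite EfE// R_val//; split=> // nz.
  by have [//|gz] := cop z zy; case: nz.
have fin : finite_set ([set x | vv x f != 0] `|` [set x | vv x g != 0] `|` [set y]).
  by rewrite !finite_setU; split=> //; split; exact: finite_vv_support.
have Ef0 x : vv x f = 0 -> sval Ef x = 0.
  by have [->|xy] := eqVneq x y; rewrite ?Efy// EfE.
have Eg0 x : vv x g = 0 -> sval Eg x = 0.
  by have [->|xy] := eqVneq x y; rewrite ?Egy// EgE.
have glob : weil_symbol f g * norm_at K g Ef = norm_at K f Eg * tame y f g.
  have -> : tame y f g =
      \big[*%R/1]_(x \in [set: point]) (if x == y then tame y f g else 1).
    rewrite (@fsbig_single _ _ _ _ y) ?eqxx// => x xy.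
    by rewrite (negPf xy).
  rewrite /weil_symbol /norm_at -!(fsbig_split_supp _ fin)/=;
    try by move=> x /not_orP[/not_orP[/vv_unsupported fx /vv_unsupported gx]
      /eqP/negPf xy]; rewrite ?Ef0 ?Eg0 ?xy ?tame_trivial.
  apply: eq_fsbigr => x _; have [->|xy] := eqVneq x y.
    by rewrite Efy Egy !expr0 mulr1 mul1r.
  rewrite mulr1 EfE// EgE//.
  have fx := R_val Rf xy f0; have gx := R_val Rg xy g0.
  have [fx0|gx0] := cop x xy.
    rewrite fx0 expr0 mulr1; apply: tame_unitl => //.
    by rewrite gez0_abs.
  rewrite gx0 expr0 -(tame_unitl (x := x) g0 f0 gx0) ?gez0_abs//.
  exact: tameC.
have N0 : norm_at K g Ef * normf (lead K y (- a%:Z) f) ^+ b != 0.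
  apply: mulf_neq0; first exact: norm_at_neq0.
  by rewrite expf_neq0// normf_neq0// -ya lead_neq0.
apply: (mulIf N0); rewrite mul1r mulrA glob -mulrA tam -res.
rewrite mulrA; congr (_ * _ * _).
(* The exponents [a * d * (b * d)] and [a * b * d] have the same parity, because [d * d] and [d]
   do. *)
rewrite -signr_odd -[in RHS]signr_odd !oddM; congr (_ ^+ _).
by case: (odd a) (odd b) (odd (pdeg K y)) => [] [] [].
Qed.

Lemma exact_approx (s : seq point) (n : point -> nat) : uniq s -> y \notin s ->
  exists h, [/\ h != 0, R h & forall x, x \in s -> vv x h = (n x)%:Z].
Proof.
move=> us ys; case: s us ys => [_ _|x0 s0].
  exists 1; split=> //; first exact: oner_neq0.
  by move=> z _; rewrite val_geE ?oner_neq0// (dval1 (vvP z)).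
move sE : (x0 :: s0) => s us ys.
(* With order [n + 1] required at every other point of [s], the summand [h x] has order exactly
   [n x] at [x] and does not disturb the orders of the other summands. *)
have [|E EE] := @div_of_finite _ X (fun x => if x \in s then (n x).+1%:Z else 0).
  by apply: sub_finite_set (finite_seq s) => x /=; case: ifP.
have sy x : x \in s -> x != y by apply: contraTneq => ->.
have /choice[h hP] x : exists h : F, x \in s ->
    vset (~` [set y]) (E - dpt x) h /\ lead K x (n x)%:Z h = 1.
  have [xs|] := boolP (x \in s); last by exists 0.
  have xy : (~` [set y]) x by move=> /= xy; have := sy x xs; rewrite xy eqxx.
  have [h hD hl] := strong_approx_affine (K := K) kX (E - dpt x) xy 1.
  exists h => _; split=> //; rewrite -hl divBE EE xs dptE eqxx.
  by congr (lead _ _ _ _); lia.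
pose H := \sum_(x <- s) h x.
have HP x : x \in s -> H != 0 /\ vv x H = (n x)%:Z.
  move=> xs; have [hD hl] := hP x xs; have xy := sy x xs.
  have nx : val_ge (vv x) (n x)%:Z (h x).
    have := hD x; rewrite divBE EE xs dptE eqxx /= => /(_ _).
    have -> : (n x).+1%:Z - 1%:Z = (n x)%:Z by lia.
    by apply; apply/eqP.
  have := @vv_near x H (h x).
  have hl0 : lead K x (n x) (h x) != 0 by rewrite hl oner_neq0.
  have [hx0 hxn] := val_lead_exact nx hl0.
  rewrite hxn; apply=> //.
  rewrite /H (big_rem x)//= [_ - h x]addrC addKr big_seq.
  apply: (val_ge_sum (vvP x)) => z; rewrite mem_rem_uniq// inE => /andP[zx zs].
  have [hD' _] := hP z zs; have := hD' x; rewrite divBE EE xs dptE eq_sym.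
  rewrite (negPf zx) subr0 (_ : (n x).+1%:Z = (n x)%:Z + 1); last by lia.
  by apply; apply/eqP.
exists H; split; last by move=> x /HP[].
- by have [] := HP x0; rewrite // -sE mem_head.
rewrite /H big_seq.
move=> z zy; apply: (val_ge_sum (vvP z)) => x xs.
have [hD _] := hP x xs; apply: val_ge_le (hD z zy).
by rewrite divBE EE dptE div0E; have [->|_] := eqVneq z x;
  [rewrite xs; lia|case: (z \in s); lia].
Qed.

(** The denominator [f2] cancels the poles of [f] off [y]. Its order is prescribed exactly on both
    divisors, so it acquires no zero at a point where [g] has nonzero order. *)
Lemma affine_fraction f g : f != 0 -> g != 0 ->
  (forall z, z != y -> vv z f = 0 \/ vv z g = 0) ->
  exists f1 f2, [/\ f = f1 / f2, f1 != 0 /\ f2 != 0, R f1 /\ R f2 &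
    forall z, z != y -> vv z g = 0 \/ vv z f1 = 0 /\ vv z f2 = 0].
Proof.
move=> f0 g0 cop.
have fin : finite_set ([set x | vv x f != 0] `|` [set x | vv x g != 0]).
  by rewrite finite_setU; split; exact: finite_vv_support.
have /finite_seqP[s0 s0E] := fin.
pose s := rem y (undup s0).
have sE x : (x \in s) = (x != y) && ((vv x f != 0) || (vv x g != 0)).
  rewrite /s mem_rem_uniq ?undup_uniq// inE mem_undup; congr (_ && _).
  apply/idP/idP => [xs|H].
    by have : [set` s0] x by []; rewrite -s0E => -[] /= ->; rewrite ?orbT.
  have : ([set x | vv x f != 0] `|` [set x | vv x g != 0]) x by apply/orP.
  by rewrite s0E.
have [||f2 [f20 Rf2 f2P]] := @exact_approx s (fun x => `|(Num.max 0 (- vv x f))%R|%N).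
- by rewrite rem_uniq ?undup_uniq.
- by rewrite sE eqxx.
have ff20 : f * f2 != 0 by exact: mulf_neq0.
exists (f * f2), f2; split=> //; first by rewrite mulfK.
  split=> // z zy; rewrite div0E val_geE// (dvalM (vvP z))//.
  have zy' : z != y by apply/eqP.
  have [zs|] := boolP (z \in s); first by rewrite f2P//; lia.
  rewrite sE zy' /= negb_or !negbK => /andP[/eqP -> _].
  by rewrite add0r; exact: R_val.
move=> z zy; have [->|gz] := eqVneq (vv z g) 0; first by left.
right; have fz : vv z f = 0.
  by have [//|gz0] := cop z zy; rewrite gz0 eqxx in gz.
have f2z : vv z f2 = 0.
  by rewrite f2P ?fz// sE zy gz orbT.
by rewrite (dvalM (vvP z))// fz f2z.
Qed.

Lemma weil_symbol_meet1 f g : f != 0 -> g != 0 ->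
  (forall z, z != y -> vv z f = 0 \/ vv z g = 0) -> weil_symbol f g = 1.
Proof.
have half u w : u != 0 -> w != 0 -> R w ->
    (forall z, z != y -> vv z u = 0 \/ vv z w = 0) -> weil_symbol u w = 1.
  move=> u0 w0 Rw cop.
  have [u1 [u2 [-> [u10 u20] [Ru1 Ru2] uP]]] := affine_fraction u0 w0 cop.
  by apply: weil_symbol_div => //; apply: weil_symbol_affine => // z zy;
    have [|[]] := uP z zy; auto.
move=> f0 g0 cop.
have [f1 [f2 [-> [f10 f20] [Rf1 Rf2] fP]]] := affine_fraction f0 g0 cop.
by apply: weil_symbol_div => //; apply: weil_symbol_sym => //;
  apply: half => // z zy; have [|[]] := fP z zy; auto.
Qed.

End AtPoint.

(** Induction on a list containing the common points of the two divisors. Take [h] with the order of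
    [g] at [x] and order 0 at the other points of the divisor of [f]: then [h] meets [f] at most at
    [x], and [g / h] no longer meets it there. *)
Theorem weil_reciprocity f g : f != 0 -> g != 0 -> weil_symbol f g = 1.
Proof.
move=> f0; have /finite_seqP[t0 t0E] := finite_vv_support f0.
have fP z : vv z f != 0 -> z \in t0.
  by move=> fz; have : [set` t0] z by rewrite -t0E.
have : forall z, vv z f != 0 -> vv z g != 0 -> z \in t0 by move=> z /fP.
elim: {1}t0 g => [|x s IHs] g com g0.
  have [[y]|np] := pselect (exists y : point, True); last first.
    by apply: fsbig1 => y; case: np; exists y.
  move=> _; apply: (weil_symbol_meet1 (y := y)) => // z _.
  have [->|fz] := eqVneq (vv z f) 0; first by left.
  by right; apply/eqP; apply: contrapT => /negP /(com z fz).
pose t := undup (x :: t0).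
have [h hP] := @weak_approximation _ X t
  (fun z => if z == x then vv x g + 1 else 1)
  (fun z => if z == x then unif x ^ vv x g else 1) (undup_uniq _).
have hx : h != 0 /\ vv x h = vv x g.
  have := hP x; rewrite mem_undup mem_head eqxx => /(_ isT) hx.
  have := @vv_near x h (unif x ^ vv x g) (unifX_neq0 _ _).
  by rewrite vv_unifX => /(_ hx).
have hz z : z != x -> vv z f != 0 -> vv z h = 0.
  move=> zx fz; have := hP z; rewrite mem_undup inE fP// orbT (negPf zx).
  move=> /(_ isT) hz; have := @vv_near z h 1 (oner_neq0 _).
  by rewrite (dval1 (vvP z)) add0r => /(_ hz)[].
have [h0 hxE] := hx.
have gh0 : g / h != 0 by rewrite mulf_neq0// invr_eq0.
have vgh z : vv z (g / h) = vv z g - vv z h.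
  by rewrite (dvalM (vvP z)) ?invr_eq0// (dvalV (vvP z)).
have fh : weil_symbol h f = 1.
  apply: (weil_symbol_meet1 (y := x)) => // z zx.
  by have [->|fz] := eqVneq (vv z f) 0; [right|left; exact: hz].
have fgh : weil_symbol (g / h) f = 1.
  apply: weil_symbol_sym => //; apply: IHs => // z fz.
  rewrite vgh; have [->|zx] := eqVneq z x; first by rewrite hxE subrr eqxx.
  rewrite hz// subr0 => gz; have := com z fz gz.
  by rewrite inE (negPf zx).
apply: weil_symbol_sym => //.
by have := weil_symbolMl gh0 h0 f0; rewrite divfK// fh fgh mulr1.
Qed.

End WeilReciprocity.

(** * Surjectivity of the norm, extension of homomorphisms *)

Section NormSurjective.
Variables (k : fieldType) (L : fieldExtType k).
Import passmx.

Lemma normf_scalar (a : k) : normf (a%:A : L) = a ^+ \dim {:L}.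
Proof.
have bas := vbasisP (fullv : {vspace L}).
rewrite /normf; have -> : amull (a%:A : L) = a *: \1%VF.
  by apply/lfunP => u; rewrite !lfunE /= !lfunE /= -scalerAl mul1r.
by rewrite linearZ /= passmx.mxof1 ?(basis_free bas)// scalemx1 det_scalar.
Qed.

Lemma closed_field_root (n : nat) (c : k) : GRing.closed_field_axiom k ->
  (0 < n)%N -> exists a, a ^+ n = c.
Proof.
move=> ck n0; have [a aE] := ck n (fun i => if i == 0%N then c else 0) n0.
exists a; rewrite aE; case: n n0 {aE} => // n _.
rewrite big_ord_recl /= expr0 mulr1 big1 ?addr0// => i _.
by rewrite mul0r.
Qed.

Lemma normf_surj_closed (c : k) : GRing.closed_field_axiom k ->
  exists l : L, normf l = c.
Proof.
move=> ck; have [a aE] := closed_field_root c ck (adim_gt0 {:L}%AS).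
by exists (a%:A); rewrite normf_scalar.
Qed.

(** Finiteness of [k] is only a proposition; the enumeration [s] equips [k] with a [finFieldType]
    structure, from which Frobenius and the prime power order are read off. *)
Lemma finite_field_card (s : seq k) : uniq s -> (forall c : k, c \in s) ->
  (forall c : k, c ^+ size s = c) /\
  exists2 p, p \in [pchar k] & p.-nat (size s).
Proof.
move=> us sP.
have sK : pcancel (index^~ s) (fun i => if (i < size s)%N then Some s`_i else None).
  by move=> c; rewrite index_mem sP nth_index.
pose cm : isCountable k := PCanIsCountable sK.
pose fm := isFinite.Build k (fun x => etrans (count_uniq_mem x us) (congr1 nat_of_bool (sP x))).
pose kf : finFieldType := HB.pack k cm fm.
have cE : #|kf| = size s.
  by rewrite cardE enumT unlock.
split=> [c|]; first by rewrite -cE; exact: (@expf_card kf c).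
have [p pr pch] := finPcharP kf.
exists p; first exact: pch.
rewrite -cE (card_primeChar pch).
by rewrite pnatX pnat_id.
Qed.

Section FrobeniusPowers.
Variable s : seq k.
Hypotheses (us : uniq s) (sP : forall c : k, c \in s).
Local Notation q := (size s).
Local Notation n := (\dim {:L}).

Let q1 : (1 < q)%N.
Proof.
have /uniq_leq_size : uniq [:: 0; 1 : k] by rewrite /= inE eq_sym oner_eq0.
by apply=> c _; exact: sP.
Qed.

Lemma frobD i (x y : L) : (x + y) ^+ (q ^ i) = x ^+ (q ^ i) + y ^+ (q ^ i).
Proof.
have [_ [p pk pq]] := finite_field_card us sP.
have pL : p \in [pchar L] by exact: (rmorph_pchar (in_alg L)).
by apply: exprDn_pchar; rewrite (eq_pnat _ (pcharf_eq pL)) pnatX pq.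
Qed.

Lemma frobZ i (a : k) (x : L) : (a *: x) ^+ (q ^ i) = a *: x ^+ (q ^ i).
Proof.
have [aq _] := finite_field_card us sP.
rewrite exprZn; congr (_ *: _); elim: i => [|i IHi]; first by rewrite expr1.
by rewrite expnSr exprM IHi aq.
Qed.

Lemma frob_sum i (I : finType) (f : I -> L) :
  (\sum_j f j) ^+ (q ^ i) = \sum_j f j ^+ (q ^ i).
Proof.
elim/big_ind2: _ => // [|_ x _ y <- <-]; last exact: frobD.
by rewrite expr0n expn_eq0 (negPf (lt0n_neq0 (ltnW q1))).
Qed.

Lemma finite_ext_enum : exists2 t : seq L, uniq t & size t = (q ^ n)%N /\
  forall x, x \in t.
Proof.
pose phi (f : {ffun 'I_n -> seq_sub s}) : L :=
  \sum_i ssval (f i) *: (vbasis {:L})`_i.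
have bfree := basis_free (vbasisP {:L}).
have phi_inj : injective phi.
  move=> f g fg; apply/ffunP => i; apply: val_inj => /=.
  have cE h : coord (vbasis {:L}) i (phi h) = ssval (h i).
    exact: (coord_sum_free (fun i => ssval (h i)) i bfree).
  by rewrite -!cE fg.
exists [seq phi f | f <- enum {: {ffun 'I_n -> seq_sub s}}].
  by rewrite map_inj_uniq ?enum_uniq.
split; first by rewrite size_map -cardE card_ffun card_ord card_seq_sub.
move=> x; apply/mapP; exists [ffun i => SeqSub (sP (coord (vbasis {:L}) i x))].
  by rewrite mem_enum.
rewrite {1}(coord_vbasis (memvf x)); apply: eq_bigr => i _.
by rewrite ffunE.
Qed.

(* The norm is the product of the conjugates under the powers of the Frobenius
   automorphism: the conjugates of a basis form an invertible Moore matrix,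
   which diagonalizes the multiplication by [x]. *)
Lemma normf_frobenius (x : L) : (normf x)%:A = x ^+ (\sum_(i < n) q ^ i).
Proof.
pose M := passmx.mxof (vbasis {:L}) (vbasis {:L}) (amull x).
pose B : 'M[L]_n := \matrix_(j, i) (vbasis {:L})`_j ^+ (q ^ i).
have MB : map_mx (in_alg L) M *m B = B *m diag_mx (\row_i x ^+ (q ^ i)).
  apply/matrixP => j i; rewrite mul_mx_diag !mxE -exprMn_comm; last exact: mulrC.
  rewrite [_ * x]mulrC amull_vbasis /comb frob_sum; apply: eq_bigr => l _.
  by rewrite !mxE frobZ -scalerAl mul1r.
have detB : \det B != 0.
  (* A vector killing the conjugates of the basis gives an additive polynomial that vanishes, by
     [k]-linearity, on all [q^n] elements of [L], although its degree is at most [q^(n-1)]. *)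
  rewrite -det_tr; apply/det0P => -[v v0 vB].
  pose P := \sum_(i < n) v 0 i *: 'X^(q ^ i).
  have Px x' : P.[x'] = 0.
    rewrite horner_sum (coord_vbasis (memvf x')).
    have E (i : 'I_n) : (v 0 i *: 'X^(q ^ i)).[\sum_(j < n)
        coord (vbasis {:L}) j x' *: (vbasis {:L})`_j] =
        \sum_(j < n) coord (vbasis {:L}) j x' *: (v 0 i * B^T i j).
      rewrite hornerZ hornerXn frob_sum mulr_sumr; apply: eq_bigr => j _.
      by rewrite frobZ !mxE -scalerAr.
    under eq_bigr do rewrite E.
    rewrite exchange_big big1// => j _ /=; rewrite -scaler_sumr.
    by have /rowP/(_ j) := vB; rewrite !mxE => ->; rewrite scaler0.
  have n0 : (0 < n)%N by exact: adim_gt0.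
  have P0 : P != 0.
    apply: contra_neq v0 => P0; apply/rowP => i; rewrite mxE.
    have := congr1 (fun p : {poly L} => p`_(q ^ i)) P0.
    rewrite coef_sum (bigD1 i)//= coefZ coefXn eqxx mulr1 big1 ?addr0 ?coef0//.
    move=> j ji; rewrite coefZ coefXn eqn_exp2l// eq_sym.
    by rewrite (inj_eq val_inj) (negPf ji) mulr0.
  have [t ut [st tP]] := finite_ext_enum.
  have Pr : all (root P) t by apply/allP => x' _; apply/rootP; exact: Px.
  have := max_poly_roots P0 Pr ut.
  rewrite st ltnNge => /negP; apply.
  apply: leq_trans (size_sum _ _ _) _; apply/bigmax_leqP => i _.
  apply: leq_trans (size_scale_leq _ _) _; rewrite size_polyXn.
  by rewrite ltn_exp2l.
have := congr1 determinant MB; rewrite !det_mulmx det_diag det_map_mx mulrC.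
move=> /(mulfI detB) detE; transitivity (in_alg L (\det M)) => //.
by rewrite detE expr_sum; apply: eq_bigr => i _; rewrite mxE.
Qed.

End FrobeniusPowers.

(** If [c] is not a norm, every nonzero [x] has [x^m] among the [q - 2] other nonzero scalars. The
    polynomial [Q], of degree [(q - 2) m], would then have [q^n - 1 = (q - 1) m] roots. *)
Lemma normf_surj_finite (c : k) : finite_set [set: k] -> c != 0 ->
  exists l : L, normf l = c.
Proof.
move=> /finite_seqP[s0 s0E] c0; pose s := undup s0.
have us : uniq s by exact: undup_uniq.
have sP a : a \in s.
  by rewrite mem_undup; have : [set` s0] a by rewrite -s0E.
apply: contrapT => nc.
pose m := (\sum_(i < \dim {:L}) size s ^ i)%N.
pose r := rem c (rem 0 s).
have s0r : 0 \in s by exact: sP.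
have cr : c \in rem 0 s by rewrite mem_rem_uniq// inE c0 sP.
pose Q : {poly L} := \prod_(a <- r) ('X^m - (a%:A)%:P).
have m0 : (0 < m)%N.
  by rewrite /m (bigD1 (Ordinal (adim_gt0 {:L}%AS)))//= expn0 add1n.
have Q0 : Q != 0.
  rewrite prodf_seq_neq0; apply/allP => a _ /=.
  by rewrite -size_poly_eq0 size_XnsubC.
have [t ut [st tP]] := finite_ext_enum us sP.
have Qr : all (root Q) (rem 0 t).
  apply/allP => x; rewrite mem_rem_uniq// inE => /andP[x0 _].
  rewrite /root horner_prod prodf_seq_eq0; apply/hasP => /=.
  exists (normf x) => /=.
    rewrite mem_rem_uniq ?rem_uniq// inE; apply/andP; split.
      by apply/eqP => xc; apply: nc; exists x.
    by rewrite mem_rem_uniq// inE normf_neq0// sP.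
  by rewrite hornerD hornerN hornerC hornerXn (normf_frobenius us sP) subrr.
have := max_poly_roots Q0 Qr (rem_uniq 0 ut).
rewrite size_rem// st predn_exp -/m.
have szQ : (size Q <= (size r * m).+1)%N.
  rewrite /Q; elim: (r) => [|a r' IHr]; first by rewrite big_nil size_poly1.
  rewrite big_cons; apply: leq_trans (size_polyMleq _ _) _.
  by rewrite size_XnsubC//= mulSn -addnS leq_add2l.
move=> lt; have := leq_trans lt szQ; rewrite ltnS leq_pmul2r//.
rewrite !size_rem//; have : (1 < size s)%N.
  have /uniq_leq_size : uniq [:: 0; c] by rewrite /= inE eq_sym c0.
  by apply=> a _; exact: sP.
by case: (size s) => [|[|l]] //= _; rewrite ltnn.
Qed.

End NormSurjective.

(** * Extension of homomorphisms into divisible groups *)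

Section HomExtension.
Variables (G M : zmodType).
Hypothesis Mdiv : forall (n : nat) (b : M), (0 < n)%N -> exists c, c *+ n = b.

(** A homomorphism defined on a subgroup, given by its graph, so that unions of chains are plain
    unions of sets. *)
Definition partial_hom (A : set (G * M)) :=
  [/\ A 0, forall s t, A s -> A t -> A (s - t) & forall b, A (0, b) -> b = 0].

Let partial_homD A s t : partial_hom A -> A s -> A t -> A (s + t).
Proof.
move=> [A0 AB _] As At; rewrite -[t]opprK; apply: (AB) => //.
by rewrite -sub0r; exact: AB.
Qed.

Let partial_hom_mulz A s (j : int) : partial_hom A -> A s -> A (s *~ j).
Proof.
move=> hA As; have X n : A (s *+ n).
  elim: n => [|n IHn]; first by rewrite mulr0n; case: hA.
  by rewrite mulrS; exact: partial_homD.
case: j => n; first exact: X.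
by rewrite NegzE mulrNz -sub0r; have [A0 AB _] := hA; apply: (AB) => //; exact: X.
Qed.

Lemma mulpz (a : G) (b : M) (j : int) : (a, b) *~ j = (a *~ j, b *~ j).
Proof.
have X n : (a, b) *+ n = (a *+ n, b *+ n).
  by elim: n => [//|n IHn]; rewrite !mulrS IHn.
by case: j => n; rewrite ?NegzE ?mulrNz -!pmulrn X.
Qed.

(** If some positive multiple of [g] is in the domain, divide the value at the least one, of which
    all others are multiples; otherwise the value at [g] is free, and 0 is taken. *)
Lemma partial_hom_root A (g : G) : partial_hom A ->
  exists c, forall (j : int) b, A (g *~ j, b) -> b = c *~ j.
Proof.
move=> hA; have [A0 AB Afun] := hA.
have inj a b b' : A (a, b) -> A (a, b') -> b = b'.
  move=> H H'; apply/eqP; rewrite -subr_eq0; apply/eqP/Afun.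
  by have := AB _ _ H H'; rewrite -[(a, b) - (a, b')]/(a - a, b - b') subrr.
pose P n := (0 < n)%N && `[< exists b, A (g *+ n, b) >].
have [[n0 Pn0]|nP] := pselect (exists n, P n); last first.
  exists 0 => j b Aj; have [j0|j0] := eqVneq j 0.
    by rewrite j0 mulr0z in Aj *; exact: Afun.
  case: nP; exists `|j|%N; rewrite /P absz_gt0 j0; apply/asboolP.
  case: j j0 Aj => n j0 Aj; first by exists b.
  exists (- b); have := AB _ _ A0 Aj.
  rewrite -[0 - _]/(0 - g *~ Negz n, 0 - b) !sub0r NegzE mulrNz opprK.
  by rewrite abszN.
case: (ex_minnP (ex_intro _ n0 Pn0)) => n /andP[n_gt0 /asboolP[b0 An]] minn.
have [c cn] := Mdiv b0 n_gt0; exists c => j b Aj.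
have jE := divz_eq j n.
have r0 : (j %% n)%Z = 0.
  have r_ge0 : 0 <= (j %% n)%Z by rewrite modz_ge0//; lia.
  have r_lt : (j %% n)%Z < n%:Z by rewrite ltz_mod; lia.
  case E : (j %% n)%Z r_ge0 r_lt => [r|//] _ r_lt.
  apply/eqP; rewrite -[_ == 0]/(r == 0%N) -leqn0 leqNgt; apply/negP => r_gt0.
  have Pr : P r.
    rewrite /P r_gt0; apply/asboolP.
    exists (b - b0 *~ (j %/ n)%Z).
    have := AB _ _ Aj (partial_hom_mulz (j %/ n)%Z hA An).
    rewrite mulpz -[(_, _) - _]/(g *~ j - g *+ n *~ _, b - b0 *~ _).
    have -> // : g *~ j - g *+ n *~ (j %/ n)%Z = g *+ r.
    rewrite {1}jE E mulrzDr [(j %/ n)%Z * _]mulrC mulrzA.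
    by rewrite addrC addKr.
  by have := minn r Pr; rewrite leqNgt; lia.
rewrite r0 addr0 in jE.
have := partial_hom_mulz (j %/ n)%Z hA An; rewrite mulpz => H.
apply: (inj (g *~ j)) => //; rewrite {2}jE [_ * n%:Z]mulrC mulrzA.
by rewrite {1}jE [_ * n%:Z]mulrC mulrzA -[c *~ n]/(c *+ n) cn.
Qed.

Lemma hom_extension A : partial_hom A ->
  exists f : G -> M, zmod_morphism f /\ forall a b, A (a, b) -> f a = b.
Proof.
move=> hA; have [A0 _ _] := hA.
(* The empty set is included for the sake of the empty chain. *)
pose P (B : set (G * M)) := B = set0 \/ partial_hom B /\ A `<=` B.
have [C CP Ctot|B [[->|[hB AB]] Bmax]] := @Zorn_bigcup _ P; last first.
- have [B0 BB Bfun] := hB.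
  suff /choice[f fP] : forall a, exists b, B (a, b).
    have inj a b b' : B (a, b) -> B (a, b') -> b = b'.
      move=> H H'; apply/eqP; rewrite -subr_eq0; apply/eqP/Bfun.
      by have := BB _ _ H H'; rewrite -[(a, b) - (a, b')]/(a - a, b - b') subrr.
    exists f; split=> [a a'|a b /AB]; last exact: inj.
    by apply: (inj (a - a')) => //; exact: (BB _ _ (fP a) (fP a')).
  move=> g; apply: contrapT => ng.
  have [c cP] := partial_hom_root g hB.
  pose B' := [set ab : G * M | exists s (j : int), B s /\ ab = s + (g, c) *~ j].
  have BB' : B `<=` B' by move=> s Bs; exists s, 0; rewrite mulr0z addr0.
  apply: (Bmax B').
    split=> // B'B; apply: ng; exists c; apply: B'B; exists 0, 1.
    by rewrite add0r mulr1z.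
  right; split; last exact: subset_trans BB'.
  split; first exact: BB'.
    move=> _ _ [s [i [Bs ->]]] [t [j [Bt ->]]]; exists (s - t), (i - j).
    by split; [exact: BB|rewrite mulrzBr opprD addrACA].
  move=> b [[a' b'] [j [Bs]]]; rewrite mulpz => -[/eqP].
  rewrite eq_sym addr_eq0 => /eqP aE ->.
  have := cP (- j) b'; rewrite mulrNz -aE => /(_ Bs) ->.
  by rewrite mulrNz addNr.
- exfalso; apply: (Bmax A); last by right; split.
  by split=> // /(_ 0); apply; have [] := hA.
have [C0|/existsNP[A1 /not_implyP[CA1 A1n0]]] := pselect (forall B, C B -> B = set0).
  by left; rewrite -subset0 => a [B CB]; rewrite (C0 _ CB).
have srP B s : C B -> B s -> partial_hom B /\ A `<=` B.
  by move=> CB Bs; have [B0|//] := CP B CB; move: Bs; rewrite B0.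
have /set0P[s1 A1s1] : A1 != set0 by apply/eqP.
have [[A10 _ _] AA1] := srP _ _ CA1 A1s1.
right; split; last by move=> s As; exists A1 => //; exact: AA1.
split; first by exists A1.
  move=> s t [B CB Bs] [B' CB' B't].
  have [[_ BB _] _] := srP _ _ CB Bs.
  have [[_ BB' _] _] := srP _ _ CB' B't.
  have [le|le] := Ctot _ _ CB CB'.
    by exists B' => //; apply: BB' => //; exact: le.
  by exists B => //; apply: BB => //; exact: le.
by move=> b [B CB Bb]; have [[_ _ Bfun] _] := srP _ _ CB Bb; exact: Bfun.
Qed.

End HomExtension.

(** * Unit ideles and the exact sequence *)

Section UnitIdeles.
Variables (k : fieldType) (X : curve k).
Variable K : forall x : closed_point X, completion x.
Hypothesis kX : alg_closed_in_fun_field X.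
Local Notation F := (ffield X).
Local Notation point := (closed_point X).
Local Notation Div := (Div X).
Local Notation deg := (div_degree K).
Local Notation v x := (@lval _ _ _ (K x)).
Local Notation rs x := (@res _ _ _ (K x)).
Implicit Types (x : point) (D E : Div) (u : point -> k).

Lemma exists_idele (h : point -> F) : (forall x, h x != 0) ->
  finite_set [set x | vv x (h x) != 0] ->
  exists a : idele K, forall x, icoord a x = embed (K x) (h x).
Proof.
move=> h0 fh.
pose c x : mulgrp (lfield (K x)) := exist _ (embed (K x) (h x)) (embed_neq0 K x (h0 x)).
have fc : finite_set [set x | v x (sval (c x)) != 0].
  by apply: sub_finite_set fh => x /=; rewrite lval_embedE.
by exists (Idele fc).
Qed.

Lemma idele1_of (a : idele K) : deg (idele_div a) = 0 ->
  exists b : idele1 K, sval b = a.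
Proof.
move=> da; have aP : a \in @idele1_pred k X K by apply/eqP.
by exists (exist _ a aP).
Qed.

Lemma exists_principal_idele (f : F) : f != 0 ->
  exists a : idele1 K, forall x, icoord (sval a) x = embed (K x) f.
Proof.
move=> f0.
have [a aE] := exists_idele (fun=> f0) (finite_vv_support K f0).
have [|b bE] := @idele1_of a; last by exists b => x; rewrite bE.
rewrite -(deg_fdiv K kX f0); congr deg; apply: div_ext => x.
by rewrite (fdivE K)//= aE lval_embedE.
Qed.

Definition divprod u D : k := \big[*%R/1]_(x \in [set: point]) u x ^ sval D x.

Lemma divprodD u D E : (forall x, u x != 0) ->
  divprod u (D + E) = divprod u D * divprod u E.
Proof.
move=> u0; have /asboolP fD := svalP D; have /asboolP fE := svalP E.
have fDE : finite_set ([set x | sval D x != 0] `|` [set x | sval E x != 0]).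
  by rewrite finite_setU.
rewrite /divprod -(fsbig_split_supp _ fDE)/=.
- by apply: eq_fsbigr => x _; rewrite fctE expfzDr.
- by move=> x /not_orP[/negP/negPn/eqP-> _].
- by move=> x /not_orP[_ /negP/negPn/eqP->].
Qed.

Lemma divprod0 u : divprod u 0 = 1.
Proof. by apply: fsbig1 => x _; rewrite expr0z. Qed.

Lemma divprod_neq0 u D : (forall x, u x != 0) -> divprod u D != 0.
Proof.
move=> u0; have := divprodD D (- D) u0; rewrite subrr divprod0.
by apply: contra_eq_neq => ->; rewrite mul0r oner_neq0.
Qed.

Lemma divprodB u D E : (forall x, u x != 0) ->
  divprod u (D - E) = divprod u D / divprod u E.
Proof.
move=> u0; apply: (mulIf (divprod_neq0 E u0)).
by rewrite -divprodD// subrK divfK// divprod_neq0.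
Qed.

Lemma divprod_dpt u x : divprod u (dpt x) = u x.
Proof.
rewrite /divprod (@fsbig_single _ _ _ _ x) ?dptE ?eqxx//.
by move=> z /negPf zx; rewrite dptE zx expr0z.
Qed.

Lemma divprod_hom (psi : Div -> mulgrp k) u D : zmod_morphism psi ->
  (forall x, u x = sval (psi (dpt x))) -> divprod u D = sval (psi D).
Proof.
move=> psiB uE; have u0 x : u x != 0 by rewrite uE mulgrp_neq0.
have psi0 : psi 0 = 0 by have := psiB 0 0; rewrite !subrr.
have psiD D' E' : psi (D' + E') = psi D' + psi E'.
  apply/eqP; rewrite -subr_eq; apply/eqP.
  by rewrite -psiB addrK.
have eff E : effective_on [set: point] E -> divprod u E = sval (psi E).
  move: E; apply: effective_ind => [|E x _ _ IH].
    by rewrite divprod0 psi0 mulgrp0.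
  by rewrite divprodD// IH divprod_dpt psiD mulgrpD uE.
have [E effE EE] := exists_pos_part D.
have [E' effE' EE'] := exists_pos_part (- D).
have -> : D = E - E'.
  apply: div_ext => x; rewrite divBE EE EE' divNE.
  by move: (sval D x) => a; lia.
by rewrite divprodB// psiB mulgrpD mulgrpN !eff.
Qed.

Definition unit_idele (a : idele K) := forall x, v x (icoord a x) = 0.

Definition norm_res (a : idele K) x : k := normf (rs x (icoord a x)).

Lemma val_ge0_eq0 x (a : lfield (K x)) : v x a = 0 -> val_ge (v x) 0 a.
Proof. by move=> va; rewrite /val_ge va lexx orbT. Qed.

Lemma norm_res_neq0 a x : unit_idele a -> norm_res a x != 0.
Proof.
move=> ua; apply: normf_neq0; rewrite res_eq0; last exact: val_ge0_eq0.
by rewrite /val_ge (negPf (icoord_neq0 a x)) ua.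
Qed.

Lemma unit_ideleD a b : unit_idele a -> unit_idele b -> unit_idele (a + b).
Proof.
move=> ua ub x; rewrite icoordD (dvalM (lvalP (K x))) ?icoord_neq0//.
by rewrite ua ub.
Qed.

Lemma unit_ideleN a : unit_idele a -> unit_idele (- a).
Proof.
move=> ua x; rewrite icoordN (dvalV (lvalP (K x))) ?icoord_neq0//.
by rewrite ua oppr0.
Qed.

Lemma norm_resD a b x : unit_idele a -> unit_idele b ->
  norm_res (a + b) x = norm_res a x * norm_res b x.
Proof.
move=> ua ub; rewrite /norm_res icoordD -normfM resM//; exact: val_ge0_eq0.
Qed.

Lemma norm_resB a b x : unit_idele a -> unit_idele b ->
  norm_res (a - b) x = norm_res a x / norm_res b x.
Proof.
move=> ua ub; apply: (mulIf (norm_res_neq0 x ub)).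
rewrite divfK ?norm_res_neq0// -norm_resD ?subrK//.
exact/unit_ideleD/unit_ideleN.
Qed.

Lemma one_units_unit (a : idele1 K) : a \in one_units K ->
  unit_idele (sval a) /\ forall x, norm_res (sval a) x = 1.
Proof.
move=> /asboolP a1; split=> x; first exact: (val_ge_unit (lvalP (K x)) (a1 x) (icoord_neq0 _ _)).
by rewrite /norm_res res_unit// Defs.normf1.
Qed.

(** Where [a] has order 0, the sign and the denominator of the symbol disappear: a unit idele acts
    as a character of the divisor group. *)
Lemma pairing_unit a b : unit_idele a ->
  pairing a b = divprod (norm_res a) (idele_div b).
Proof.
move=> ua; apply: eq_fsbigr => x _; rewrite /local_symbol ua mulr0 mul0r.
rewrite !expr0z divr1 mul1r /= /norm_res.
have resX (c : lfield (K x)) (n : nat) : v x c = 0 -> c != 0 ->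
    rs x (c ^+ n) = rs x c ^+ n.
  move=> vc c0; elim: n => [|n IHn]; first by rewrite !expr0 res1.
  rewrite !exprS resM ?IHn//; apply: val_ge0_eq0 => //.
  by rewrite (dvalX (lvalP (K x)))// vc mul0rn.
have a0 := icoord_neq0 a x.
case: (v x (icoord b x)) => n; first by rewrite -!exprnP resX// normfX.
rewrite NegzE -!exprnN -!exprVn resX ?invr_eq0//; last first.
  by rewrite (dvalV (lvalP (K x)))// ua oppr0.
rewrite normfX; congr (_ ^+ _).
have uN := unit_ideleN ua.
have := norm_resD x ua uN; rewrite subrr /norm_res icoordN icoord0 res1 Defs.normf1.
by move=> /(congr1 (fun c => (normf (rs x (icoord a x)))^-1 * c));
  rewrite mulr1 mulKf//; exact: norm_res_neq0.
Qed.

Lemma norm_res_const (a : idele K) (c : k) x :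
  icoord a x = embed (K x) (constf X c) -> norm_res a x = c ^+ pdeg K x.
Proof. by move=> aE; rewrite /norm_res aE res_const normf_scalar. Qed.

Hypothesis norm_surj : forall x (c : k), c != 0 ->
  exists l : rfield (K x), normf l = c.

(** The local components can be taken among functions, one for each point: [norm_surj] gives a
    residue of the right norm and [rho_surj] lifts it. *)
Lemma exists_unit_idele u : (forall x, u x != 0) ->
  exists a : idele1 K, unit_idele (sval a) /\ forall x, norm_res (sval a) x = u x.
Proof.
move=> u0.
have /choice[h hP] x : exists h : F, [/\ h != 0, vv x h = 0 &
    normf (rho K x h) = u x].
  have [l lu] := norm_surj x (u0 x).
  have l0 : l != 0.
    apply: contra_neq (u0 x) => l0; rewrite -lu l0 -(scale0r 1) normf_scalar.
    by rewrite expr0n -[_ == 0%N]negbK -lt0n adim_gt0.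
  have [h h0 hl] := rho_surj l.
  have [|hn0 hv] := @val_lead_exact _ _ K x 0 h h0; first by rewrite lead0 hl.
  by exists h; split=> //; rewrite hl.
have h0 x : h x != 0 by have [] := hP x.
have hv x : vv x (h x) = 0 by have [] := hP x.
have [|a aE] := exists_idele h0.
  by apply: sub_finite_set (finite_set0 _) => x /=; rewrite hv.
have ua : unit_idele a by move=> x; rewrite aE lval_embedE.
have [|b bE] := @idele1_of a.
  rewrite -[RHS](div_degree0 K); congr deg; apply: div_ext => x.
  exact: ua.
exists b; rewrite bE; split=> // x; rewrite /norm_res aE.
by have [] := hP x.
Qed.

End UnitIdeles.

Section Sequence.
Variables (k : fieldType) (X : curve k).
Variable K : forall x : closed_point X, completion x.
Hypothesis kX : alg_closed_in_fun_field X.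
Local Notation F := (ffield X).
Local Notation point := (closed_point X).
Local Notation Div := (Div X).
Local Notation deg := (div_degree K).
Local Notation v x := (@lval _ _ _ (K x)).
Implicit Types (x : point) (D E : Div).

Definition is_principal (a : idele1 K) (f : F) :=
  f != 0 /\ forall x, icoord (sval a) x = embed (K x) f.

Lemma principal_idele_div a f : is_principal a f -> idele_div (sval a) = fdiv f.
Proof.
move=> [f0 aE]; apply: div_ext => x.
by rewrite (fdivE K)//= aE lval_embedE.
Qed.

Lemma pairing_principal a b f g : is_principal a f -> is_principal b g ->
  pairing (sval a) (sval b) = 1.
Proof.
move=> [f0 aE] [g0 bE]; rewrite -(weil_reciprocity K kX f0 g0).
by apply: eq_fsbigr => x _; rewrite aE bE.
Qed.

Lemma perpP (a : idele1 K) : bclass a \in perp (principal_ideles K) <->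
  forall b f, is_principal b f -> pairing (sval a) (sval b) = 1.
Proof.
split=> [/asboolP aP b f [f0 bE]|aP].
  by rewrite -bpairingE; apply: aP; exists b, f; split.
apply/asboolP => _ [b [f [f0 bE ->]]]; rewrite bpairingE.
exact: (aP b f).
Qed.

Lemma unit_perp (a : idele1 K) : unit_idele (sval a) ->
  (forall f : F, f != 0 -> divprod (norm_res (sval a)) (fdiv f) = 1) ->
  bclass a \in perp (principal_ideles K).
Proof.
move=> ua aP; apply/perpP => b f bf.
by rewrite pairing_unit// (principal_idele_div bf) aP//; case: bf.
Qed.

Lemma perp_class_surj (q : perp_quot K) :
  exists (a : idele1 K) (aP : bclass a \in perp (principal_ideles K)),
    perp_class (exist _ (bclass a) aP) = q.
Proof.
have E : perp_class (repr q) = q by rewrite /perp_class reprK.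
move: (repr q) E => [s sP] <-.
have [a aE] := bclass_surj s; subst s.
by exists a, sP.
Qed.

Lemma perp_classB s t : perp_class (s - t) = perp_class s - perp_class t
  :> perp_quot K.
Proof. by rewrite /perp_class raddfB. Qed.

Lemma perp_class_eqP (s t : perp_fun K) :
  perp_class s = perp_class t <-> s - t \in fun_norm_one K.
Proof.
split=> [/eqP|st]; first by rewrite /perp_class -Quotient.idealrBE.
by apply/eqP; rewrite /perp_class -Quotient.idealrBE.
Qed.

Lemma div_classB (D E : Div0 K) : div_class (D - E) = div_class D - div_class E
  :> Pic0 K.
Proof. by rewrite /div_class raddfB. Qed.

End Sequence.

(** * The two maps and exactness *)

Section ExactSequence.
Variables (k : fieldType) (X : curve k).
Variable K : forall x : closed_point X, completion x.
Hypothesis kX : alg_closed_in_fun_field X.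
Local Notation F := (ffield X).
Local Notation point := (closed_point X).
Local Notation Div := (Div X).
Local Notation deg := (div_degree K).
Local Notation v x := (@lval _ _ _ (K x)).
Local Notation Perp := (perp (principal_ideles K)).
Implicit Types (x : point) (D E : Div) (a b c : idele1 K) (f : F).

Definition norm_one a := unit_idele (sval a) /\ forall x, norm_res (sval a) x = 1.

Lemma perp_class_eq a b (aP : bclass a \in Perp) (bP : bclass b \in Perp) :
  perp_class (exist _ (bclass a) aP) = perp_class (exist _ (bclass b) bP) <->
  exists c f, is_principal c f /\ norm_one (a - b - c).
Proof.
apply: (iff_trans (perp_class_eqP _ _)); split.
  move=> /asboolP[_ [_ [[c [f [f0 cE ->]]] [e [eN ->]]]]] /= abE.
  exists c, f; split; first by split.
  have /bclass_eq : bclass (a - b) = bclass (c + e).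
    by rewrite bclassB abE -[e in RHS]opprK bclassB -[- e]sub0r bclassB bclass0 sub0r opprK.
  move=> /one_units_unit[uw nw].
  have ue : unit_idele (sval e) by move=> x; case: (eN x).
  have E : sval (a - b - c) = sval (a - b - (c + e)) + sval e.
    by rewrite -[RHS]/(sval (a - b - (c + e) + e)) opprD addrA subrK.
  rewrite /norm_one E; split; first exact: unit_ideleD.
  by move=> x; rewrite norm_resD// nw mul1r; case: (eN x).
move=> [c [f [[f0 cE] [ue ne]]]]; apply/asboolP.
exists (bclass c), (bclass (a - b - c)); split.
- by exists c, f; split.
- by exists (a - b - c); split=> // x; split; [exact: ue|exact: ne].
by rewrite /= !bclassB [RHS]addrC subrK.
Qed.

Lemma norm_one_diff_class a b (aP : bclass a \in Perp) (bP : bclass b \in Perp) :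
  norm_one (a - b) -> perp_class (exist _ (bclass a) aP) = perp_class (exist _ (bclass b) bP).
Proof.
move=> n1; apply/perp_class_eq; exists 0, 1; rewrite subr0; split=> //.
by split=> [|x]; rewrite ?oner_neq0// icoord0 rmorph1.
Qed.

Lemma div_class_eq (D E : Div0 K) :
  div_class D = div_class E <-> D - E \in principal_div K.
Proof.
split=> [/eqP|DE]; first by rewrite /div_class -Quotient.idealrBE.
by apply/eqP; rewrite /div_class -Quotient.idealrBE.
Qed.

Lemma div_class_surj (p : Pic0 K) : exists D : Div0 K, div_class D = p.
Proof. by exists (repr p); rewrite /div_class reprK. Qed.

Lemma perp_class_div a b (aP : bclass a \in Perp) (bP : bclass b \in Perp) :
  perp_class (exist _ (bclass a) aP) = perp_class (exist _ (bclass b) bP) ->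
  div_class (idele1_div a) = div_class (idele1_div b).
Proof.
move=> /perp_class_eq[c [f [[f0 cE] [u _]]]]; apply/div_class_eq/asboolP.
exists f => // x; have := u x; rewrite -(lval_embed (K x))// -cE.
have vP := lvalP (K x).
rewrite -[icoord _ x]/(icoord (sval a) x / icoord (sval b) x / icoord (sval c) x).
rewrite !(dvalM vP) ?(dvalV vP) ?mulf_neq0 ?invr_eq0 ?icoord_neq0//.
move=> /eqP; rewrite subr_eq0 => /eqP <-.
by rewrite -[LHS]/(v x (icoord (sval a) x) - v x (icoord (sval b) x)).
Qed.

Lemma exists_delta : exists delta : {additive perp_quot K -> Pic0 K},
  forall a (aP : bclass a \in Perp),
    delta (perp_class (exist _ (bclass a) aP)) = div_class (idele1_div a).
Proof.
have /choice[d dP] (q : perp_quot K) : exists p : Pic0 K,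
    forall a (aP : bclass a \in Perp), perp_class (exist _ (bclass a) aP) = q ->
      p = div_class (idele1_div a).
  have [a [aP <-]] := perp_class_surj q.
  by exists (div_class (idele1_div a)) => b bP /esym; exact: perp_class_div.
have dB : zmod_morphism d.
  move=> q r; have [a [aP aE]] := perp_class_surj q.
  have [b [bP bE]] := perp_class_surj r.
  have abP : bclass (a - b) \in Perp by rewrite bclassB; exact: rpredB.
  have abE : perp_class (exist _ (bclass (a - b)) abP) = q - r.
    rewrite -aE -bE -perp_classB; congr perp_class; apply: val_inj.
    exact: bclassB.
  rewrite (dP _ _ _ abE) (dP _ _ _ aE) (dP _ _ _ bE) -div_classB.
  by congr div_class; apply: val_inj; exact: idele_divB.
pose D : {additive _ -> _} :=
  HB.pack d (GRing.isZmodMorphism.Build (perp_quot K) (Pic0 K) d dB).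
by exists D => a aP; exact: dP.
Qed.

Variable x0 : point.
Hypothesis x0_rational : pdeg K x0 = 1%N.

Lemma div_degreeMz D (n : int) : deg (D *~ n) = deg D * n.
Proof.
by case: n => n; rewrite ?NegzE ?mulrNz ?div_degreeN -pmulrn div_degreeMn intmulrn ?mulrN.
Qed.

Fact div0_proj_subproof D : (D - dpt x0 *~ deg D) \in @div0_pred k X K.
Proof.
apply/eqP; rewrite div_degreeB div_degreeMz div_degree_dpt x0_rational.
by rewrite mul1r subrr.
Qed.

(** A retraction onto degree zero divisors, possible because [x0] has degree one. It extends a
    character of [Pic0] to all divisors, with value 1 at [x0]. *)
Definition div0_proj D : Div0 K :=
  exist _ (D - dpt x0 *~ deg D) (div0_proj_subproof D).

Lemma div0_projB : zmod_morphism div0_proj.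
Proof.
move=> D E; apply: val_inj => /=; rewrite div_degreeB mulrzBr.
by rewrite !opprD !opprK addrACA.
Qed.

Lemma div0_projK (D : Div0 K) : div0_proj (sval D) = D.
Proof.
apply: val_inj => /=; have /eqP -> : deg (sval D) == 0 by exact: (svalP D).
by rewrite mulr0z subr0.
Qed.

Lemma div0_proj_dpt0 : div0_proj (dpt x0) = 0.
Proof.
by apply: val_inj; rewrite /= div_degree_dpt x0_rational mulr1z subrr.
Qed.

Local Notation Hom := (Homgr (Pic0 K) (mulgrp k)).

Definition hom_div (chi : Hom) D : mulgrp k := sval chi (div_class (div0_proj D)).

Lemma homgrB (chi : Hom) p q : sval chi (p - q) = sval chi p - sval chi q.
Proof. by have /asboolP := svalP chi; apply. Qed.

Lemma hom_divB chi : zmod_morphism (hom_div chi).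
Proof. by move=> D E; rewrite /hom_div div0_projB div_classB homgrB. Qed.

Lemma hom_div_fdiv chi f : f != 0 -> hom_div chi (fdiv f) = 0.
Proof.
move=> f0; rewrite /hom_div.
have -> : div_class (div0_proj (fdiv f)) = 0.
  rewrite -(subrr (div_class 0)) -div_classB subrr; apply/div_class_eq/asboolP.
  exists f => // x.
  rewrite /= (deg_fdiv K kX f0) mulr0z subr0 -[LHS]/(sval (fdiv f - 0) x).
  by rewrite subr0; exact: (fdivE K).
by have := homgrB chi 0 0; rewrite !subrr.
Qed.

Lemma homgrP (chi chi' : Hom) : (forall D, hom_div chi D = hom_div chi' D) ->
  chi = chi'.
Proof.
move=> H; apply: val_inj; apply: funext => p.
have [D <-] := div_class_surj p.
by have := H (sval D); rewrite /hom_div div0_projK.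
Qed.

Hypothesis norm_surj : forall x (c : k), c != 0 ->
  exists l : rfield (K x), normf l = c.

Definition represents a (chi : Hom) := unit_idele (sval a) /\
  forall x, norm_res (sval a) x = sval (hom_div chi (dpt x)).

Lemma exists_represents chi : exists a, represents a chi.
Proof. by apply: exists_unit_idele => // x; exact: mulgrp_neq0. Qed.

Lemma represents_perp a chi : represents a chi -> bclass a \in Perp.
Proof.
move=> [ua na]; apply: unit_perp => // f f0.
by rewrite (divprod_hom _ (@hom_divB chi) na) hom_div_fdiv.
Qed.

(** Two unit ideles representing the same character differ by one of norm 1 everywhere, so their
    class depends on the character alone, and additively. *)
Lemma exists_iota : exists iota : {additive Hom -> perp_quot K},
  forall chi a (aP : bclass a \in Perp), represents a chi ->
    iota chi = perp_class (exist _ (bclass a) aP).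
Proof.
have /choice[r rP] := exists_represents.
pose io chi := perp_class (exist _ (bclass (r chi)) (represents_perp (rP chi))).
have ioP chi a (aP : bclass a \in Perp) : represents a chi ->
    io chi = perp_class (exist _ (bclass a) aP).
  move=> [ua na]; have [ur nr] := rP chi; apply: norm_one_diff_class.
  split; first exact: (unit_ideleD ur (unit_ideleN ua)).
  move=> x; rewrite [LHS](norm_resB x ur ua) nr na divff//.
  exact: mulgrp_neq0.
have ioB : zmod_morphism io.
  move=> chi chi'; rewrite -perp_classB.
  have abP : bclass (r chi - r chi') \in Perp.
    rewrite bclassB; apply: rpredB; exact: represents_perp (rP _).
  rewrite (ioP _ _ abP).
    by congr perp_class; apply: val_inj; exact: bclassB.
  have [u n] := rP chi; have [u' n'] := rP chi'.
  split; first exact: (unit_ideleD u (unit_ideleN u')).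
  by move=> x; rewrite [LHS](norm_resB x u u') n n'.
pose I : {additive _ -> _} :=
  HB.pack io (GRing.isZmodMorphism.Build Hom (perp_quot K) io ioB).
by exists I => chi a aP; exact: ioP.
Qed.

Lemma norm_one_unit_const (a : idele1 K) f : is_principal a f ->
  unit_idele (sval a) -> exists2 c : k, c != 0 &
    forall x, norm_res (sval a) x = c ^+ pdeg K x.
Proof.
move=> [f0 aE] ua; have [|c fc] := @rr0_const _ _ kX f.
  move=> x _; rewrite oppr0 div0E val_geE//.
  by rewrite -(lval_embedE K x f0) -aE ua.
exists c; first by apply: contra_neq f0 => c0; rewrite fc c0 rmorph0.
by move=> x; apply: norm_res_const; rewrite aE fc.
Qed.

(** Equality of classes yields a function that is a unit everywhere, hence a constant [d], and the
    characters differ by [d^(deg x)] at [x]. At the rational point both are 1, so [d = 1]. *)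
Lemma iota_injective (iota : {additive Hom -> perp_quot K}) :
  (forall chi a (aP : bclass a \in Perp), represents a chi ->
    iota chi = perp_class (exist _ (bclass a) aP)) -> injective iota.
Proof.
move=> iotaP chi chi' e; have [a aR] := exists_represents chi.
have [a' aR'] := exists_represents chi'.
have aP := represents_perp aR; have aP' := represents_perp aR'.
move: e; rewrite (iotaP _ _ aP aR) (iotaP _ _ aP' aR').
move=> /perp_class_eq[c [f [cf [uw nw]]]].
have [[ua na] [ua' na']] := (aR, aR').
have uaa : unit_idele (sval a - sval a') by exact/unit_ideleD/unit_ideleN.
have uc : unit_idele (sval c).
  have -> : sval c = sval a - sval a' - sval (a - a' - c).
    by rewrite -[sval (a - a' - c)]/(sval a - sval a' - sval c) opprB addrC subrK.
  exact/unit_ideleD/unit_ideleN.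
have [d d0 dE] := norm_one_unit_const cf uc.
have key x : sval (hom_div chi (dpt x)) =
    sval (hom_div chi' (dpt x)) * d ^+ pdeg K x.
  have := nw x; rewrite -[sval (a - a' - c)]/(sval a - sval a' - sval c).
  rewrite !norm_resB// na na' dE => H.
  by rewrite -[LHS]divr1 -H; field; rewrite !mulgrp_neq0 expf_neq0.
have d1 : d = 1.
  have := key x0; rewrite /hom_div div0_proj_dpt0 x0_rational expr1.
  have h0 (ch : Hom) : sval ch (div_class 0) = 0.
    by have := homgrB ch (div_class 0) (div_class 0); rewrite -div_classB !subrr.
  by rewrite !h0 mulgrp0 mul1r => <-.
apply: homgrP => D; apply: val_inj => /=.
rewrite -(divprod_hom D (@hom_divB chi) (fun=> erefl)).
rewrite -(divprod_hom D (@hom_divB chi') (fun=> erefl)).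
by apply: eq_fsbigr => x _; rewrite key d1 expr1n mulr1.
Qed.

(* An element of the kernel is the class of some [f * u] with [u] a unit
   idele, which is orthogonal to the functions by Weil reciprocity; hence
   [D |-> <u, D>] factors through [Pic0]. *)
Lemma kernel_represented a : bclass a \in Perp ->
  div_class (idele1_div a) = 0 ->
  exists chi b (bP : bclass b \in Perp) (aP : bclass a \in Perp),
    represents b chi /\ perp_class (exist _ (bclass b) bP) = perp_class (exist _ (bclass a) aP).
Proof.
move=> aP da.
have : div_class (idele1_div a) = div_class 0.
  by rewrite da -(subrr (div_class 0)) -div_classB subrr.
move=> /div_class_eq; rewrite subr0 => /asboolP[f f0 fE].
have [c cE] := exists_principal_idele K kX f0.
have cf : is_principal c f by split.
pose w := a - c.
have uw : unit_idele (sval w).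
  move=> x; have vP := lvalP (K x).
  rewrite -[icoord _ x]/(icoord (sval a) x / icoord (sval c) x).
  rewrite (dvalM vP) ?invr_eq0 ?icoord_neq0// (dvalV vP) ?icoord_neq0//.
  by rewrite cE lval_embedE// -[v x _]/(sval (sval (idele1_div a)) x) fE subrr.
have wP g : g != 0 -> divprod (norm_res (sval w)) (fdiv g) = 1.
  move=> g0; have [d dE] := exists_principal_idele K kX g0.
  have dg : is_principal d g by split.
  rewrite -(principal_idele_div dg) -pairing_unit//.
  rewrite -[sval w]/(sval a - sval c) pairingBl (pairing_principal kX cf dg).
  by rewrite divr1; have /perpP/(_ d g dg) := aP.
have nw x : norm_res (sval w) x != 0 by exact: norm_res_neq0.
pose psi D : mulgrp k :=
  exist _ (divprod (norm_res (sval w)) D) (divprod_neq0 D nw).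
have psiB D E : psi (D - E) = psi D - psi E.
  by apply: val_inj; rewrite /= divprodB.
have psi_wd (D E : Div0 K) : div_class D = div_class E ->
    psi (sval D) = psi (sval E).
  move=> /div_class_eq/asboolP[g g0 gE]; apply/eqP; rewrite -subr_eq0 -psiB.
  apply/eqP; apply: val_inj => /=; rewrite -[RHS](wP g g0); congr divprod.
  by apply: div_ext => x; rewrite (fdivE K)//; exact: gE.
pose ch (p : Pic0 K) := psi (sval (repr p)).
have chE (D : Div0 K) : ch (div_class D) = psi (sval D).
  by apply: psi_wd; rewrite /div_class reprK.
have chB : zmod_morphism ch.
  move=> p q; have [[D <-] [E <-]] := (div_class_surj p, div_class_surj q).
  by rewrite -div_classB !chE -psiB.
pose chi : Hom := exist _ ch (asboolT chB).
have [b bR] := exists_represents chi.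
exists chi, b, (represents_perp bR), aP; split=> //.
apply/perp_class_eq.
(* Since [chi] is extended with value 1 at [x0], the norms of [b] are those of [w] divided by
   [e^(deg x)]. The constant [e^-1] accounts exactly for this discrepancy. *)
pose e := norm_res (sval w) x0.
have e0 : e != 0 by exact: nw.
have ce0 : constf X e^-1 != 0 :> F by rewrite fmorph_eq0 invr_eq0.
have [d dE] := exists_principal_idele K kX ce0.
have [ub nb] := bR.
have ud : unit_idele (sval d).
  by move=> x; rewrite dE lval_embedE// vv_const// invr_eq0.
exists (d - c), (constf X e^-1 / f); split.
  split; first by rewrite mulf_neq0// invr_eq0.
  move=> x; rewrite -[LHS]/(icoord (sval d) x / icoord (sval c) x) dE cE.
  by rewrite -fmorphV -(rmorphM (embed (K x))).
have -> : b - a - (d - c) = b - w - d by rewrite /w !opprB !addrA (addrAC b).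
have ubw : unit_idele (sval b - sval w) by exact/unit_ideleD/unit_ideleN.
split; first exact/unit_ideleD/unit_ideleN.
move=> x; rewrite -[sval (b - w - d)]/(sval b - sval w - sval d).
rewrite (norm_resB x ubw ud) (norm_resB x ub uw).
have -> : norm_res (sval b) x =
    divprod (norm_res (sval w)) (dpt x - dpt x0 *~ deg (dpt x)).
  rewrite nb; exact: congr1 (chE (div0_proj (dpt x))).
rewrite (norm_res_const (dE x)) div_degree_dpt.
rewrite divprodB// divprod_dpt.
have -> : divprod (norm_res (sval w)) (dpt x0 *~ (pdeg K x)%:Z) = e ^+ pdeg K x.
  rewrite -pmulrn; elim: (pdeg K x) => [|n IHn]; first by rewrite divprod0.
  by rewrite mulrS divprodD// IHn divprod_dpt exprS.
rewrite exprVn; field.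
by rewrite nw oner_neq0 expf_neq0.
Qed.

Lemma mulgrpMn (u : mulgrp k) n : sval (u *+ n) = sval u ^+ n.
Proof. by elim: n => [//|n IHn]; rewrite mulrS mulgrpD IHn exprS. Qed.

Lemma divprod_pow (d : k) D : d != 0 -> deg D = 0 ->
  divprod (fun x => d ^+ pdeg K x) D = 1.
Proof.
move=> d0 D0; pose dm : mulgrp k := exist _ d d0.
rewrite (@divprod_hom _ _ (fun D => dm *~ deg D)); first by rewrite D0.
  by move=> D1 D2; rewrite div_degreeB mulrzBr.
by move=> x; rewrite div_degree_dpt -pmulrn mulgrpMn.
Qed.

Lemma delta_surjective (kc : GRing.closed_field_axiom k) (D : Div0 K) :
  exists a (aP : bclass a \in Perp), idele1_div a = D.
Proof.
have [|a0 a0E] := exists_idele K (fun x => unifX_neq0 x (sval (sval D) x)).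
  have /asboolP := svalP (sval D); apply: sub_finite_set => x /=.
  by rewrite vv_unifX.
have a0D : idele_div a0 = sval D.
  apply: div_ext => x; rewrite -[LHS]/(v x (icoord a0 x)) a0E.
  by rewrite lval_embedE ?unifX_neq0// vv_unifX.
have [|a aE] := @idele1_of _ _ K a0.
  by rewrite a0D; apply/eqP; exact: (svalP D).
(* The graph of [(f) |-> <a, f>^-1] on principal divisors. *)
pose A := [set fc : Div * mulgrp k | exists b f, [/\ is_principal b f,
  fc.1 = fdiv f & sval fc.2 * pairing (sval a) (sval b) = 1]].
have hA : partial_hom A.
  split.
  - exists 0, 1; split=> /=.
    + by split=> [|x]; rewrite ?oner_neq0// icoord0 rmorph1.
    + apply: div_ext => x; rewrite (fdivE K) ?oner_neq0//.
      by rewrite (dval1 (vvP x)).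
    by rewrite mul1r; have := pairingC (sval a) 0; rewrite pairing0l mulr1.
  - move=> [D1 c1] [D2 c2] [b1 [f1 [bf1 /= -> e1]]] [b2 [f2 [bf2 /= -> e2]]].
    have [[f10 b1E] [f20 b2E]] := (bf1, bf2).
    exists (b1 - b2), (f1 / f2); split=> /=.
    + split=> [|x]; first by rewrite mulf_neq0// invr_eq0.
      rewrite -[LHS]/(icoord (sval b1) x / icoord (sval b2) x) b1E b2E.
      by rewrite -fmorphV -(rmorphM (embed (K x))).
    + by rewrite (fdivM K) ?invr_eq0// (fdivV K).
    have pB : pairing (sval a) (sval b1 - sval b2) =
        pairing (sval a) (sval b1) / pairing (sval a) (sval b2).
      have P2 := pairingC (sval a) (sval b2); have P1 := pairingC (sval a) (sval b1).
      have P := pairingC (sval a) (sval b1 - sval b2).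
      have inv (u w : k) : u * w = 1 -> u = w^-1.
        move=> uw; have w0 : w != 0.
          by apply: contra_eq_neq uw => ->; rewrite mulr0 eq_sym oner_neq0.
        by apply: (mulIf w0); rewrite uw mulVf.
      by rewrite (inv _ _ P) pairingBl (inv _ _ P1) (inv _ _ P2) invfM invrK.
    rewrite [pairing _ _]pB.
    by rewrite mulrACA e1 mul1r -invfM e2 invr1.
  (* Single-valuedness: a function with zero divisor is a constant [d], and its pairing with [a] is
     [d] to the degree of the divisor of [a], which is zero. *)
  move=> c [b [f [bf /= f0E ce]]]; apply: val_inj => /=.
  have [f0 bE] := bf.
  have ub : unit_idele (sval b).
    move=> x; rewrite bE lval_embedE// -(fdivE K x f0) -f0E.
    by [].
  have [d d0 dE] := norm_one_unit_const bf ub.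
  have pba : pairing (sval b) (sval a) = 1.
    rewrite pairing_unit// aE a0D -[RHS](divprod_pow d0 (eqP (svalP D))).
    by apply: eq_fsbigr => x _; rewrite dE.
  by have := pairingC (sval b) (sval a); rewrite pba mul1r => pab;
    rewrite pab mulr1 in ce.
have kdiv (n : nat) (c : mulgrp k) : (0 < n)%N -> exists d, d *+ n = c.
  move=> n0; have [d dE] := closed_field_root (sval c) kc n0.
  have d0 : d != 0.
    apply: contra_neq (mulgrp_neq0 c) => d0.
    by rewrite -dE d0 expr0n -[_ == 0%N]negbK -lt0n n0.
  by exists (exist _ d d0); apply: val_inj;
    apply: etrans dE; exact: mulgrpMn.
have [psi [psiB psiA]] := hom_extension kdiv hA.
(* The unit idele [u] realizes [psi], so it pairs with a function [f] to [<a, f>^-1]; adding it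
   makes [a] orthogonal to functions without changing its divisor. *)
have [u [uu nu]] := exists_unit_idele (K := K) norm_surj
  (fun x => mulgrp_neq0 (psi (dpt x))).
have aP : bclass (a + u) \in Perp.
  apply/perpP => b f bf; rewrite -[sval (a + u)]/(sval a + sval u) pairingDl.
  rewrite (pairing_unit _ uu) (principal_idele_div bf) (divprod_hom _ psiB nu).
  have [f0 _] := bf.
  pose c : mulgrp k := exist _ (pairing (sval a) (sval b))^-1
    (invr_neq0 (pairing_neq0 (sval a) (sval b))).
  rewrite (psiA _ c); first by rewrite mulfV ?pairing_neq0.
  by exists b, f; split=> //=; rewrite mulVf ?pairing_neq0.
exists (a + u), aP; apply: val_inj; apply: div_ext => x.
rewrite -[LHS]/(v x (icoord (sval a) x * icoord (sval u) x)).
rewrite (dvalM (lvalP (K x))) ?icoord_neq0// uu addr0 aE.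
by rewrite -[LHS]/(sval (idele_div a0) x) a0D.
Qed.

End ExactSequence.

Lemma is_complex_closed (k : fieldType) : is_complex k ->
  GRing.closed_field_axiom k.
Proof.
move=> [R [phi [psi phiK psiK]]] n P n0.
have [z zE] := @solve_monicpoly R[i] n (fun i => phi (P i)) n0.
exists (psi z); apply: (can_inj phiK); rewrite rmorphXn psiK zE rmorph_sum.
by apply: eq_bigr => i _; rewrite rmorphM rmorphXn psiK.
Qed.

Theorem theorem5p5 (k : fieldType) (X : curve k)
    (K : forall x : closed_point X, completion x) :
  perfect_field k ->
  alg_closed_in_fun_field X ->
  has_rational_point K ->
  finite_set [set: k] \/ GRing.closed_field_axiom k ->
  exists (iota : {additive Homgr (Pic0 K) (mulgrp k) -> perp_quot K})
         (delta : {additive perp_quot K -> Pic0 K}),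
    [/\ (forall (a : idele1 K) (aP : bclass a \in perp (principal_ideles K)),
           delta (perp_class (exist _ (bclass a) aP)) = div_class (idele1_div a)),
        injective iota,
        (forall q, delta q = 0 <-> exists chi, iota chi = q) &
        is_complex k -> forall p, exists q, delta q = p].
Proof.
move=> _ kX [x0 x0_rat] kfc.
have norm_surj x (c : k) : c != 0 -> exists l : rfield (K x), normf l = c.
  case: kfc => [kf|kc] c0; first exact: normf_surj_finite.
  exact: normf_surj_closed.
have [iota iotaP] := exists_iota kX x0_rat norm_surj.
have [delta deltaP] := exists_delta K.
exists iota, delta; split=> //.
- exact: (iota_injective kX norm_surj iotaP).
- move=> q; split=> [|[chi <-]].
    have [a [aP <-]] := perp_class_surj q; rewrite deltaP => da.
    have [chi [b [bP [aP' [bR E]]]]] := kernel_represented kX x0_rat norm_surj aP da.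
    by exists chi; rewrite (iotaP _ _ bP bR) E (Prop_irrelevance aP' aP).
  have [a aR] := exists_represents x0_rat norm_surj chi.
  have aP := represents_perp kX aR; rewrite (iotaP _ _ aP aR) deltaP.
  have -> : idele1_div a = 0.
    by apply: val_inj; apply: div_ext => x; case: aR => ua _; exact: ua.
  by rewrite -(subrr (0 : Div0 K)) div_classB subrr.
move=> /is_complex_closed kc p; have [D <-] := div_class_surj p.
have [a [aP <-]] := delta_surjective kX norm_surj kc D.
by exists (perp_class (exist _ (bclass a) aP)).
Qed.
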